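(* Let $d,r\in\mathbb{N}$ and let $\sigma\in C^r(\mathbb{R})$ be $r$-finite. Let $U=U_p\times U_q\subseteq\mathbb{R}^{2d}$ be open and $H(p,q,t)=K(p,t)+V(q,t)$ with $K\in C^{r+1}(U_p\times\mathbb{R})$, $V\in C^{r+1}(U_q\times\mathbb{R})$. Let $\Phi(h,t_0,x_0)$ denote the solution at time $t_0+h$ of $\dot x=J^{-1}\nabla_xH(x,t)$, $x(t_0)=x_0$, assumed to exist in $U$ for all $h,t_0\ge0$, $x_0\in U$. Then for every $T>0$, compact $W_t\subseteq[0,\infty)$, compact $W\subseteq U$ and $\epsilon>0$ there is an NATG-SympNet $\psi$ such that, writing $\psi_x(h,t,x)\in\mathbb{R}^{2d}$ for its phase-space component, $$\|\Phi-\psi_x\|_{C^r([0,T]\times W_t\times W;\mathbb{R}^{2d})}<\epsilon.$$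
   Context: $J=\begin{pmatrix}0&I_d\\-I_d&0\end{pmatrix}$. $\sigma$ is $r$-finite if $0<\int_\mathbb{R}|\sigma^{(r)}(x)|\,dx<\infty$; applied componentwise. For width $n$, $K_0\in\mathbb{R}^{n\times d}$, $a,b,c\in\mathbb{R}^n$ let $\hat\sigma(y,t)=K_0^T\operatorname{diag}(a)\sigma(K_0y+ct+b)$. For $m\in\mathbb{N}$ the non-autonomous gradient modules are $u^{(m)}_{up}(h,t,(p,q))=\big(t+\tfrac hm,\ (p+h\hat\sigma(q,t),\,q)\big)$ and $u^{(m)}_{low}(h,t,(p,q))=\big(t+\tfrac hm,\ (p,\,q+h\hat\sigma(p,t))\big)$. An NATG-SympNet is any map $\psi(h,t,x)=(u_m(h,\cdot,\cdot)\circ\dots\circ u_1(h,\cdot,\cdot))(t,x)$ with $m\in\mathbb{N}$ and each $u_j$ an upper or lower module of this form with the same $m$ (each with its own parameters); its output is $(t+h,\psi_x(h,t,x))$. Norm: sum over all partial derivatives of order $\le r$ in $(h,t,x)$ of the sup over the domain of the maximal component. *)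

(* Defs.v *)
From HB Require Import structures.
From mathcomp Require Import all_boot all_order all_algebra.
From mathcomp Require Import all_classical all_reals all_analysis.
Set Implicit Arguments. Unset Strict Implicit. Unset Printing Implicit Defensive.
Import Order.TTheory GRing.Theory Num.Theory.
Import numFieldNormedType.Exports.
Local Open Scope classical_set_scope.
Local Open Scope ring_scope.

Section Defs.
Variable R : realType.

Definition pd (n : nat) (i : 'I_n) (f : 'cV[R]_n -> R) : 'cV[R]_n -> R :=
  fun x => 'D_(delta_mx i ord0) f x.

Fixpoint Ck (n : nat) (k : nat) (A : set 'cV[R]_n) (f : 'cV[R]_n -> R) {struct k}
  : Prop :=
  match k with
  | 0 => forall x, A x -> {for x, continuous f}
  | k'.+1 => (forall x, A x -> {for x, continuous f}) /\
             forall i : 'I_n, (forall x, A x -> derivable f x (delta_mx i ord0)) /\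
                              Ck k' A (pd i f)
  end.

Definition CrR (r : nat) (s : R -> R) : Prop :=
  (forall k, (k < r)%N -> forall x, derivable (derive1n k s) x 1) /\
  continuous (derive1n r s).

Definition rfinite (r : nat) (s : R -> R) : Prop :=
  (0 < \int[lebesgue_measure]_(x in [set: R]) (`|derive1n r s x|)%:E)%E /\
  (\int[lebesgue_measure]_(x in [set: R]) (`|derive1n r s x|)%:E < +oo)%E.

Definition dalpha (n : nat) (alpha : 'I_n -> nat) (f : 'cV[R]_n -> R) :
  'cV[R]_n -> R :=
  foldr (fun i g => iter (alpha i) (pd i) g) f (enum 'I_n).

Definition gradc (n : nat) (f : 'cV[R]_n -> R) (x : 'cV[R]_n) : 'cV[R]_n :=
  \col_i 'D_(delta_mx i ord0) f x.

Definition Jmx (d : nat) : 'M[R]_(d + d) := block_mx 0 1%:M (- 1%:M) 0.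

Definition Ham (d : nat) (K V : 'cV[R]_d -> R -> R) (x : 'cV[R]_(d + d)) (t : R)
  : R := K (usubmx x) t + V (dsubmx x) t.

Definition hamF (d : nat) (K V : 'cV[R]_d -> R -> R) (x : 'cV[R]_(d + d)) (t : R)
  : 'cV[R]_(d + d) :=
  invmx (Jmx d) *m gradc (fun y => Ham K V y t) x.

Definition prodU (d : nat) (Up Uq : set 'cV[R]_d) : set 'cV[R]_(d + d) :=
  [set x | Up (usubmx x) /\ Uq (dsubmx x)].

Definition pack (d : nat) (h t : R) (x : 'cV[R]_(d + d)) : 'cV[R]_(1 + 1 + (d + d)) :=
  col_mx (col_mx h%:M t%:M) x.
Definition zh (d : nat) (z : 'cV[R]_(1 + 1 + (d + d))) : R := usubmx (usubmx z) ord0 ord0.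
Definition zt (d : nat) (z : 'cV[R]_(1 + 1 + (d + d))) : R := dsubmx (usubmx z) ord0 ord0.
Definition zx (d : nat) (z : 'cV[R]_(1 + 1 + (d + d))) : 'cV[R]_(d + d) := dsubmx z.

Definition uncurry_t (d : nat) (K : 'cV[R]_d -> R -> R) : 'cV[R]_(d + 1) -> R :=
  fun z => K (usubmx z) (dsubmx z ord0 ord0).

Record natg_module (d : nat) := NATGModule {
  nm_up : bool;
  nm_n : nat;
  nm_K0 : 'M[R]_(nm_n, d);
  nm_a : 'rV[R]_nm_n;
  nm_b : 'cV[R]_nm_n;
  nm_c : 'cV[R]_nm_n }.

Definition hat_sigma (d : nat) (s : R -> R) (u : natg_module d) (y : 'cV[R]_d) (t : R)
  : 'cV[R]_d :=
  (nm_K0 u)^T *m diag_mx (nm_a u) *m map_mx s (nm_K0 u *m y + t *: nm_c u + nm_b u).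

Definition module_step (d : nat) (s : R -> R) (m : nat) (u : natg_module d) (h : R)
  (tx : R * 'cV[R]_(d + d)) : R * 'cV[R]_(d + d) :=
  let t := tx.1 in let p := usubmx tx.2 in let q := dsubmx tx.2 in
  (t + h / m%:R,
   if nm_up u then col_mx (p + h *: hat_sigma s u q t) q
   else col_mx p (q + h *: hat_sigma s u p t)).

Definition natg_psi (d : nat) (s : R -> R) (us : seq (natg_module d)) (h t : R)
  (x : 'cV[R]_(d + d)) : R * 'cV[R]_(d + d) :=
  foldl (fun tx u => module_step s (size us) u h tx) (t, x) us.

Definition natg_psi_x (d : nat) (s : R -> R) (us : seq (natg_module d)) (h t : R)
  (x : 'cV[R]_(d + d)) : 'cV[R]_(d + d) := (natg_psi s us h t x).2.

Definition mindex_le (n r : nat) (alpha : {ffun 'I_n -> 'I_r.+1}) : bool :=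
  (\sum_(i < n) (alpha i : nat) <= r)%N.

(* ||G||_{C^r(Dom)} < eps, where G : R^n -> R^k (componentwise);
   sum over |alpha| <= r of sup_{z in Dom} max_j |d^alpha G_j (z)| < eps,
   expressed with explicit upper bounds M alpha for the suprema *)
Definition Cr_norm_lt (n k r : nat) (Dom : set 'cV[R]_n) (G : 'cV[R]_n -> 'cV[R]_k)
  (eps : R) : Prop :=
  exists M : {ffun 'I_n -> 'I_r.+1} -> R,
    (forall alpha, mindex_le alpha -> forall z, Dom z -> forall j : 'I_k,
       `| dalpha (fun i => (alpha i : nat)) (fun z => G z j ord0) z | <= M alpha) /\
    \sum_(alpha | mindex_le alpha) M alpha < eps.

End Defs.

(* Main.v *)
(* An up module followed by a low module with the same parameter [m = 2N] moves
   time by [h/N] and acts on [(p, q)] as one step of the symplectic Euler scheme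
   for the Hamiltonian [K + V], provided that the gradients of [K] and [V] are
   replaced by gradients of one-hidden-layer networks.  In the state [(h, t, x)],
   rescaled to unit time, [N] such steps are an Euler scheme [x + F_N x / N] with
   varying fields [F_N], and everything reduces to two facts.

   Convergence of the scheme.  A sequence [f_N] converges continuously at [x] when
   [f_N x_N --> l] whenever [x_N --> x].  If [F_N] converges continuously, together
   with its partial derivatives of order at most [r], then so do the [N]-fold
   iterates: for [r = 0] this is the compactness argument of Peano and uniqueness
   of the limiting solution, and the Jacobian of the iterate is itself computed by
   the Euler scheme of the tangent lift [(x, v) |-> (F_N x, DF_N x v)], which gives
   the induction on [r].  A limit of this kind is automatically of class [C^r], so
   no regularity of the flow needs to be known in advance.

   Density of networks.  Let [S' = sigma].  Since [sigma^(r)] is integrable and not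
   identically zero, no iterated difference [Delta^m S] vanishes identically.
   Averages of translates of ridge functions [S (w.z + b)] give ridge functions of
   class [C^(k+m)] with [m]-th derivative [Delta^m S]; differentiating these [m]
   times in [w] at [w = 0] gives all monomials, and Bernstein polynomials, one
   coordinate at a time, give all [C^k] functions in the [C^k] topology of compact
   sets. *)

Require Import Defs.
From HB Require Import structures.
From mathcomp Require Import all_boot all_order all_algebra.
From mathcomp Require Import all_classical all_reals all_analysis.
From mathcomp Require Import measurable_realfun.
From mathcomp Require Import ring lra.
Set Implicit Arguments. Unset Strict Implicit. Unset Printing Implicit Defensive.
Import Order.TTheory GRing.Theory Num.Theory.
Import numFieldNormedType.Exports.
Local Open Scope classical_set_scope.
Local Open Scope ring_scope.

(** * Continuous convergence *)

(** For [r = 0] the limiting field is merely continuous, so no Lipschitz estimate is available: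
    uniqueness for the Hamiltonian system is taken from [Huniq], and for the tangent lifts it is
    recovered from linearity in [v] by Gronwall's inequality. Moreover the network fields converge
    only over the open set [U], and nothing prevents an iterate a priori from leaving it. The fields
    are therefore multiplied by a cut-off supported in a tube around the exact orbit; the modified
    scheme converges to that orbit, hence ends up where the cut-off is 1 and coincides with the
    original scheme. Derivatives at [h = 0] call for an open set of states, so orbits are followed
    for [h] of either sign inside [D]. The Bernstein operator acts on sequences of functions because
    its derivative in the distinguished coordinate is such an operator again, applied to a
    difference quotient whose step depends on the index. Iterated differences of [S] express that
    [S] is not a polynomial in the form that averaging produces and that periodicity can refute. *)

Section ContinuousConvergence.
Variable R : realType.

(** The product filter stands for the sequences [x_N]: limit lemmas for sums, products and norms
    apply directly, and compactness of a set of points turns the notion into a uniform estimate. *)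
Definition ccvg (V : normedModType R) n (f : nat -> 'cV[R]_n -> V) (x : 'cV[R]_n)
    (l : V) : Prop :=
  (fun p => f p.1 p.2) @ filter_prod \oo (nbhs x) --> l.

Definition evnear n (x : 'cV[R]_n) (P : nat -> 'cV[R]_n -> Prop) : Prop :=
  \forall p \near filter_prod \oo (nbhs x), P p.1 p.2.

Lemma coord_le_norm m n (M : 'M[R]_(m, n)) i j : `|M i j| <= `|M|.
Proof.
rewrite [leRHS]/Num.norm /= mx_normrE; apply/bigmax_geP; right => /=.
by exists (i, j).
Qed.

Lemma mx_norm_le m n (M : 'M[R]_(m, n)) e :
  0 <= e -> (forall i j, `|M i j| <= e) -> `|M| <= e.
Proof.
move=> e0 H; rewrite [leLHS]/Num.norm /= mx_normrE.
by apply/bigmax_leP; split => // -[i j] _ /=.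
Qed.

Lemma cvg_mx (T : Type) (F : set_system T) {FF : Filter F} m n
    (f : T -> 'M[R]_(m, n)) (l : 'M[R]_(m, n)) :
  (forall i j, (fun t => f t i j) @ F --> l i j) -> f @ F --> l.
Proof.
move=> H; apply/cvgrPdist_le => e e0.
have : \forall t \near F, forall ij : 'I_m * 'I_n, `|l ij.1 ij.2 - f t ij.1 ij.2| <= e.
  apply: filter_forall => -[i j] /=.
  by move/cvgrPdist_le : (H i j) => /(_ _ e0).
apply: filterS => t Ht; apply: mx_norm_le; first exact: ltW.
by move=> i j; have := Ht (i, j); rewrite !mxE.
Qed.

Lemma ccvg_mx n m (f : nat -> 'cV[R]_n -> 'cV[R]_m) x (l : 'cV[R]_m) :
  (forall j, ccvg (fun N y => f N y j ord0) x (l j ord0)) -> ccvg f x l.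
Proof. by move=> H; apply: cvg_mx => i j; rewrite ord1; exact: H. Qed.

Lemma ccvg_coord n m (f : nat -> 'cV[R]_n -> 'cV[R]_m) x l j :
  ccvg f x l -> ccvg (fun N y => f N y j ord0) x (l j ord0).
Proof.
move=> H; apply: (cvg_comp _ (fun v : 'cV[R]_m => v j ord0) H).
exact: coord_continuous.
Qed.

Lemma cvg_to_filter_prod (T U V : Type) (F : set_system T) (G : set_system U)
    (H : set_system V) (f : T -> U) (g : T -> V) : Filter F ->
  f @ F --> G -> g @ F --> H -> (fun t => (f t, g t)) @ F --> filter_prod G H.
Proof.
move=> FF fG gH P [[A B] /= [GA HB] AB].
have fA : F (f @^-1` A) := fG _ GA; have gB : F (g @^-1` B) := gH _ HB.
have sub : f @^-1` A `&` g @^-1` B `<=` (fun t => (f t, g t)) @^-1` P.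
  by move=> t [At Bt]; apply: (AB (f t, g t)).
exact: (filterS sub (filterI fA gB)).
Qed.

Lemma evnear_comp n m (f : nat -> 'cV[R]_n -> 'cV[R]_m) x y P : ccvg f x y ->
  evnear y P -> evnear x (fun N z => P N (f N z)).
Proof.
move=> H Hp.
have : (fun p => (p.1, f p.1 p.2)) @ filter_prod \oo (nbhs x)
  --> filter_prod \oo (nbhs y) by apply: cvg_to_filter_prod => //; exact: cvg_fst.
move=> H2; exact: (H2 _ Hp).
Qed.

Lemma ccvg_comp n m (V : normedModType R) (f : nat -> 'cV[R]_n -> 'cV[R]_m)
    (g : nat -> 'cV[R]_m -> V) x y l : ccvg f x y -> ccvg g y l ->
  ccvg (fun N z => g N (f N z)) x l.
Proof.
move=> H Hg.
have : (fun p => (p.1, f p.1 p.2)) @ filter_prod \oo (nbhs x)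
  --> filter_prod \oo (nbhs y) by apply: cvg_to_filter_prod => //; exact: cvg_fst.
move=> H2 P /Hg HP; exact: (H2 _ HP).
Qed.

Lemma ccvg_unique (V : normedModType R) n (f : nat -> 'cV[R]_n -> V) x l l' :
  ccvg f x l -> ccvg f x l' -> l = l'.
Proof. exact: cvg_unique. Qed.

Lemma ccvg_id n (x : 'cV[R]_n) : ccvg (fun _ z => z) x x.
Proof. exact: cvg_snd. Qed.

Lemma ccvg_cst (V : normedModType R) n (f : 'cV[R]_n -> V) x :
  {for x, continuous f} -> ccvg (fun _ => f) x (f x).
Proof.
move=> Hf P /Hf HP.
exact: (@cvg_snd _ _ \oo (nbhs x) _ _ HP).
Qed.

Lemma ccvg_seq (V : normedModType R) n (f : nat -> V) (x : 'cV[R]_n) l :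
  f @ \oo --> l -> ccvg (fun N _ => f N) x l.
Proof. by move=> Hf; apply: cvg_comp Hf; exact: cvg_fst. Qed.

Lemma evnear_near n (x : 'cV[R]_n) P : evnear x P ->
  evnear x (fun N z => \forall w \near z, P N w).
Proof.
move=> [[A B]] /= [HA HB] H.
exists (A, [set z | nbhs z B]) => /=.
  split => //; exact: nbhs_interior.
move=> [N z] /= [AN Bz]; apply: filterS Bz => w Bw.
by apply: (H (N, w)).
Qed.

Lemma evnear_seq n (x : 'cV[R]_n) P : evnear x P ->
  \forall N \near \oo, \forall z \near x, P N z.
Proof.
move=> [[A B]] /= [HA HB] H.
apply: filterS HA => N AN; apply: filterS HB => z Bz.
exact: (H (N, z)).
Qed.

Lemma evnear_snd n (x : 'cV[R]_n) (P : set 'cV[R]_n) : nbhs x P ->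
  evnear x (fun _ z => P z).
Proof. by move=> H; exists (setT, P) => /=; [split => //; exact: filterT|move=> [N z] [_ ?]]. Qed.

Lemma evnear_fst n (x : 'cV[R]_n) (P : set nat) : (\forall N \near \oo, P N) ->
  evnear x (fun N _ => P N).
Proof. by move=> H; exists (P, setT) => /=; [split => //; exact: filterT|move=> [N z] [? _]]. Qed.

Lemma ccvg_ext (V : normedModType R) n (f g : nat -> 'cV[R]_n -> V) x l :
  evnear x (fun N z => f N z = g N z) -> ccvg f x l -> ccvg g x l.
Proof.
move=> H; apply: cvg_trans; apply: near_eq_cvg.
by apply: filterS H => p.
Qed.

(** For one large [N], [f N z] is close to [g x] because [z] is near [x], and close to [g z] by
    convergence at [z] itself. *)
Lemma ccvg_limit_continuous (V : normedModType R) n (f : nat -> 'cV[R]_n -> V)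
    (g : 'cV[R]_n -> V) x :
  (\forall z \near x, ccvg f z (g z)) -> ccvg f x (g x) -> {for x, continuous g}.
Proof.
move=> Hn Hx; apply/(@cvgrPdist_le _ _ _ (nbhs x)) => e e0.
have e20 : 0 < e / 2 by rewrite divr_gt0.
have /evnear_seq H1 : evnear x (fun N z => `|g x - f N z| <= e / 2).
  by move/cvgrPdist_le : Hx; apply.
have H2 : evnear x (fun N z => `|g x - f N z| <= e / 2).
  by move/cvgrPdist_le : Hx; apply.
have [[A B] /= [HA HB] HAB] := H2.
near=> z.
have Hz : ccvg f z (g z) by near: z.
have /evnear_seq H3 : evnear z (fun N w => `|g z - f N w| <= e / 2).
  by move/cvgrPdist_le : Hz; apply.
near \oo => N.
have Hgz : `|g z - f N z| <= e / 2.
  suff : \forall w \near z, `|g z - f N w| <= e / 2 by apply: nbhs_singleton.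
  by near: N.
have Hgx : `|g x - f N z| <= e / 2.
  by apply: (HAB (N, z)); split => /=; [near: N|near: z].
rewrite (_ : g x - g z = (g x - f N z) - (g z - f N z)); last first.
  by rewrite opprB addrA subrK.
by rewrite (le_trans (ler_normB _ _))// [leRHS](splitr e) lerD.
Unshelve. all: by end_near. Qed.

Lemma ccvgD (V : normedModType R) n (f g : nat -> 'cV[R]_n -> V) x l m :
  ccvg f x l -> ccvg g x m -> ccvg (fun N z => f N z + g N z) x (l + m).
Proof. exact: cvgD. Qed.

Lemma ccvgN (V : normedModType R) n (f : nat -> 'cV[R]_n -> V) x l :
  ccvg f x l -> ccvg (fun N z => - f N z) x (- l).
Proof. exact: cvgN. Qed.

Lemma ccvgB (V : normedModType R) n (f g : nat -> 'cV[R]_n -> V) x l m :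
  ccvg f x l -> ccvg g x m -> ccvg (fun N z => f N z - g N z) x (l - m).
Proof. exact: cvgB. Qed.

Lemma ccvgM n (f g : nat -> 'cV[R]_n -> R) x l m :
  ccvg f x l -> ccvg g x m -> ccvg (fun N z => f N z * g N z) x (l * m).
Proof. exact: cvgM. Qed.

Lemma ccvgZ (V : normedModType R) n (f : nat -> 'cV[R]_n -> R)
    (g : nat -> 'cV[R]_n -> V) x l m :
  ccvg f x l -> ccvg g x m -> ccvg (fun N z => f N z *: g N z) x (l *: m).
Proof. exact: cvgZ. Qed.

Lemma cvg_fsum (T I : Type) (F : set_system T) {FF : Filter F} (s : seq I)
    (P : pred I) (V : normedModType R) (f : I -> T -> V) (l : I -> V) :
  (forall i, f i @ F --> l i) ->
  (fun t => \sum_(i <- s | P i) f i t) @ F --> \sum_(i <- s | P i) l i.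
Proof.
move=> H; elim: s => [|i s IH].
  by rewrite big_nil; under eq_fun do rewrite big_nil; exact: cvg_cst.
rewrite big_cons; under eq_fun do rewrite big_cons.
by case: ifPn => Pi //; exact: cvgD (H i) IH.
Qed.

Lemma ccvg_sum (I : Type) (s : seq I) (P : pred I) (V : normedModType R) n
    (f : I -> nat -> 'cV[R]_n -> V) x l :
  (forall i, ccvg (f i) x (l i)) ->
  ccvg (fun N z => \sum_(i <- s | P i) f i N z) x (\sum_(i <- s | P i) l i).
Proof. by move=> H; apply: (cvg_fsum (f := fun i p => f i p.1 p.2)). Qed.

End ContinuousConvergence.

(** * Differentiability in epsilon form and the chain rule for partial derivatives *)

Section Frechet.
Variable R : realType.

(** Replaces the library form, with a differential chosen by [get] and a little-o remainder, by an
    estimate for an explicit [L]. *)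
Lemma frechet_differentiable (V W : normedModType R) (f : V -> W) (x : V)
    (L : {linear V -> W}) : continuous L ->
  (forall e, 0 < e -> \forall y \near x, `|f y - f x - L (y - x)| <= e * `|y - x|) ->
  differentiable f x.
Proof.
move=> cL H; apply/diffP.
apply: (@getPex _ (fun (df : {linear V -> W}) => continuous df /\
  forall y, f y = f (lim (nbhs x)) + df (y - lim (nbhs x))
                  +o_(y \near x) (y - lim (nbhs x)))).
exists L; split => //; rewrite lim_id //; 
suff Hf : (f : V -> W) = (fun y => f x + L (y - x)) +o_x (fun y => y - x).
  by move=> y; rewrite {1}Hf.
apply/eqaddoP => e e0; apply: filterS (H e e0) => y /=.
by rewrite /= !fctE /= opprD addrA.
Qed.

Lemma differentiable_frechet (V W : normedModType R) (f : V -> W) (x : V) :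
  differentiable f x -> forall e, 0 < e ->
  \forall y \near x, `|f y - f x - 'd f x (y - x)| <= e * `|y - x|.
Proof.
move=> /diffP[cL]; rewrite lim_id // => H e e0.
have /eqaddoP /(_ e e0) : (f : V -> W) =
   (fun y => f x + 'd f x (y - x)) +o_x (fun y => y - x).
  by apply/funext => y; rewrite {1}H.
by apply: filterS => y; rewrite /= !fctE /= opprD addrA.
Qed.

Lemma near_eq_differentiable (V W : normedModType R) (f g : V -> W) (x : V) :
  (\forall y \near x, f y = g y) -> differentiable f x -> differentiable g x.
Proof.
move=> fg df.
apply: (@frechet_differentiable _ _ _ _ ('d f x)).
  exact: diff_continuous.
move=> e e0; have := differentiable_frechet df e0.
apply: filterS2 (fg) => y fgy.
by rewrite fgy (nbhs_singleton fg).
Qed.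

Lemma pd_near_eq n (f g : 'cV[R]_n -> R) i (x : 'cV[R]_n) :
  (\forall y \near x, f y = g y) -> pd i f x = pd i g x.
Proof. exact: near_eq_derive. Qed.

Lemma pdE n (f : 'cV[R]_n -> R) i x : differentiable f x ->
  pd i f x = 'd f x (delta_mx i ord0).
Proof. by move=> df; rewrite /pd deriveE. Qed.

Lemma cV_sum_delta n (x : 'cV[R]_n) : x = \sum_i x i ord0 *: delta_mx i ord0.
Proof.
rewrite [LHS]matrix_sum_delta; apply: eq_bigr => i _.
by rewrite big_ord1.
Qed.

Lemma diff_pd n (f : 'cV[R]_n -> R) x v : differentiable f x ->
  'd f x v = \sum_i v i ord0 * pd i f x.
Proof.
move=> df; rewrite {1}[v]cV_sum_delta linear_sum; apply: eq_bigr => i _.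
by rewrite linearZ pdE.
Qed.

Lemma differentiable_cV n m (F : 'cV[R]_n -> 'cV[R]_m) x :
  (forall j, differentiable (fun y => F y j ord0) x) -> differentiable F x.
Proof.
move=> H.
have -> : F = \sum_(j < m) (fun y => F y j ord0 *: delta_mx j ord0).
  by apply/funext => y; rewrite fct_sumE -cV_sum_delta.
apply: differentiable_sum => j; apply: differentiableZl; exact: H.
Qed.

Lemma pd_comp n m (F : 'cV[R]_n -> 'cV[R]_m) (g : 'cV[R]_m -> R) i x :
  (forall j, differentiable (fun y => F y j ord0) x) ->
  differentiable g (F x) ->
  pd i (fun y => g (F y)) x =
  \sum_j pd i (fun y => F y j ord0) x * pd j g (F x).
Proof.
move=> HF Hg; have dF := differentiable_cV HF.
rewrite pdE; last exact: (differentiable_comp dF Hg).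
rewrite (diff_comp dF Hg) /= diff_pd //; apply: eq_bigr => j _; congr (_ * _).
rewrite (pdE _ (HF j)).
have -> : (fun y => F y j ord0) = (fun M : 'cV[R]_m => M j ord0) \o F by [].
have dc : differentiable (fun M : 'cV[R]_m => M j ord0 : R) (F x).
  exact: differentiable_coord.
rewrite (diff_comp dF dc) /=.
rewrite /= -[LHS]/((fun M : 'cV[R]_m => M j ord0) _).
(* The coordinate is packed as a linear map so that [diff_lin] computes its differential. *)
have @f : {linear 'cV[R]_m -> R}.
  by exists (fun N : 'cV[R]_m => N j ord0); do 2![eexists]; do ?[constructor];
     rewrite ?mxE// => ? *; rewrite ?mxE//; move=> ?; rewrite !mxE.
have -> : (fun N : 'cV[R]_m => N j ord0) = f by [].
rewrite diff_lin //; exact: coord_continuous.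
Qed.

End Frechet.

(** * Mean values along lines, and differentiability from continuous partial derivatives *)

Section MeanValue.
Variable R : realType.

Lemma is_derive_line (V W : normedModType R) (f : V -> W) x v (s : R) :
  derivable f (s *: v + x) v ->
  is_derive s 1 (fun t : R => f (t *: v + x)) ('D_v f (s *: v + x)).
Proof.
have E : (fun h : R => h^-1 *: (((fun t : R => f (t *: v + x)) \o shift s) (h *: 1)
    - f (s *: v + x))) =
  (fun h : R => h^-1 *: ((f \o shift (s *: v + x)) (h *: v) - f (s *: v + x))).
  apply/funext => h; congr (_ *: (_ - _)) => /=; congr f.
  by rewrite [h *: 1]mulr1 scalerDl addrA.
by move=> H; split; rewrite /derivable /derive E.
Qed.

Lemma mvt_line (V : normedModType R) (f : V -> R) x v (h : R) :
  (forall s, `|s| <= `|h| -> derivable f (s *: v + x) v) ->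
  exists2 s, `|s| <= `|h| & f (h *: v + x) - f x = h * 'D_v f (s *: v + x).
Proof.
move=> H.
pose phi := fun t : R => f (t *: v + x).
have dphi (s : R) : `|s| <= `|h| -> is_derive s 1 phi ('D_v f (s *: v + x)).
  by move=> hs; exact: is_derive_line (H _ hs).
have cphi (s : R) : `|s| <= `|h| -> {for s, continuous phi}.
  move=> /dphi [d _]; apply: differentiable_continuous.
  exact/derivable1_diffP.
have [h0|h0|h0] := ltrgt0P h.
- have [||c + E] := @MVT R phi (fun s => 'D_v f (s *: v + x)) 0 h h0.
  + move=> s; rewrite in_itv /= => /andP[s0 sh]; apply: dphi.
    by rewrite !ger0_norm // ltW.
  + apply: continuous_in_subspaceT => s; rewrite inE /= in_itv /= => /andP[s0 sh].
    by apply: cphi; rewrite !ger0_norm // ltW.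
  rewrite in_itv /= => /andP[c0 ch]; exists c; first by rewrite !ger0_norm // ltW.
  by move: E; rewrite /phi scale0r add0r => ->; rewrite subr0 mulrC.
- have [||c + E] := @MVT R phi (fun s => 'D_v f (s *: v + x)) h 0 h0.
  + move=> s; rewrite in_itv /= => /andP[s0 sh]; apply: dphi.
    by rewrite !ler0_norm ?lerN2 // ltW.
  + apply: continuous_in_subspaceT => s; rewrite inE /= in_itv /= => /andP[s0 sh].
    apply: cphi; rewrite !ler0_norm ?lerN2 //; exact: ltW.
  rewrite in_itv /= => /andP[c0 ch]; exists c.
    by rewrite !ler0_norm ?lerN2 // ltW.
  apply/eqP; rewrite -eqr_opp; apply/eqP; move: E.
  by rewrite /phi scale0r add0r opprB => ->; rewrite sub0r mulrN mulrC.
- exists 0; first by rewrite normr0.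
  by rewrite h0 !scale0r add0r subrr mul0r.
Qed.

(** The move from [x] to [y] is made one coordinate at a time through the points [z k]; the mean
    value theorem turns each increment into a partial derivative taken near [x]. *)
Lemma partials_differentiable n (f : 'cV[R]_n -> R) (x : 'cV[R]_n) :
  (forall i, \forall y \near x, derivable f y (delta_mx i ord0)) ->
  (forall i, {for x, continuous (pd i f)}) -> differentiable f x.
Proof.
move=> Hd Hc.
pose Lf (v : 'cV[R]_n) : R := \sum_i v i ord0 * pd i f x.
have Llin : linear Lf.
  move=> a u v; rewrite /Lf scaler_sumr -big_split; apply: eq_bigr => i _ /=.
  by rewrite !mxE mulrDl -mulrA.
pose LM := GRing.isLinear.Build _ _ _ _ _ Llin.
pose L : {linear 'cV[R]_n -> R} := HB.pack Lf LM.
have cL : continuous L.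
  move=> v; rewrite /= /continuous_at.
  apply: (@cvg_fsum _ _ _ (nbhs v)) => i.
  apply: (@cvgM _ _ (nbhs v)); last exact: (@cvg_cst _ _ _ (nbhs v)).
  exact: coord_continuous.
apply: (frechet_differentiable cL) => e e0.
(* The successor keeps the denominator positive for [n = 0]; [n] such errors still sum to at most
   [e]. *)
have n0 : 0 < e / n.+1%:R by rewrite divr_gt0.
have HH i : \forall y \near x, derivable f y (delta_mx i ord0) /\
    `|pd i f x - pd i f y| <= e / n.+1%:R.
  apply: filterI; first exact: Hd.
  by have /(@cvgrPdist_le _ _ _ (nbhs x)) := Hc i; apply.
have : \forall y \near x, forall i, derivable f y (delta_mx i ord0) /\
    `|pd i f x - pd i f y| <= e / n.+1%:R.
  exact: (@filter_forall _ _ _ (nbhs x) _ HH).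
move=> /nbhs_ballP[r r0 Hr].
near=> y.
have yr : `|y - x| < r.
  rewrite distrC; near: y; apply/nbhs_ballP; exists r => // z.
  by rewrite -ball_normE.
pose z k : 'cV[R]_n := \col_i (if (i < k)%N then y i ord0 else x i ord0).
have zS (i : 'I_n) : z i.+1 = (y i ord0 - x i ord0) *: delta_mx i ord0 + z i.
  apply/colP => j; rewrite !mxE eqxx andbT ltnS leq_eqVlt val_eqE.
  case: eqP => [->|_] /=; first by rewrite ltnn mulr1 subrK.
  by rewrite mulr0 add0r.
have z0 : z 0%N = x by apply/colP => j; rewrite mxE.
have zn : z n = y by apply/colP => j; rewrite mxE ltn_ord.
have zx (i : 'I_n) s : `|s| <= `|y i ord0 - x i ord0| ->
    `|x - (s *: delta_mx i ord0 + z i)| < r.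
  move=> hs; apply: le_lt_trans yr; apply: mx_norm_le => // j k; rewrite (ord1 k).
  rewrite !mxE eqxx andbT; case: eqP => [->|_] /=.
    rewrite ltnn mulr1 opprD addrCA subrr addr0 normrN (le_trans hs) //.
    by have := coord_le_norm (y - x) i ord0; rewrite !mxE.
  rewrite mulr0 add0r; case: ifP => _; last by rewrite subrr normr0.
  by rewrite distrC; have := coord_le_norm (y - x) j ord0; rewrite !mxE.
have step (i : 'I_n) : `|f (z i.+1) - f (z i) - (y i ord0 - x i ord0) * pd i f x|
    <= e / n.+1%:R * `|y - x|.
  rewrite zS; have [|s hs ->] := @mvt_line _ f (z i) (delta_mx i ord0)
      (y i ord0 - x i ord0).
    move=> s hs; have [|//] := Hr (s *: delta_mx i ord0 + z i) _ i.
    by rewrite -ball_normE; exact: zx.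
  rewrite -mulrBr normrM mulrC; apply: ler_pM => //.
    rewrite distrC.
    have [|//] := Hr (s *: delta_mx i ord0 + z i) _ i.
    by rewrite -ball_normE; exact: zx.
  by have := coord_le_norm (y - x) i ord0; rewrite !mxE.
have tele : f y - f x = \sum_(i < n) (f (z i.+1) - f (z i)).
  by rewrite -(big_mkord xpredT (fun i => f (z i.+1) - f (z i))) telescope_sumr //
    z0 zn.
rewrite tele /= /Lf -sumrB (le_trans (ler_norm_sum _ _ _)) //.
have -> : \sum_i `|f (z (i : 'I_n).+1) - f (z i) - (y - x) i ord0 * pd i f x| =
  \sum_i `|f (z (i : 'I_n).+1) - f (z i) - (y i ord0 - x i ord0) * pd i f x|.
  by apply: eq_bigr => i _; rewrite !mxE.
apply: (@le_trans _ _ (\sum_(i < n) e / n.+1%:R * `|y - x|)).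
  exact: ler_sum.
rewrite sumr_const card_ord -mulrnAl ler_wpM2r // -mulr_natr -mulrA ler_piMr ?(ltW e0) //.
by rewrite mulrC ler_pdivrMr ?ltr0n // mul1r ler_nat.
Unshelve. all: by end_near. Qed.

End MeanValue.

(** * Continuous convergence of all partial derivatives up to a given order *)

Section SmoothConvergence.
Variable R : realType.

Definition evdiff n (A : set 'cV[R]_n) (f : nat -> 'cV[R]_n -> R) : Prop :=
  forall x, A x -> evnear x (fun N z => differentiable (f N) z).

(* For an open set [A], the constant sequence [f] satisfies [Pc k A] exactly when
   [f] is of class [C^k] on [A]. *)
Fixpoint Pc n (k : nat) (A : set 'cV[R]_n) (f : nat -> 'cV[R]_n -> R)
    {struct k} : Prop :=
  match k with
  | 0 => forall x, A x -> exists l, ccvg f x l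
  | k'.+1 => [/\ forall x, A x -> exists l, ccvg f x l, evdiff A f &
      forall i, Pc k' A (fun N => pd i (f N))]
  end.

Lemma Pc_lim n k (A : set 'cV[R]_n) f x : Pc k A f -> A x -> exists l, ccvg f x l.
Proof. by case: k => [|k] /=; [exact|case=> + _ _; apply]. Qed.

Lemma Pc_pred n k (A : set 'cV[R]_n) f : Pc k.+1 A f -> Pc k A f.
Proof.
elim: k f => [|k IH] f [cf df pf] //; split => // i.
by apply: IH; exact: pf.
Qed.

Lemma Pc_le n k m (A : set 'cV[R]_n) f : (k <= m)%N -> Pc m A f -> Pc k A f.
Proof.
elim: m => [|m IH]; first by rewrite leqn0 => /eqP ->.
by rewrite leq_eqVlt => /orP[/eqP -> //|km /Pc_pred]; exact: IH.
Qed.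

Lemma Pc_sub n k (A B : set 'cV[R]_n) f : B `<=` A -> Pc k A f -> Pc k B f.
Proof.
move=> BA; elim: k f => [|k IH] f /=; first by move=> H x /BA; exact: H.
case=> cf df pf; split => [x /BA|x /BA|i]; [exact: cf|exact: df|exact: IH].
Qed.

Lemma evnear_pd_eq n (f g : nat -> 'cV[R]_n -> R) i x :
  evnear x (fun N z => f N z = g N z) ->
  evnear x (fun N z => pd i (f N) z = pd i (g N) z).
Proof.
by move=> /evnear_near; apply: filterS => -[N z] /= H; exact: pd_near_eq.
Qed.

Lemma evnear_diff_eq n (f g : nat -> 'cV[R]_n -> R) x :
  evnear x (fun N z => f N z = g N z) ->
  evnear x (fun N z => differentiable (f N) z) ->
  evnear x (fun N z => differentiable (g N) z).
Proof.
move=> /evnear_near H1 H2; rewrite /evnear.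
near=> p; have Hp : differentiable (f p.1) p.2 by near: p.
apply: near_eq_differentiable Hp.
by near: p.
Unshelve. all: by end_near. Qed.

Lemma Pc_ext n k (A : set 'cV[R]_n) (f g : nat -> 'cV[R]_n -> R) :
  (forall x, A x -> evnear x (fun N z => f N z = g N z)) -> Pc k A f -> Pc k A g.
Proof.
elim: k f g => [|k IH] f g fg /=.
  by move=> H x Ax; have [l Hl] := H x Ax; exists l; exact: (ccvg_ext (fg x Ax) Hl).
case=> cf df pf; split.
- by move=> x Ax; have [l Hl] := cf x Ax; exists l; apply: ccvg_ext Hl; exact: fg.
- by move=> x Ax; apply: evnear_diff_eq (df x Ax); exact: fg.
- by move=> i; apply: IH (pf i) => x Ax; apply: evnear_pd_eq; exact: fg.
Qed.

Lemma pd_cst n i (c : R) : pd i (fun _ : 'cV[R]_n => c) = fun _ => 0.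
Proof. by apply/funext => x; rewrite /pd -[LHS]/('D_(delta_mx i ord0) (cst c) x) derive_cst. Qed.

Lemma Pc_seq n k (A : set 'cV[R]_n) (c : nat -> R) (l : R) : c @ \oo --> l ->
  Pc k A (fun N _ => c N).
Proof.
elim: k c l => [|k IH] c l cl /=; first by move=> x _; exists l; exact: ccvg_seq.
split; first by move=> x _; exists l; exact: ccvg_seq.
- by move=> x _; apply: nearW => p /=; exact: differentiable_cst.
- move=> i; have -> : (fun N => pd i (fun _ : 'cV[R]_n => c N)) = (fun _ _ => 0).
    by apply/funext => N; rewrite pd_cst.
  exact: (IH _ 0 (@cvg_cst _ _ _ \oo _)).
Qed.

Lemma Pc_cst n k (A : set 'cV[R]_n) (c : R) : Pc k A (fun _ _ => c).
Proof. exact: (@Pc_seq _ _ _ _ c (@cvg_cst _ _ _ \oo _)). Qed.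

Lemma pd_coord n i (j : 'I_n) :
  pd i (fun x : 'cV[R]_n => x j ord0) = fun _ => (i == j)%:R.
Proof.
apply/funext => x.
have dc : differentiable (fun M : 'cV[R]_n => M j ord0 : R) x.
  exact: differentiable_coord.
rewrite (pdE _ dc).
have @f : {linear 'cV[R]_n -> R}.
  by exists (fun N : 'cV[R]_n => N j ord0); do 2![eexists]; do ?[constructor];
     rewrite ?mxE// => ? *; rewrite ?mxE//; move=> ?; rewrite !mxE.
have -> : (fun N : 'cV[R]_n => N j ord0) = f by [].
rewrite diff_lin; last exact: coord_continuous.
by rewrite /= mxE eqxx andbT eq_sym.
Qed.

Lemma Pc_coord n k (A : set 'cV[R]_n) j : Pc k A (fun _ x => x j ord0).
Proof.
have cc x : ccvg (fun _ (x : 'cV[R]_n) => x j ord0 : R) x (x j ord0).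
  by apply: ccvg_cst; exact: coord_continuous.
case: k => [|k] /=; first by move=> x _; exists (x j ord0).
split; first by move=> x _; exists (x j ord0).
- by move=> x _; apply: nearW => p /=; exact: differentiable_coord.
- by move=> i; rewrite pd_coord; exact: Pc_cst.
Qed.

Lemma pdD n (f g : 'cV[R]_n -> R) i x : differentiable f x -> differentiable g x ->
  pd i (fun y => f y + g y) x = pd i f x + pd i g x.
Proof. by move=> df dg; rewrite /pd deriveD //; exact: diff_derivable. Qed.

Lemma pdM n (f g : 'cV[R]_n -> R) i x : differentiable f x -> differentiable g x ->
  pd i (fun y => f y * g y) x = f x * pd i g x + g x * pd i f x.
Proof. by move=> df dg; rewrite /pd deriveM //; exact: diff_derivable. Qed.

Lemma Pc_add n k (A : set 'cV[R]_n) f g : Pc k A f -> Pc k A g ->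
  Pc k A (fun N z => f N z + g N z).
Proof.
elim: k f g => [|k IH] f g /=.
  move=> Hf Hg x Ax; have [l Hl] := Hf x Ax; have [m Hm] := Hg x Ax.
  by exists (l + m); exact: ccvgD.
move=> [cf df pf] [cg dg pg]; split.
- move=> x Ax; have [l Hl] := cf x Ax; have [m Hm] := cg x Ax.
  by exists (l + m); exact: ccvgD.
- move=> x Ax; apply: filterS2 (df x Ax) (dg x Ax) => p; exact: differentiableD.
- move=> i; apply: Pc_ext (IH _ _ (pf i) (pg i)) => x Ax.
  by apply: filterS2 (df x Ax) (dg x Ax) => p Hf Hg; rewrite pdD.
Qed.

Lemma Pc_mul n k (A : set 'cV[R]_n) f g : Pc k A f -> Pc k A g ->
  Pc k A (fun N z => f N z * g N z).
Proof.
elim: k f g => [|k IH] f g.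
  move=> Hf Hg x Ax; have [l Hl] := Hf x Ax; have [m Hm] := Hg x Ax.
  by exists (l * m); exact: ccvgM.
move=> Hf Hg; have Hf' := Pc_pred Hf; have Hg' := Pc_pred Hg.
case: Hf Hg => [cf df pf] [cg dg pg]; split.
- move=> x Ax; have [l Hl] := cf x Ax; have [m Hm] := cg x Ax.
  by exists (l * m); exact: ccvgM.
- move=> x Ax; apply: filterS2 (df x Ax) (dg x Ax) => p; exact: differentiableM.
- move=> i; apply: Pc_ext (Pc_add (IH _ _ Hf' (pg i)) (IH _ _ Hg' (pf i))) => x Ax.
  by apply: filterS2 (df x Ax) (dg x Ax) => p ? ?; rewrite pdM.
Qed.

Lemma Pc_scale n k (A : set 'cV[R]_n) (c : R) f : Pc k A f ->
  Pc k A (fun N z => c * f N z).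
Proof. by move=> H; apply: Pc_mul => //; exact: Pc_cst. Qed.

Lemma Pc_opp n k (A : set 'cV[R]_n) f : Pc k A f -> Pc k A (fun N z => - f N z).
Proof.
move=> /(Pc_scale (-1)); apply: Pc_ext => x _; apply: nearW => p /=.
by rewrite mulN1r.
Qed.

Lemma Pc_sum n k (A : set 'cV[R]_n) (I : Type) (s : seq I)
    (f : I -> nat -> 'cV[R]_n -> R) : (forall i, Pc k A (f i)) ->
  Pc k A (fun N z => \sum_(i <- s) f i N z).
Proof.
move=> H; elim: s => [|i s IH].
  apply: Pc_ext (Pc_cst k A 0) => x _; apply: nearW => p /=; exact/esym/big_nil.
apply: Pc_ext (Pc_add (H i) IH) => x _; apply: nearW => p /=.
by rewrite big_cons.
Qed.

(** The condition bears on the limits of [F]: if the limit at [x] lies in [B], the values of [F]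
    eventually lie where [g N] is differentiable. The inductive step is the chain rule, a sum of
    products. *)
Lemma Pc_comp n m k (A : set 'cV[R]_n) (B : set 'cV[R]_m)
    (F : nat -> 'cV[R]_n -> 'cV[R]_m) (g : nat -> 'cV[R]_m -> R) :
  Pc k B g -> (forall j, Pc k A (fun N z => F N z j ord0)) ->
  (forall x l, A x -> ccvg F x l -> B l) ->
  Pc k A (fun N z => g N (F N z)).
Proof.
have limF A' k' : (forall j, Pc k' A' (fun N z => F N z j ord0)) ->
    forall x, A' x -> exists l, ccvg F x l.
  move=> HF x Ax; have /choice[l Hl] : forall j, exists l,
      ccvg (fun N z => F N z j ord0) x l by move=> j; exact: Pc_lim (HF j) Ax.
  exists (\col_j l j); apply: ccvg_mx => j; rewrite mxE; exact: Hl.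
elim: k g => [|k IH] g.
  move=> Hg HF HB x Ax; have [l Hl] := limF _ _ HF x Ax.
  by have [w Hw] := Hg l (HB _ _ Ax Hl); exists w; exact: ccvg_comp Hl Hw.
move=> [cg dg pg] HF HB.
have dF x : A x -> evnear x (fun N z => forall j, differentiable
    (fun y => F N y j ord0) z).
  move=> Ax; apply: (@filter_forall _ _ _ _ _) => j.
  by have [_ + _] := HF j; apply.
have dgF x : A x -> evnear x (fun N z => differentiable (g N) (F N z)).
  move=> Ax; have [l Hl] := limF _ _ HF x Ax.
  apply: (evnear_comp Hl (P := fun N z => differentiable (g N) z)).
  by apply: dg; exact: HB Hl.
split.
- move=> x Ax; have [l Hl] := limF _ _ HF x Ax.
  by have [w Hw] := cg l (HB _ _ Ax Hl); exists w; exact: ccvg_comp Hl Hw.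
- move=> x Ax; apply: filterS2 (dF x Ax) (dgF x Ax) => p Hp Hg.
  by apply: differentiable_comp Hg; exact: differentiable_cV.
- move=> i.
  have HF' j : Pc k A (fun N z => F N z j ord0) by apply: Pc_pred; exact: HF.
  have H : Pc k A (fun N z => \sum_(j <- index_enum 'I_m)
      pd i (fun y => F N y j ord0) z * pd j (g N) (F N z)).
    apply: Pc_sum => j; apply: Pc_mul; first by have [_ _] := HF j; exact.
    exact: IH (pg j) HF' HB.
  apply: Pc_ext H => x Ax.
  by apply: filterS2 (dF x Ax) (dgF x Ax) => p Hp Hg; rewrite pd_comp.
Qed.

End SmoothConvergence.

(** * Regularity of limits and iterated partial derivatives *)

Section SmoothLimits.
Variable R : realType.

Lemma evnearP n (x : 'cV[R]_n) P : evnear x P <->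
  exists N0 : nat, exists2 r : R, 0 < r &
    forall N z, (N0 <= N)%N -> `|z - x| < r -> P N z.
Proof.
split.
  move=> [[A B]] /= [[N0 _ HA] /nbhs_ballP[r r0 Hr]] H.
  exists N0, r => // N z N0N zx; apply: (H (N, z)); split => /=; first exact: HA.
  by apply: Hr; rewrite -ball_normE /= distrC.
move=> [N0 [r r0 H]].
exists ([set N | (N0 <= N)%N], ball x r) => /=.
  by split; [exists N0|exact: nbhsx_ballx].
move=> [N z] /= [HN]; rewrite -ball_normE /= distrC; exact: H.
Qed.

Lemma evnearI n (x : 'cV[R]_n) P Q : evnear x P -> evnear x Q ->
  evnear x (fun N z => P N z /\ Q N z).
Proof. exact: filterI. Qed.

Lemma ccvg_pt (V : normedModType R) n (f : nat -> 'cV[R]_n -> V) x l :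
  ccvg f x l -> (fun N => f N x) @ \oo --> l.
Proof.
move=> H P /H /= HP.
have /evnear_seq : evnear x (fun N z => P (f N z)) by exact: HP.
by apply: filterS => N; exact: nbhs_singleton.
Qed.

(** At a fixed step [t] the difference quotient of [f N] is, by the mean value theorem, a value of
    its partial derivative near [x], hence within [e] of [L] for all large [N]; letting [N] grow
    transfers the bound to [g]. *)
Lemma derivative_of_limit n (A : set 'cV[R]_n) f (g : 'cV[R]_n -> R) i x L :
  open A -> A x -> evdiff A f ->
  (forall y, A y -> ccvg f y (g y)) ->
  ccvg (fun N => pd i (f N)) x L ->
  derivable g x (delta_mx i ord0) /\ pd i g x = L.
Proof.
move=> oA Ax df fg dL.
suff H : (fun h : R => h^-1 *: ((g \o shift x) (h *: delta_mx i ord0) - g x)) @ 0^'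
    --> L.
  split; first by apply/cvg_ex; exists L.
  exact/cvg_lim.
apply/cvgrPdist_le => e e0.
have H1 : evnear x (fun N z => `|L - pd i (f N) z| <= e).
  by move/cvgrPdist_le : dL; apply.
have H2 : evnear x (fun N z => A z).
  by apply: evnear_snd; exact: open_nbhs_nbhs.
have /evnearP[N0 [r r0 Hr]] := evnearI (evnearI H1 (df x Ax)) H2.
have nd (t : R) : `|t *: delta_mx i ord0 : 'cV[R]_n| <= `|t|.
  apply: mx_norm_le => // j k; rewrite !mxE normrM ler_piMr //.
  by case: (_ && _); rewrite /= ?normr1 // normr0.
near=> t => /=.
have tr : `|t| < r by near: t; exact: dnbhs0_lt.
have t0 : t != 0 by near: t; exact: nbhs_dnbhs_neq.
have At : A (t *: delta_mx i ord0 + x).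
  have [|_ //] := Hr N0 (t *: delta_mx i ord0 + x) (leqnn _).
  by rewrite addrK (le_lt_trans (nd t)).
have C1 := ccvg_pt (fg _ At); have C2 := ccvg_pt (fg _ Ax).
have C3 : (fun N => `|L - t^-1 * (f N (t *: delta_mx i ord0 + x) - f N x)|) @ \oo -->
    `|L - t^-1 * (g (t *: delta_mx i ord0 + x) - g x)|.
  apply: cvg_norm; apply: cvgB; first exact: cvg_cst.
  by apply: cvgM; [exact: cvg_cst|exact: cvgB].
rewrite -[X in X <= _]/(`|L - t^-1 * (g (t *: delta_mx i ord0 + x) - g x)|).
apply: (cvgr_to_le C3).
exists N0 => // N /= N0N.
have [s hs|s hs ->] := @mvt_line R _ (f N) x (delta_mx i ord0) t.
  apply: diff_derivable; have [|[_ //]] := Hr N (s *: delta_mx i ord0 + x) N0N.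
  by rewrite addrK (le_lt_trans (nd s)) // (le_lt_trans hs).
rewrite mulKf //; have [|[+ _] _] := Hr N (s *: delta_mx i ord0 + x) N0N.
  by rewrite addrK (le_lt_trans (nd s)) // (le_lt_trans hs).
exact.
Unshelve. all: by end_near. Qed.

Lemma Pc_derivative_limit n k (A : set 'cV[R]_n) f (g : 'cV[R]_n -> R) i :
  open A -> Pc k.+1 A f -> (forall y, A y -> ccvg f y (g y)) ->
  forall x, A x -> derivable g x (delta_mx i ord0) /\
    ccvg (fun N => pd i (f N)) x (pd i g x).
Proof.
move=> oA [cf df pf] fg x Ax; have [L HL] := Pc_lim (pf i) Ax.
by have [? ->] := derivative_of_limit oA Ax df fg HL.
Qed.

Lemma Pc_limit_continuous n k (A : set 'cV[R]_n) f (g : 'cV[R]_n -> R) :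
  open A -> Pc k A f -> (forall y, A y -> ccvg f y (g y)) ->
  forall x, A x -> {for x, continuous g}.
Proof.
move=> oA pf fg x Ax; apply: ccvg_limit_continuous (fg x Ax).
by apply: filterS (open_nbhs_nbhs (conj oA Ax)).
Qed.

Lemma ccvg_near_diff n (A : set 'cV[R]_n) (g : 'cV[R]_n -> R) :
  open A -> (forall x, A x -> differentiable g x) -> evdiff A (fun _ => g).
Proof.
move=> oA H x Ax; apply: evnear_snd; apply: filterS (open_nbhs_nbhs (conj oA Ax)).
exact: H.
Qed.

(** The partial derivatives of [g] are limits of partial derivatives, hence continuous, so
    [partials_differentiable] applies at every order. *)
Lemma Pc_limit n k (A : set 'cV[R]_n) f (g : 'cV[R]_n -> R) :
  open A -> Pc k A f -> (forall y, A y -> ccvg f y (g y)) ->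
  Pc k A (fun _ => g).
Proof.
move=> oA; elim: k f g => [|k IH] f g pf fg.
  move=> x Ax; exists (g x); apply: ccvg_cst; exact: Pc_limit_continuous pf fg _ Ax.
have D i x : A x -> _ := @Pc_derivative_limit _ k A f g i oA pf fg x.
split.
- by move=> x Ax; exists (g x); apply: ccvg_cst; exact: Pc_limit_continuous pf fg _ Ax.
- apply: ccvg_near_diff => // x Ax; apply: partials_differentiable => i.
    apply: filterS (open_nbhs_nbhs (conj oA Ax)) => y Ay.
    by have [] := D i y Ay.
  case: pf => _ _ /(_ i) pf.
  apply: (Pc_limit_continuous oA pf) Ax => y Ay.
  by have [] := D i y Ay.
- move=> i; case: pf => _ _ /(_ i) pf; apply: IH pf _ => y Ay.
  by have [] := D i y Ay.
Qed.

Lemma Ck_cont n k (A : set 'cV[R]_n) f : Ck k A f ->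
  forall x, A x -> {for x, continuous f}.
Proof. by case: k => [|k] //= []. Qed.

Lemma Ck_Pc n k (A : set 'cV[R]_n) f : open A -> Ck k A f -> Pc k A (fun _ => f).
Proof.
move=> oA; elim: k f => [|k IH] f /= H.
  by move=> x Ax; exists (f x); apply: ccvg_cst; exact: H.
case: H => cf H; split.
- by move=> x Ax; exists (f x); apply: ccvg_cst; exact: cf.
- apply: ccvg_near_diff => // x Ax; apply: partials_differentiable => i.
    apply: filterS (open_nbhs_nbhs (conj oA Ax)) => y.
    by have [+ _] := H i; apply.
  by have [_ /Ck_cont] := H i; apply.
- by move=> i; apply: IH; have [] := H i.
Qed.

(** The last entry of the list is differentiated first, so that [rcons] matches the recursion of
    [Pc]; [dalpha] is the case of a list sorted by coordinate. *)
Definition pdl n (l : seq 'I_n) (f : 'cV[R]_n -> R) : 'cV[R]_n -> R :=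
  foldr (fun i g => pd i g) f l.

Lemma pdl_rcons n (l : seq 'I_n) i f : pdl (rcons l i) f = pdl l (pd i f).
Proof. by rewrite /pdl foldr_rcons. Qed.

Lemma pdl_cat n (l l' : seq 'I_n) f : pdl (l ++ l') f = pdl l (pdl l' f).
Proof. by rewrite /pdl foldr_cat. Qed.

Lemma dalpha_pdl n (al : 'I_n -> nat) f :
  dalpha al f = pdl (flatten [seq nseq (al i) i | i <- enum 'I_n]) f.
Proof.
rewrite /dalpha; elim: (enum 'I_n) => //= i s ->.
rewrite pdl_cat; elim: (al i) => //= m ->.
by [].
Qed.

Lemma Pc_pdl n k (A : set 'cV[R]_n) f l : Pc k A f -> (size l <= k)%N ->
  Pc (k - size l) A (fun N => pdl l (f N)).
Proof.
elim/last_ind: l k f => [|l i IH] k f pf; first by rewrite subn0.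
rewrite size_rcons; case: k pf => // k [_ _ /(_ i)] pf; rewrite ltnS subSS => sl.
have -> : (fun N => pdl (rcons l i) (f N)) = (fun N => pdl l (pd i (f N))).
  by apply/funext => N; rewrite pdl_rcons.
exact: IH.
Qed.

Lemma Pc_pdl_limit n k (A : set 'cV[R]_n) f (g : 'cV[R]_n -> R) l :
  open A -> Pc k A f -> (forall y, A y -> ccvg f y (g y)) -> (size l <= k)%N ->
  forall x, A x -> ccvg (fun N => pdl l (f N)) x (pdl l g x).
Proof.
move=> oA; elim/last_ind: l k f g => [|l i IH] k f g pf fg.
  by move=> _ x Ax; exact: fg.
rewrite size_rcons; case: k pf => // k pf; rewrite ltnS => sl x Ax.
have -> : (fun N => pdl (rcons l i) (f N)) = (fun N => pdl l (pd i (f N))).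
  by apply/funext => N; rewrite pdl_rcons.
rewrite pdl_rcons; have [_ _ /(_ i) pf'] := pf.
apply: (IH k _ (pd i g)) => //.
by move=> y Ay; have [] := Pc_derivative_limit i oA pf fg Ay.
Qed.

Lemma Pc_of_pdl n k (A : set 'cV[R]_n) f :
  (forall l, (size l < k)%N -> evdiff A (fun N => pdl l (f N))) ->
  (forall l, (size l <= k)%N -> forall x, A x ->
     exists L, ccvg (fun N => pdl l (f N)) x L) -> Pc k A f.
Proof.
elim: k f => [|k IH] f Hd Hc; first by move=> x Ax; exact: (Hc [::]).
split; [exact: (Hc [::])|exact: (Hd [::])|move=> i].
have E l : (fun N => pdl l (pd i (f N))) = (fun N => pdl (rcons l i) (f N)).
  by apply/funext => N; rewrite pdl_rcons.
apply: IH => l sl; rewrite E; first by apply: Hd; rewrite size_rcons.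
by apply: Hc; rewrite size_rcons.
Qed.

(** The passage from local to uniform estimates: the near-covering form of compactness produces the
    common index. *)
Lemma compact_evnear n (K : set 'cV[R]_n) P : compact K ->
  (forall x, K x -> evnear x P) ->
  exists N0 : nat, forall N x, (N0 <= N)%N -> K x -> P N x.
Proof.
move=> /compact_near_coveringP cK H.
have := cK nat \oo (fun N x => P N x) _.
case.
  move=> x Kx; have [[A B] /= [HA HB] HAB] := H x Kx.
  by exists (B, A) => //= -[z N] /= [Bz AN]; exact: (HAB (N, z)).
move=> N0 _ HN0; exists N0 => N x N0N Kx; exact: HN0 Kx.
Qed.

End SmoothLimits.

(** * Euler schemes with varying fields *)

Section EulerScheme.
Variable R : realType.

(** Consider the supremum [c] of the times up to which [P] holds: the third premise gives [P c], and
    the second pushes past [c] unless [c = b]. *)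
Lemma real_induction (P : R -> Prop) (b : R) : P 0 ->
  (forall s, 0 <= s < b -> (forall u, 0 <= u <= s -> P u) ->
     exists2 d, 0 < d & forall u, s <= u <= s + d -> u <= b -> P u) ->
  (forall s, 0 < s <= b -> (forall u, 0 <= u < s -> P u) -> P s) ->
  forall s, 0 <= s <= b -> P s.
Proof.
move=> P0 Pstep Plim s0 /andP[s00 s0b].
have b0 : 0 <= b by exact: le_trans s0b.
pose S := [set s : R | 0 <= s <= b /\ forall u, 0 <= u <= s -> P u].
have S0 : S 0.
  by split; [rewrite lexx|move=> u; rewrite -eq_le => /eqP <-].
have hS : has_sup S by split; [exists 0|exists b => s [/andP[]]].
pose c := sup S.
have c0 : 0 <= c by apply: ub_le_sup => //; case: hS.
have cb : c <= b by apply: ge_sup; [exists 0|move=> s [/andP[]]].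
have Pc u : 0 <= u < c -> P u.
  move=> /andP[u0 uc].
  have [v [_ Hv] uv] : exists2 v, S v & u < v.
    by have [v Sv] := sup_adherent (eps := c - u) ltac:(by rewrite subr_gt0) hS;
       rewrite subKr => uv; exists v.
  by apply: Hv; rewrite u0 ltW.
have PcE : P c.
  move: (c0); rewrite le_eqVlt => /orP[/eqP <- //|c_gt0].
  by apply: Plim => //; rewrite c_gt0.
have Pcle u : 0 <= u <= c -> P u.
  move=> /andP[u0]; rewrite le_eqVlt => /orP[/eqP -> //|uc].
  by apply: Pc; rewrite u0.
move: cb; rewrite le_eqVlt => /orP[/eqP cb|cb].
  by apply: Pcle; rewrite s00 cb.
have [d d0 Hd] := Pstep c ltac:(by rewrite c0) Pcle.
pose m := Num.min (c + d) b.
have cm : c < m by rewrite lt_min cb andbT ltrDl.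
suff : S m by move=> Sm; have := ub_le_sup (proj2 hS) Sm; rewrite leNgt cm.
split; first by rewrite (le_trans c0 (ltW cm)) ge_min lexx orbT.
move=> u /andP[u0 um]; have [uc|cu] := leP u c; first by apply: Pcle; rewrite u0.
move: um; rewrite le_min => /andP[u1 u2].
by apply: Hd => //; rewrite (ltW cu).
Qed.

Definition euler n (F : nat -> 'cV[R]_n -> 'cV[R]_n) (N : nat) (x : 'cV[R]_n) :
  'cV[R]_n := x + N%:R^-1 *: F N x.

(** The derivative is expressed by an estimate relative to [[0, b]], so that it is one-sided at both
    ends and limits of discrete increments yield it directly. *)
Definition sol n (G : 'cV[R]_n -> 'cV[R]_n) (Om : set 'cV[R]_n) (b : R)
    (y : R -> 'cV[R]_n) : Prop :=
  forall s, 0 <= s <= b -> Om (y s) /\ forall e, 0 < e -> exists2 d, 0 < d &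
    forall u, 0 <= u <= b -> `|u - s| <= d ->
      `|y u - y s - (u - s) *: G (y s)| <= e * `|u - s|.

(** Near-covering is run along pairs of an index and a bound tending to infinity together, so that
    one application gives both [C] and [N0]. *)
Lemma uniform_bound n (V : normedModType R) (F : nat -> 'cV[R]_n -> V) L :
  compact L -> (forall x, L x -> exists l, ccvg F x l) ->
  exists2 C, 0 < C & exists N0 : nat, forall N x, (N0 <= N)%N -> L x -> `|F N x| <= C.
Proof.
move=> /compact_near_coveringP cL H.
have [] := cL (nat * R)%type (filter_prod \oo (pinfty_nbhs R))
  (fun p x => `|F p.1 x| <= p.2) _.
  move=> x Lx; have [l Hl] := H x Lx.
  have /evnearP[N0 [r r0 Hr]] : evnear x (fun N z => `|l - F N z| <= 1).
    by move/cvgrPdist_le : Hl; apply.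
  exists (ball x r, [set p | (N0 <= p.1)%N /\ `|l| + 1 <= p.2]) => /=.
    split; first exact: nbhsx_ballx.
    exists ([set N | (N0 <= N)%N], [set C | `|l| + 1 <= C]) => //=.
    split; first by exists N0.
    exact: nbhs_pinfty_ge (num_real _).
  move=> [z [N C]] /= [+ [N0N lC]]; rewrite -ball_normE /= distrC => zx.
  apply: le_trans lC; rewrite -(subrK l (F N z)) addrC.
  by rewrite (le_trans (ler_normD _ _)) // lerD2l distrC; exact: Hr.
move=> [A B] /= [[N0 _ HA] HB] HAB.
have [C [BC C0]] : exists C, B C /\ 0 < C.
  near (pinfty_nbhs R) => C; exists C; split; first by near: C.
  by near: C; exact: nbhs_pinfty_gt (num_real _).
exists C => //; exists N0 => N x N0N Lx.
by apply: (HAB (N, C)) Lx; split => //=; exact: HA.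
Unshelve. all: by end_near. Qed.

(** With [g = 0] this bounds displacements; with [g = G (y s)] it is the discrete form of the
    estimate in [sol]. *)
Lemma euler_increment n (F : nat -> 'cV[R]_n -> 'cV[R]_n) N x (g : 'cV[R]_n) e i j :
  (i <= j)%N ->
  (forall k, (i <= k < j)%N -> `|F N (iter k (euler F N) x) - g| <= e) ->
  `|iter j (euler F N) x - iter i (euler F N) x - ((j%:R - i%:R) / N%:R) *: g| <=
    e * ((j%:R - i%:R) / N%:R).
Proof.
move=> /subnK <-; elim: (j - i)%N => [|m IH] H.
  by rewrite add0n !subrr mul0r scale0r subrr normr0 mulr0.
have Hm : `|iter (m + i) (euler F N) x - iter i (euler F N) x
    - (((m + i)%:R - i%:R) / N%:R) *: g| <= e * (((m + i)%:R - i%:R) / N%:R).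
  apply: IH => k /andP[ik kj]; apply: H; rewrite ik /= addSn ltnS; exact: ltnW.
have E : ((m.+1 + i)%:R - i%:R) / N%:R = ((m + i)%:R - i%:R) / N%:R + N%:R^-1 :> R.
  by rewrite addSn -addn1 natrD addrAC mulrDl mul1r.
rewrite E addSn iterS mulrDr scalerDl.
set z := iter (m + i) _ x in Hm *.
have -> : euler F N z - iter i (euler F N) x -
    ((((m + i)%:R - i%:R) / N%:R) *: g + N%:R^-1 *: g) =
  (z - iter i (euler F N) x - (((m + i)%:R - i%:R) / N%:R) *: g)
   + N%:R^-1 *: (F N z - g).
  rewrite /euler scalerBr opprD !addrA; congr (_ - _).
  by rewrite addrAC [in LHS]addrAC [RHS]addrAC; congr (_ + _); rewrite addrAC.
apply: (le_trans (ler_normD _ _)); apply: lerD => //.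
rewrite normrZ ger0_norm ?invr_ge0 // mulrC ler_wpM2r ?invr_ge0 //.
by apply: H; rewrite leq_addl /= addSn.
Qed.

Lemma truncn_near (s : R) (N : nat) : 0 <= s -> (0 < N)%N ->
  `|(Num.truncn (s * N%:R))%:R / N%:R - s| <= N%:R^-1.
Proof.
move=> s0 N0; have N0' : 0 < N%:R :> R by rewrite ltr0n.
have /truncn_itv/andP[h1 h2] : 0 <= s * N%:R by rewrite mulr_ge0.
have -> : (Num.truncn (s * N%:R))%:R / N%:R - s =
  ((Num.truncn (s * N%:R))%:R - s * N%:R) / N%:R.
  by rewrite mulrBl mulfK // gt_eqF.
rewrite normrM (ger0_norm (x := _^-1)) ?invr_ge0 // ler_piMl ?invr_ge0 //.
rewrite ler_norml; apply/andP; split; last by rewrite (le_trans (y := 0)) ?subr_le0.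
by rewrite lerBrDl lerBlDr ltW // natr1.
Qed.

Lemma truncn_leN (s : R) (N : nat) : s <= 1 -> (Num.truncn (s * N%:R) <= N)%N.
Proof.
move=> s1; rewrite truncn_le_nat (@le_lt_trans _ _ N%:R) ?ltr_nat //.
by rewrite ler_piMl.
Qed.

(** A filter is the intersection of the ultrafilters refining it. Along an ultrafilter a trajectory
    in a compact set converges at all times simultaneously, which takes the place of extracting a
    subsequence. *)
Lemma cvg_ultra (T : Type) (V : topologicalType) (F : set_system T)
    (FF : ProperFilter F) (f : T -> V) (l : V) :
  (forall U : set_system T, UltraFilter U -> F `<=` U -> f @ U --> l) -> f @ F --> l.
Proof.
move=> H P Pl; apply: contrapT => NF.
pose B := f @^-1` P.
(* The filter generated by [F] and the complement of [B]; it is proper because [B] is not in [F]. *)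
pose G := [set A : set T | F (B `|` A)].
have PG : ProperFilter G.
  apply: Build_ProperFilter.
    by rewrite /G /= setU0.
  split; first by rewrite /G /= setUT; exact: filterT.
    by move=> A A' GA GA'; rewrite /G /= setUIr; exact: filterI.
  move=> A A' AA' GA; have GA' : F (B `|` A) := GA.
  have sub : B `|` A `<=` B `|` A' by move=> t [|/AA']; [left|right].
  exact: (filterS sub GA').
have [U [UU GU]] := ultraFilterLemma PG.
have FU : F `<=` U.
  by move=> A FA; apply: GU; apply: filterS FA => t At; right.
have UB : U B by exact: (H U UU FU _ Pl).
have UNB : U (~` B) by apply: GU; rewrite /G /= setUv; exact: filterT.
have : U set0 by rewrite -(setICr B); exact: filterI.
exact: filter_not_empty.
Qed.

Lemma euler_increment_sym n (F : nat -> 'cV[R]_n -> 'cV[R]_n) N x (g : 'cV[R]_n) e i j :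
  (forall k, (minn i j <= k < maxn i j)%N -> `|F N (iter k (euler F N) x) - g| <= e) ->
  `|iter j (euler F N) x - iter i (euler F N) x - ((j%:R - i%:R) / N%:R) *: g| <=
    e * `|(j%:R - i%:R) / N%:R|.
Proof.
have [ij H|ji H] := leqP i j.
  by rewrite (ger0_norm (x := _ / _)) ?divr_ge0 ?subr_ge0 ?ler_nat //; exact: euler_increment.
have q0 : (j%:R - i%:R) / N%:R = - ((i%:R - j%:R) / N%:R) :> R by rewrite -mulNr opprB.
rewrite q0 normrN (ger0_norm (x := _ / _)) ?divr_ge0 ?subr_ge0 ?ler_nat ?(ltnW ji) //.
by rewrite -normrN scaleNr opprK opprD opprB; apply: euler_increment => //; exact: ltnW.
Qed.

(** The scheme with [p.1] steps from [p.2], read as a step function of the time [s]. *)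
Definition trajectory n (F : nat -> 'cV[R]_n -> 'cV[R]_n) (s : R) (p : nat * 'cV[R]_n) :=
  iter (Num.truncn (s * p.1%:R)) (euler F p.1) p.2.

Lemma invn_small (e : R) : 0 < e -> exists2 N0 : nat, (0 < N0)%N &
  forall N, (N0 <= N)%N -> N%:R^-1 <= e.
Proof.
move=> e0; have e1 : 0 <= e^-1 by rewrite invr_ge0 ltW.
exists (Num.truncn e^-1).+1 => // N HN.
have /truncn_itv/andP[_ h] := e1.
rewrite -[e]invrK lef_pV2 ?posrE ?invr_gt0 //; last first.
  by rewrite ltr0n (leq_trans _ HN).
by apply: ltW; apply: (lt_le_trans h); rewrite ler_nat.
Qed.

Lemma truncn_diff (s u : R) N : (0 < N)%N -> 0 <= s -> 0 <= u ->
  `|((Num.truncn (u * N%:R))%:R - (Num.truncn (s * N%:R))%:R) / N%:R| <=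
  `|u - s| + 2 * N%:R^-1.
Proof.
move=> N0 s0 u0; rewrite mulrBl.
have h1 := truncn_near u0 N0; have h2 := truncn_near s0 N0.
set a := (Num.truncn (u * _))%:R / _ in h1 *.
set b := (Num.truncn (s * _))%:R / _ in h2 *.
have -> : a - b = (u - s) + (a - u) - (b - s) by ring.
apply: (le_trans (ler_normB _ _)).
have := ler_normD (u - s) (a - u); lra.
Qed.

Lemma trajectory_increment n (F : nat -> 'cV[R]_n -> 'cV[R]_n) (L : set 'cV[R]_n) C N x s u :
  (0 < N)%N -> 0 <= C -> (forall z, L z -> `|F N z| <= C) ->
  (forall j, (j <= N)%N -> L (iter j (euler F N) x)) ->
  0 <= s <= 1 -> 0 <= u <= 1 ->
  `|trajectory F u (N, x) - trajectory F s (N, x)| <= C * (`|u - s| + 2 * N%:R^-1).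
Proof.
move=> N0 C0 HC HL /andP[s0 s1] /andP[u0 u1]; rewrite /trajectory /=.
set i := Num.truncn (s * _); set j := Num.truncn (u * _).
have := @euler_increment_sym n F N x 0 C i j.
rewrite scaler0 subr0 => h; apply: (le_trans (h _)); last first.
  by rewrite ler_wpM2l // truncn_diff.
move=> k /andP[_ kj]; rewrite subr0; apply: HC; apply: HL; apply: ltnW.
by apply: leq_trans kj _; rewrite geq_max !truncn_leN.
Qed.

Lemma truncn_cvg (s : R) : 0 <= s ->
  (fun N => (Num.truncn (s * N%:R))%:R / N%:R : R) @ \oo --> s.
Proof.
move=> s0; apply/cvgrPdist_le => e e0; have [N0 N00 HN] := invn_small e0.
exists N0 => // N /= N0N; rewrite distrC.
by rewrite (le_trans (truncn_near s0 (leq_trans N00 N0N))) // HN.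
Qed.

(** Near [y s] the fields are within [e] of [G (y s)], and for short times the whole trajectory
    stays near [y s]; the discrete increment estimate then passes to the limit along [U]. *)
Lemma euler_limit_sol n (Om : set 'cV[R]_n) (F : nat -> 'cV[R]_n -> 'cV[R]_n) G x L
    (U : set_system (nat * 'cV[R]_n)) (PU : ProperFilter U) y :
  (forall z, L z -> ccvg F z (G z)) -> L `<=` Om -> compact L ->
  filter_prod \oo (nbhs x) `<=` U ->
  evnear x (fun N x' => forall j, (j <= N)%N -> L (iter j (euler F N) x')) ->
  (forall s, 0 <= s <= 1 -> L (y s) /\ trajectory F s @ U --> y s) -> sol G Om 1 y.
Proof.
move=> FG LOm cL FU HL Hy s s01; have [Lys Ts] := Hy s s01.
split; first exact: LOm.
move=> e e0.
have [C C0 [N1 HC]] := uniform_bound cL (fun z Lz => ex_intro _ _ (FG z Lz)).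
have /evnearP[N2 [r r0 Hr]] : evnear (y s) (fun N z => `|G (y s) - F N z| <= e).
  by move/cvgrPdist_le : (FG _ Lys); apply.
(* At speed at most [C], a time [r / (4 * C)] and two rounding errors [r / (8 * C)] cost at most
   [r / 2]; the distance of the trajectory to [y s] adds [r / 8], in total less than [r]. *)
have rC : 0 < r / (4 * C) by rewrite divr_gt0 // mulr_gt0.
exists (r / (4 * C)) => // u u01 us.
have [Lyu Tu] := Hy u u01.
have rC' : 0 < r / (8 * C) by rewrite divr_gt0 // mulr_gt0.
have [N3 N30 HN3] := invn_small rC'.
have s0 : 0 <= s by case/andP: s01.
have u0 : 0 <= u by case/andP: u01.
pose q (p : nat * 'cV[R]_n) := ((Num.truncn (u * p.1%:R))%:R
  - (Num.truncn (s * p.1%:R))%:R) / p.1%:R : R.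
have qU : q @ U --> u - s.
  have : q @ filter_prod \oo (nbhs x) --> u - s.
    have : (fun p : nat * 'cV[R]_n => (Num.truncn (u * p.1%:R))%:R / p.1%:R
        - (Num.truncn (s * p.1%:R))%:R / p.1%:R : R) @ filter_prod \oo (nbhs x) --> u - s.
      apply: cvgB.
        exact: (@ccvg_seq _ R^o n (fun N => (Num.truncn (u * N%:R))%:R / N%:R) x _
          (truncn_cvg u0)).
      exact: (@ccvg_seq _ R^o n (fun N => (Num.truncn (s * N%:R))%:R / N%:R) x _
          (truncn_cvg s0)).
    by apply: cvg_trans; apply: near_eq_cvg; apply: nearW => p; rewrite /q mulrBl.
  by move=> Hq P /Hq HP; exact: FU.
have C1 : (fun p => `|trajectory F u p - trajectory F s p - q p *: G (y s)|) @ U -->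
    `|y u - y s - (u - s) *: G (y s)|.
  apply: cvg_norm; apply: cvgB; first exact: cvgB.
  by apply: cvgZ => //; exact: cvg_cst.
have C2 : (fun p => e * `|q p|) @ U --> e * `|u - s|.
  by apply: cvgM; [exact: cvg_cst|exact: cvg_norm].
apply: (ler_cvg_to C1 C2).
have U1 : U (fun p => (N1 <= p.1)%N /\ (N2 <= p.1)%N /\ (N3 <= p.1)%N).
  apply: FU; apply: (@evnear_fst _ _ x
    (fun N => (N1 <= N)%N /\ (N2 <= N)%N /\ (N3 <= N)%N)).
  exists (maxn N1 (maxn N2 N3)) => // N /=.
  by rewrite !geq_max => /and3P[].
have U2 : U (fun p => forall j, (j <= p.1)%N -> L (iter j (euler F p.1) p.2)) by exact: FU.
have U3 : U (fun p => `|y s - trajectory F s p| < r / 8).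
  by move/cvgrPdist_lt : Ts; apply; rewrite divr_gt0.
near=> p.
have [H1 [H2 H3]] : (N1 <= p.1)%N /\ (N2 <= p.1)%N /\ (N3 <= p.1)%N by near: p.
have H4 : forall j, (j <= p.1)%N -> L (iter j (euler F p.1) p.2) by near: p.
have H5 : `|y s - trajectory F s p| < r / 8 by near: p.
have p0 : (0 < p.1)%N by exact: leq_trans H3.
rewrite /q /trajectory; apply: euler_increment_sym => k /andP[k1 k2].
rewrite distrC; apply: Hr => //.
set i := Num.truncn (s * _) in k1 k2; set j := Num.truncn (u * _) in k1 k2.
have kN : (k <= p.1)%N.
  apply: ltnW; apply: leq_trans k2 _; rewrite geq_max !truncn_leN //.
    by case/andP: u01.
  by case/andP: s01.
have h : `|iter k (euler F p.1) p.2 - trajectory F s p| <=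
    C * (`|u - s| + 2 * p.1%:R^-1).
  rewrite /trajectory -/i.
  have := @euler_increment_sym n F p.1 p.2 0 C i k.
  rewrite scaler0 subr0 => h; apply: (le_trans (h _)).
    move=> l /andP[_ lk]; rewrite subr0; apply: HC => //; apply: H4.
    apply: ltnW; apply: leq_trans lk _; rewrite geq_max kN andbT truncn_leN //.
    by case/andP: s01.
  rewrite ler_wpM2l //; first exact: ltW.
  apply: le_trans (truncn_diff p0 s0 u0).
  rewrite !normrM ler_wpM2r // -/i -/j.
  move: k1 k2; rewrite /minn /maxn; case: ltnP => ij k1 k2.
    by rewrite !ger0_norm ?subr_ge0 ?ler_nat // ?lerD2r ?ler_nat ltnW.
  rewrite !ler0_norm ?subr_le0 ?ler_nat ?(ltnW k2) //.
  by rewrite lerN2 lerD2r ler_nat.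
rewrite -(subrK (trajectory F s p) (iter k _ _)) -addrA.
apply: (le_lt_trans (ler_normD _ _)).
rewrite distrC in H5; apply: (le_lt_trans (lerD h (ltW H5))).
have h3 : p.1%:R^-1 <= r / (8 * C) by exact: HN3.
have h4 : C * (`|u - s| + 2 * p.1%:R^-1) <= C * (r / (4 * C) + 2 * (r / (8 * C))).
  by rewrite ler_wpM2l ?(ltW C0) // lerD // ler_wpM2l.
apply: (le_lt_trans (lerD h4 (lexx _))).
have -> : C * (r / (4 * C) + 2 * (r / (8 * C))) + r / 8 = (5 / 8) * r.
  by field; rewrite gt_eqF.
lra.
Unshelve. all: by end_near. Qed.

End EulerScheme.

(** * Convergence of the Euler scheme, order zero *)

Section EulerConvergence.
Variable R : realType.

Definition uniq_sol n (G : 'cV[R]_n -> 'cV[R]_n) (Om : set 'cV[R]_n) x : Prop :=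
  forall y1 y2, sol G Om 1 y1 -> sol G Om 1 y2 -> y1 0 = x -> y2 0 = x ->
    forall s, 0 <= s <= 1 -> y1 s = y2 s.

Definition confined n (F : nat -> 'cV[R]_n -> 'cV[R]_n) (L : set 'cV[R]_n) x : Prop :=
  evnear x (fun N x' => forall j, (j <= N)%N -> L (iter j (euler F N) x')).

Lemma trajectory0 n (F : nat -> 'cV[R]_n -> 'cV[R]_n) p : trajectory F 0 p = p.2.
Proof. by rewrite /trajectory mul0r truncn0. Qed.

Lemma euler_cvg n (Om : set 'cV[R]_n) (F : nat -> 'cV[R]_n -> 'cV[R]_n) G x L :
  (forall z, Om z -> ccvg F z (G z)) -> L `<=` Om -> compact L ->
  confined F L x -> uniq_sol G Om x ->
  exists Y, [/\ sol G Om 1 Y, Y 0 = x, forall s, 0 <= s <= 1 -> L (Y s) &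
    forall e, 0 < e -> evnear x (fun N x' => forall j, (j <= N)%N ->
      `|iter j (euler F N) x' - Y (j%:R / N%:R)| <= e)].
Proof.
move=> FG LOm cL HL Hu.
have FGL z : L z -> ccvg F z (G z) by move=> /LOm; exact: FG.
pose Fx := filter_prod \oo (nbhs x).
have TL s : 0 <= s <= 1 -> Fx (trajectory F s @^-1` L).
  move=> /andP[_ s1]; apply: filterS HL => p H /=; apply: H; exact: truncn_leN.
(* Along an ultrafilter a limit exists at each time by compactness of [L]; together these limits
   form a solution. *)
have lim_sol (U : set_system (nat * 'cV[R]_n)) : UltraFilter U -> Fx `<=` U ->
    exists y, [/\ sol G Om 1 y, y 0 = x & forall s, 0 <= s <= 1 ->
      L (y s) /\ trajectory F s @ U --> y s].
  move=> UU FU.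
  have H s : exists l, 0 <= s <= 1 -> L l /\ trajectory F s @ U --> l.
    case: (pselect (0 <= s <= 1)) => [s01|ns]; last by exists 0.
    have [l [Ll Hl]] := cL (trajectory F s @ U) _ (FU _ (TL s s01)).
    exists l => _; split => // P Pl.
    have [//|UP] := in_ultra_setVsetC (trajectory F s @^-1` P) UU.
    by have [z []] := Hl (~` P) P UP Pl.
  have /choice[y Hy] := H.
  exists y; split => //; first exact: (euler_limit_sol _ FGL LOm cL FU HL Hy).
  have [_ T0] := Hy 0 ltac:(by rewrite lexx ler01).
  apply: (cvg_unique _ T0) => //.
  move=> P Px; apply: FU; exists (setT, P) => /=; first by split => //; exact: filterT.
  by move=> p [_ Pp] /=; rewrite trajectory0.
have [U0 [UU0 FU0]] := ultraFilterLemma (F := Fx) _.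
have [Y [solY Y0 HY]] := lim_sol U0 UU0 FU0.
(* By uniqueness every refining ultrafilter leads to the same solution, so convergence holds along
   [Fx] itself. *)
have TY s : 0 <= s <= 1 -> trajectory F s @ Fx --> Y s.
  move=> s01; apply: cvg_ultra => U UU FU.
  have [y [soly y0 Hy]] := lim_sol U UU FU.
  rewrite (Hu Y y) //; by have [] := Hy s s01.
exists Y; split => //; first by move=> s /HY [].
have [C C0 [N1 HC]] := uniform_bound cL (fun z Lz => ex_intro _ _ (FGL z Lz)).
have lipT : \forall p \near Fx, [/\ (0 < p.1)%N, (N1 <= p.1)%N &
     forall j, (j <= p.1)%N -> L (iter j (euler F p.1) p.2)].
  have H1 : Fx (fun p => (0 < p.1)%N /\ (N1 <= p.1)%N).
    apply: (@evnear_fst _ _ x (fun N => (0 < N)%N /\ (N1 <= N)%N)).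
    by exists (maxn 1 N1) => // N /=; rewrite geq_max => /andP[].
  by apply: filterS2 H1 HL => p [].
have lipY s u : 0 <= s <= 1 -> 0 <= u <= 1 -> `|Y u - Y s| <= C * `|u - s|.
  move=> s01 u01.
  have C1 : (fun p => `|trajectory F u p - trajectory F s p|) @ Fx --> `|Y u - Y s|.
    by apply: cvg_norm; apply: cvgB; exact: TY.
  have C2 : (fun p : nat * 'cV[R]_n => C * (`|u - s| + 2 * p.1%:R^-1)) @ Fx -->
      C * (`|u - s| + 2 * 0).
    apply: cvgM; first exact: cvg_cst.
    apply: cvgD; first exact: cvg_cst.
    apply: cvgM; first exact: cvg_cst.
    apply: (@ccvg_seq _ R^o n (fun N => N%:R^-1) x 0).
    apply/cvgrPdist_le => e e0; have [N0 N00 HN] := invn_small e0.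
    by exists N0 => // N /= N0N; rewrite sub0r normrN ger0_norm ?invr_ge0 // HN.
  rewrite mulr0 addr0 in C2; apply: (ler_cvg_to C1 C2).
  apply: filterS lipT => -[N x'] /= [H1 H2 H3].
  apply: (@trajectory_increment _ _ _ L) => //; first exact: ltW.
  by move=> z; exact: HC.
move=> e e0.
(* Trajectories are Lipschitz in time up to an error of order [1 / N], so pointwise convergence
   becomes uniform. The errors [3 e / 8], [e / 4] and [e / 8] add up to less than [e]. *)
have /compact_near_coveringP/near_covering_withinP cI := @segment_compact R 0 1.
have := cI _ Fx (fun p s => `|trajectory F s p - Y s| <= e) _.
case.
  move=> s; rewrite /= in_itv /= => s01.
  have d0 : 0 < e / (8 * C) by rewrite divr_gt0 // mulr_gt0.
  have [N2 N20 HN2] := invn_small d0.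
  have T1 : Fx (fun p => `|Y s - trajectory F s p| <= e / 4).
    by move/cvgrPdist_le : (TY s s01); apply; rewrite divr_gt0.
  have T2 : Fx (fun p => (N2 <= p.1)%N).
    by apply: (@evnear_fst _ _ x (fun N => (N2 <= N)%N)); exists N2.
  exists (ball s (e / (8 * C)), [set p | [/\ `|Y s - trajectory F s p| <= e / 4,
     (N2 <= p.1)%N & [/\ (0 < p.1)%N, (N1 <= p.1)%N &
     forall j, (j <= p.1)%N -> L (iter j (euler F p.1) p.2)]]]).
    split => /=; first exact: nbhsx_ballx.
    by apply: filterS2 (filterI T1 T2) lipT => p [].
  move=> [u [N x']] [/= su [h1 h2 [h3 h4 h5]]]; rewrite in_itv /= => u01.
  rewrite /ball /= distrC in su.
  have i1 := @trajectory_increment _ n F L C N x' s u h3 (ltW C0)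
    (fun z => HC N z h4) h5 s01 u01.
  have i2 := lipY _ _ u01 s01; rewrite distrC in i2; rewrite (distrC s u) in i2.
  have i3 : N%:R^-1 <= e / (8 * C) by exact: HN2.
  have i4 : C * (`|u - s| + 2 * N%:R^-1) <= e / 8 + 2 * (e / 8).
    have -> : e / 8 + 2 * (e / 8) = C * (e / (8 * C) + 2 * (e / (8 * C))).
      by field; rewrite gt_eqF.
    by rewrite ler_wpM2l ?(ltW C0) // lerD ?(ltW su) // ler_wpM2l.
  have i5 : C * `|u - s| <= e / 8.
    have -> : e / 8 = C * (e / (8 * C)) by field; rewrite gt_eqF.
    by rewrite ler_wpM2l ?(ltW C0) // ltW.
  have -> : trajectory F u (N, x') - Y u = (trajectory F u (N, x') - trajectory F s (N, x'))
     - (Y s - trajectory F s (N, x')) - (Y u - Y s).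
    by apply/colP => k; rewrite !mxE; ring.
  have := ler_normB (trajectory F u (N, x') - trajectory F s (N, x')
     - (Y s - trajectory F s (N, x'))) (Y u - Y s).
  have := ler_normB (trajectory F u (N, x') - trajectory F s (N, x'))
     (Y s - trajectory F s (N, x')).
  lra.
move=> [A B] /= [HA HB] HAB.
have T2 : Fx (fun p => (0 < p.1)%N).
  by apply: (@evnear_fst _ _ x (fun N => (0 < N)%N)); exists 1%N.
have T3 : Fx (A `*` B) by exists (A, B).
apply: filterS2 T2 T3 => -[N x'] /= N0 AB j jN.
have N0' : N%:R != 0 :> R by rewrite pnatr_eq0 -lt0n.
have := HAB (N, x') AB (j%:R / N%:R); rewrite /= in_itv /=.
rewrite divr_ge0 // ler_pdivrMr ?ltr0n // mul1r ler_nat jN => /(_ isT).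
by rewrite /trajectory /= divfK // natrK.
Qed.

End EulerConvergence.

(** * The tangent lift of an Euler scheme *)

Section TangentLift.
Variable R : realType.

Definition jac n m (f : 'cV[R]_n -> 'cV[R]_m) (x : 'cV[R]_n) : 'M[R]_(m, n) :=
  \matrix_(i, j) pd j (fun z => f z i ord0) x.

(* Iterating the Euler scheme of [tlift F] from [(x, v)] applies to [v] the Jacobian
   at [x] of the iterated Euler scheme of [F]. *)
Definition tlift n (F : nat -> 'cV[R]_n -> 'cV[R]_n) (N : nat) (z : 'cV[R]_(n + n)) :
  'cV[R]_(n + n) :=
  col_mx (F N (usubmx z)) (jac (F N) (usubmx z) *m dsubmx z).

Definition cdiff n m (f : 'cV[R]_n -> 'cV[R]_m) (x : 'cV[R]_n) : Prop :=
  forall i, differentiable (fun z => f z i ord0) x.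

Lemma jac_comp n m p (g : 'cV[R]_m -> 'cV[R]_p) (f : 'cV[R]_n -> 'cV[R]_m) x :
  cdiff f x -> cdiff g (f x) -> jac (g \o f) x = jac g (f x) *m jac f x.
Proof.
move=> df dg; apply/matrixP => i j; rewrite !mxE.
rewrite [LHS](pd_comp (F := f) (g := fun z => g z i ord0) j df (dg i)).
by apply: eq_bigr => k _; rewrite !mxE mulrC.
Qed.

Lemma cdiff_comp n m p (g : 'cV[R]_m -> 'cV[R]_p) (f : 'cV[R]_n -> 'cV[R]_m) x :
  cdiff f x -> cdiff g (f x) -> cdiff (g \o f) x.
Proof.
move=> df dg i; apply: (@differentiable_comp _ _ _ _ f (fun z => g z i ord0)) => //.
exact: differentiable_cV.
Qed.

Lemma jac_id n (x : 'cV[R]_n) : jac id x = 1%:M.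
Proof. by apply/matrixP => i j; rewrite !mxE pd_coord eq_sym. Qed.

Lemma cdiff_euler n (F : nat -> 'cV[R]_n -> 'cV[R]_n) N x :
  cdiff (F N) x -> cdiff (euler F N) x.
Proof.
move=> dF i.
have -> : (fun z => euler F N z i ord0) =
    (fun z : 'cV[R]_n => z i ord0) + (fun z => N%:R^-1 *: F N z i ord0).
  by apply/funext => z; rewrite /euler !mxE.
apply: differentiableD; first exact: differentiable_coord.
exact: differentiableZ.
Qed.

Lemma jac_euler n (F : nat -> 'cV[R]_n -> 'cV[R]_n) N x :
  cdiff (F N) x -> jac (euler F N) x = 1%:M + N%:R^-1 *: jac (F N) x.
Proof.
move=> dF; apply/matrixP => i j; rewrite !mxE.
have -> : (fun z => euler F N z i ord0) =
    (fun z : 'cV[R]_n => z i ord0 + N%:R^-1 * F N z i ord0).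
  by apply/funext => z; rewrite /euler !mxE.
have dc : differentiable (fun z : 'cV[R]_n => z i ord0 : R) x.
  exact: differentiable_coord.
rewrite pdD //; last exact: differentiableZ.
rewrite pdM ?pd_cst ?mulr0 ?addr0 ?pd_coord 1?eq_sym //.
Qed.

Lemma iter_euler_lift n (F : nat -> 'cV[R]_n -> 'cV[R]_n) N x v j :
  (forall k, (k < j)%N -> cdiff (F N) (iter k (euler F N) x)) ->
  cdiff (iter j (euler F N)) x /\
  iter j (euler (tlift F) N) (col_mx x v) =
  col_mx (iter j (euler F N) x) (jac (iter j (euler F N)) x *m v).
Proof.
elim: j => [|j IH] H.
  split; first by move=> i; exact: differentiable_coord.
  rewrite (_ : iter 0 (euler F N) = id) // jac_id mul1mx //.
have [dj Ej] := IH (fun k kj => H k (ltnW kj)).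
have de := cdiff_euler (H j (ltnSn j)).
have iE : iter j.+1 (euler F N) = euler F N \o iter j (euler F N) by [].
split; first by rewrite iE; exact: cdiff_comp.
rewrite iterS Ej iE jac_comp // jac_euler; last exact: H.
rewrite {1}/euler /tlift col_mxKu col_mxKd /= scale_col_mx add_col_mx.
by congr col_mx; rewrite !mulmxDl mul1mx -!scalemxAl !mulmxA.
Qed.

Lemma iter_euler_lift_u n (F : nat -> 'cV[R]_n -> 'cV[R]_n) N z j :
  usubmx (iter j (euler (tlift F) N) z) = iter j (euler F N) (usubmx z).
Proof.
elim: j => // j IH; rewrite !iterS -IH {1}/euler raddfD /= linearZ /=.
by rewrite {2}/tlift col_mxKu.
Qed.

Lemma iter_euler_lift_d n (F : nat -> 'cV[R]_n -> 'cV[R]_n) N z j :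
  dsubmx (iter j.+1 (euler (tlift F) N) z) =
  dsubmx (iter j (euler (tlift F) N) z) +
  N%:R^-1 *: (jac (F N) (iter j (euler F N) (usubmx z))
     *m dsubmx (iter j (euler (tlift F) N) z)).
Proof.
by rewrite iterS {1}/euler raddfD /= linearZ /= /tlift col_mxKd iter_euler_lift_u.
Qed.

Lemma mulmx_norm m n (M : 'M[R]_(m, n)) (v : 'cV[R]_n) :
  `|M *m v| <= n%:R * `|M| * `|v|.
Proof.
apply: mx_norm_le => [|i j]; first by rewrite !mulr_ge0.
rewrite mxE (le_trans (ler_norm_sum _ _ _)) //.
apply: (@le_trans _ _ (\sum_(k < n) `|M| * `|v|)).
  apply: ler_sum => k _; rewrite normrM ler_pM //; exact: coord_le_norm.
by rewrite sumr_const card_ord -mulrA mulr_natl.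
Qed.

Lemma usubmx_norm m n (z : 'cV[R]_(m + n)) : `|usubmx z| <= `|z|.
Proof. by apply: mx_norm_le => // i j; rewrite mxE coord_le_norm. Qed.

Lemma dsubmx_norm m n (z : 'cV[R]_(m + n)) : `|dsubmx z| <= `|z|.
Proof. by apply: mx_norm_le => // i j; rewrite mxE coord_le_norm. Qed.

Lemma col_mx_norm m n (u : 'cV[R]_m) (v : 'cV[R]_n) e :
  `|u| <= e -> `|v| <= e -> `|col_mx u v| <= e.
Proof.
move=> ue ve; apply: mx_norm_le => [|i j]; first exact: le_trans ue.
by case: (split_ordP i) => k ->; rewrite ?col_mxEu ?col_mxEd (le_trans (coord_le_norm _ _ _)).
Qed.

Lemma usubmx_continuous m n : continuous (@usubmx R m n 1).
Proof.
move=> z; apply: (@cvg_mx _ _ (nbhs z)) => i j.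
under eq_fun do rewrite mxE; rewrite mxE; exact: coord_continuous.
Qed.

Lemma dsubmx_continuous m n : continuous (@dsubmx R m n 1).
Proof.
move=> z; apply: (@cvg_mx _ _ (nbhs z)) => i j.
under eq_fun do rewrite mxE; rewrite mxE; exact: coord_continuous.
Qed.

Lemma compact_ball n (M : R) : compact [set v : 'cV[R]_n | `|v| <= M].
Proof.
have [M0|M0] := leP 0 M; last first.
  rewrite (_ : mkset _ = set0); first exact: compact0.
  apply/seteqP; split => v //= h.
  by have := le_trans (normr_ge0 v) h; rewrite leNgt M0.
have := @rV_compact R n (fun _ => `[- M, M]%classic) (fun _ => @segment_compact _ _ _).
set S := mkset _ => cS.
have -> : [set v : 'cV[R]_n | `|v| <= M] = (fun w : 'rV[R]_n => w^T) @` S.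
  apply/seteqP; split => [v /= h|_ [w hw <-] /=].
    exists v^T; last by rewrite trmxK.
    move=> i; rewrite /= mxE in_itv /= -ler_norml; apply: le_trans h.
    exact: coord_le_norm.
  apply: mx_norm_le => // i j; rewrite mxE (ord1 j).
  by have := hw i; rewrite /= in_itv /= -ler_norml.
apply: continuous_compact => //; apply: continuous_subspaceT => w.
apply: (@cvg_mx _ _ (nbhs w)) => i j.
under eq_fun do rewrite mxE; rewrite mxE; exact: coord_continuous.
Qed.

Lemma compact_col_mx m n (A : set 'cV[R]_m) (B : set 'cV[R]_n) :
  compact A -> compact B ->
  compact [set z : 'cV[R]_(m + n) | A (usubmx z) /\ B (dsubmx z)].
Proof.
move=> cA cB; have cAB := compact_setX cA cB.
have -> : [set z : 'cV[R]_(m + n) | A (usubmx z) /\ B (dsubmx z)] =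
    (fun p => col_mx p.1 p.2) @` (A `*` B).
  apply/seteqP; split => [z /= [Az Bz]|_ [p [Ap Bp] <-] /=].
    by exists (usubmx z, dsubmx z) => //=; rewrite vsubmxK.
  by rewrite col_mxKu col_mxKd.
apply: continuous_compact => //; apply: continuous_subspaceT => p.
apply: (@cvg_mx _ _ (nbhs p)) => i j.
case: (split_ordP i) => k ->.
  under eq_fun do rewrite col_mxEu; rewrite col_mxEu.
  apply: (@cvg_comp _ _ _ fst (fun u : 'cV[R]_m => u k j) (nbhs p) (nbhs p.1)).
    exact: cvg_fst.
  exact: coord_continuous.
under eq_fun do rewrite col_mxEd; rewrite col_mxEd.
apply: (@cvg_comp _ _ _ snd (fun u : 'cV[R]_n => u k j) (nbhs p) (nbhs p.2)).
  exact: cvg_snd.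
exact: coord_continuous.
Qed.

End TangentLift.

(** * Confinement and convergence of the lifted scheme; Gronwall's inequality *)

Section EulerSmooth.
Variable R : realType.

Lemma Pc_eq n k (A : set 'cV[R]_n) (f g : nat -> 'cV[R]_n -> R) :
  (forall N z, f N z = g N z) -> Pc k A f -> Pc k A g.
Proof. by move=> fg; apply: Pc_ext => x _; apply: nearW => p; exact: fg. Qed.

Definition PcV n m k (A : set 'cV[R]_n) (F : nat -> 'cV[R]_n -> 'cV[R]_m) : Prop :=
  forall i, Pc k A (fun N z => F N z i ord0).

Definition ccvgon n m (A : set 'cV[R]_n) (F : nat -> 'cV[R]_n -> 'cV[R]_m) G : Prop :=
  forall z, A z -> ccvg F z (G z).

Lemma evdiff_cdiff n m k (A : set 'cV[R]_n) (F : nat -> 'cV[R]_n -> 'cV[R]_m) x :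
  PcV k.+1 A F -> A x -> evnear x (fun N z => cdiff (F N) z).
Proof.
move=> HF Ax; apply: (@filter_forall _ _ _ _ _) => j.
by have [_ + _] := HF j; apply.
Qed.

Lemma ccvg_jac n m k (A : set 'cV[R]_n) (F : nat -> 'cV[R]_n -> 'cV[R]_m) G :
  open A -> PcV k.+1 A F -> ccvgon A F G ->
  forall x, A x -> ccvg (fun N => jac (F N)) x (jac G x).
Proof.
move=> oA pF FG x Ax; apply: cvg_mx => i j; rewrite !mxE.
under eq_fun do rewrite mxE.
have [_] := @Pc_derivative_limit R n k A (fun N z => F N z i ord0)
  (fun z => G z i ord0) j oA (pF i) (fun y Ay => ccvg_coord (FG y Ay)) x Ax.
exact.
Qed.

Lemma ccvg_lift n k (Om : set 'cV[R]_n) F G : open Om -> PcV k.+1 Om F ->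
  ccvgon Om F G ->
  ccvgon [set z | Om (usubmx z)] (tlift F) (tlift (fun _ => G) 0).
Proof.
move=> oO pF FG z /= Oz.
have cu : ccvg (fun _ (z : 'cV[R]_(n + n)) => usubmx z) z (usubmx z).
  by apply: ccvg_cst; exact: usubmx_continuous.
have cJ := ccvg_comp cu (ccvg_jac oO pF FG Oz).
have cF := ccvg_comp cu (FG _ Oz).
apply: ccvg_mx => i; rewrite /tlift; case: (split_ordP i) => k' ->.
  rewrite col_mxEu; apply: ccvg_ext (ccvg_coord (j := k') cF); apply: nearW => p /=.
  by rewrite col_mxEu.
rewrite col_mxEd.
have H : ccvg (fun N z => \sum_(j <- index_enum 'I_n) jac (F N) (usubmx z) k' j
     * dsubmx z j ord0) z
    (\sum_(j <- index_enum 'I_n) jac G (usubmx z) k' j * dsubmx z j ord0).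
  apply: ccvg_sum => j; apply: ccvgM.
    apply: (cvg_comp _ (fun M : 'M[R]_n => M k' j) cJ); exact: coord_continuous.
  have cd : ccvg (fun _ (z : 'cV[R]_(n + n)) => dsubmx z) z (dsubmx z).
    by apply: ccvg_cst; exact: dsubmx_continuous.
  exact: (ccvg_coord (j := j) cd).
rewrite [X in ccvg _ _ X]mxE; apply: ccvg_ext H; apply: nearW => p /=.
by rewrite col_mxEd mxE.
Qed.

Lemma open_usubmx m n (A : set 'cV[R]_m) : open A ->
  open [set z : 'cV[R]_(m + n) | A (usubmx z)].
Proof. by move=> oA; apply: open_comp => // z _; exact: usubmx_continuous. Qed.

Lemma Pc_usubmx m n k (A : set 'cV[R]_m) (f : nat -> 'cV[R]_m -> R) :
  Pc k A f -> Pc k [set z : 'cV[R]_(m + n) | A (usubmx z)] (fun N z => f N (usubmx z)).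
Proof.
move=> pf; apply: (Pc_comp pf).
  move=> j; apply: (Pc_eq (f := fun _ z => z (lshift n j) ord0)).
    by move=> N z; rewrite mxE.
  exact: Pc_coord.
move=> x l /= Ax cl.
have cu : ccvg (fun _ (z : 'cV[R]_(m + n)) => usubmx z) x (usubmx x).
  by apply: ccvg_cst; exact: usubmx_continuous.
by rewrite (ccvg_unique cl cu).
Qed.

Lemma PcV_lift n k (Om : set 'cV[R]_n) F : PcV k.+1 Om F ->
  PcV k [set z : 'cV[R]_(n + n) | Om (usubmx z)] (tlift F).
Proof.
move=> pF i; rewrite /tlift; case: (split_ordP i) => j ->.
  apply: (Pc_eq (f := fun N z => F N (usubmx z) j ord0)).
    by move=> N z; rewrite col_mxEu.
  have H := Pc_pred (pF j); exact: (Pc_usubmx n H).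
apply: (Pc_eq (f := fun N z => \sum_(l <- index_enum 'I_n)
    pd l (fun z => F N z j ord0) (usubmx z) * z (rshift n l) ord0)).
  move=> N z; rewrite col_mxEd mxE; apply: eq_bigr => l _.
  by rewrite !mxE.
apply: Pc_sum => l; apply: Pc_mul; last exact: Pc_coord.
have [_ _ /(_ l) H] := pF j.
exact: (Pc_usubmx n H).
Qed.

(** Discrete Gronwall estimate: one step multiplies the norm of the tangent vector by at most
    [1 + C' / N], hence at most [N] steps by at most [expR C']. *)
Lemma confined_lift n (Om : set 'cV[R]_n) F G L x v :
  open Om -> PcV 1 Om F -> ccvgon Om F G -> L `<=` Om -> compact L ->
  confined F L x ->
  exists M, confined (tlift F)
    [set z : 'cV[R]_(n + n) | L (usubmx z) /\ `|dsubmx z| <= M] (col_mx x v).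
Proof.
move=> oO pF FG LOm cL HL.
have [C C0 [N1 HC]] := uniform_bound cL (fun z Lz =>
  ex_intro _ _ (ccvg_jac oO pF FG (LOm z Lz))).
(* The factor [n] is the cost of the maximum norm in [mulmx_norm]. The summand 1 in the bound below
   leaves room for starting vectors near [v]. *)
pose C' := n%:R * C; have C'0 : 0 <= C' by rewrite mulr_ge0 // ltW.
exists (expR C' * (`|v| + 1)).
have cu : ccvg (fun _ (z : 'cV[R]_(n + n)) => usubmx z) (col_mx x v) x.
  by rewrite -{2}(col_mxKu x v); apply: ccvg_cst; exact: usubmx_continuous.
have cd : ccvg (fun _ (z : 'cV[R]_(n + n)) => dsubmx z) (col_mx x v) v.
  by rewrite -{2}(col_mxKd x v); apply: ccvg_cst; exact: dsubmx_continuous.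
have H1 := evnear_comp cu HL.
have H2 : evnear (col_mx x v) (fun _ (z : 'cV[R]_(n + n)) => `|v - dsubmx z| <= 1).
  by move/cvgrPdist_le : cd; apply.
have H3 : evnear (col_mx x v) (fun N _ => (0 < N)%N /\ (N1 <= N)%N).
  apply: (@evnear_fst _ _ _ (fun N => (0 < N)%N /\ (N1 <= N)%N)).
  by exists (maxn 1 N1) => // N /=; rewrite geq_max => /andP[].
apply: filterS2 (filterI H1 H2) H3 => -[N z] /= [h1 h2] [N0 h3] j jN.
rewrite iter_euler_lift_u; split; first exact: h1.
have N0' : 0 < N%:R :> R by rewrite ltr0n.
have vz : `|dsubmx z| <= `|v| + 1.
  rewrite -(subrK v (dsubmx z)) addrC (le_trans (ler_normD _ _)) // lerD2l.
  by rewrite distrC.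
have step k : (k <= N)%N ->
    `|dsubmx (iter k (euler (tlift F) N) z)| <= expR (C' * (k%:R / N%:R)) * (`|v| + 1).
  elim: k => [|k IH] kN; first by rewrite mul0r mulr0 expR0 mul1r.
  rewrite iter_euler_lift_d.
  set w := dsubmx _ in IH *; set J := jac _ _.
  have wle := IH (ltnW kN).
  have Jw : `|J *m w| <= C' * `|w|.
    rewrite (le_trans (mulmx_norm _ _)) // ler_wpM2r // ler_wpM2l //.
    by apply: HC => //; apply: h1; exact: ltnW.
  apply: (le_trans (ler_normD _ _)); rewrite normrZ ger0_norm ?invr_ge0 //.
  apply: (@le_trans _ _ ((1 + C' / N%:R) * `|w|)).
    by rewrite mulrDl mul1r lerD2l mulrC -mulrA [_ * `|w|]mulrC mulrA
      ler_wpM2r ?invr_ge0.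
  have -> : C' * (k.+1%:R / N%:R) = C' / N%:R + C' * (k%:R / N%:R).
    by rewrite -(addn1 k) natrD; field; rewrite gt_eqF.
  rewrite expRD -mulrA; apply: ler_pM => //; last exact: expR_ge1Dx.
  by rewrite addr_ge0 // divr_ge0.
apply: (le_trans (step j jN)); rewrite ler_wpM2r ?addr_ge0 // ler_expR.
by rewrite ler_piMr // ler_pdivrMr // mul1r ler_nat.
Qed.

Lemma sol_continuous n (G : 'cV[R]_n -> 'cV[R]_n) Om y s : sol G Om 1 y ->
  0 <= s <= 1 -> forall e, 0 < e -> exists2 d, 0 < d & forall u, 0 <= u <= 1 ->
    `|u - s| <= d -> `|y u - y s| <= e.
Proof.
move=> soly s01 e e0; have [_ /(_ 1 ltr01)[d d0 Hd]] := soly s s01.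
pose B := 1 + `|G (y s)|; have B0 : 0 < B by rewrite ltr_pwDl.
exists (Num.min d (e / B)); first by rewrite lt_min d0 divr_gt0.
move=> u u01; rewrite le_min => /andP[ud ue].
have := Hd u u01 ud; rewrite mul1r => h.
rewrite -(subrK ((u - s) *: G (y s)) (y u - y s)).
apply: (le_trans (ler_normD _ _)); rewrite normrZ.
apply: (le_trans (lerD h (lexx _))).
rewrite -{1}[`|u - s|]mulr1 -mulrDr -/B.
by rewrite -ler_pdivlMr.
Qed.

(* Gronwall's inequality for a differential inequality stated with difference
   quotients: [e * expR ((C + 1) * s)] is a strict supersolution. *)
Lemma gronwall_zero n (w : R -> 'cV[R]_n) (C : R) : 0 <= C -> w 0 = 0 ->
  (forall s, 0 <= s <= 1 -> forall e, 0 < e -> exists2 d, 0 < d &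
    forall u, 0 <= u <= 1 -> `|u - s| <= d ->
      `|w u - w s| <= (C * `|w s| + e) * `|u - s|) ->
  forall s, 0 <= s <= 1 -> w s = 0.
Proof.
move=> C0 w0 Hw.
have key e : 0 < e -> forall s, 0 <= s <= 1 -> `|w s| <= e * expR ((C + 1) * s).
  move=> e0; apply: real_induction.
  - by rewrite w0 normr0 mulr_ge0 ?expR_ge0 // ltW.
  - move=> s /andP[s0 s1] Hs.
    have [d d0 Hd] := Hw s ltac:(by rewrite s0 ltW) e e0.
    exists d => // u /andP[su ud] u1.
    have us : 0 <= u - s by rewrite subr_ge0.
    have h := Hd u ltac:(by rewrite (le_trans s0)) ltac:(by rewrite ger0_norm // lerBlDl).
    rewrite (ger0_norm us) in h.
    have hs := Hs s ltac:(by rewrite s0 lexx).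
    have hu : `|w u| <= `|w s| + (C * `|w s| + e) * (u - s).
      by rewrite -{1}(subrK (w s) (w u)) addrC (le_trans (ler_normD _ _)) // lerD2l.
    apply: (le_trans hu).
    set E := e * expR ((C + 1) * s) in hs *.
    have eE : e <= E.
      rewrite ler_peMr ?(ltW e0) // -expR0 ler_expR mulr_ge0 //.
      by rewrite addr_ge0.
    have -> : e * expR ((C + 1) * u) = E * expR ((C + 1) * (u - s)).
      by rewrite /E -mulrA -expRD; congr (_ * expR _); ring.
    apply: (@le_trans _ _ (E * (1 + (C + 1) * (u - s)))); last first.
      by rewrite ler_wpM2l ?expR_ge1Dx // (le_trans (ltW e0)).
    have -> : E * (1 + (C + 1) * (u - s)) = E + (C * E + E) * (u - s) by ring.
    by apply: lerD => //; rewrite ler_wpM2r // lerD // ler_wpM2l.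
  - move=> s /andP[s0 s1] Hs; rewrite leNgt; apply/negP => hgt.
    set E := e * expR ((C + 1) * s) in hgt.
    have [d d0 Hd] := Hw s ltac:(by rewrite ltW) 1 ltr01.
    pose B := C * `|w s| + 1; have B0 : 0 < B by rewrite ltr_wpDl // mulr_ge0.
    (* On [[s - m, s]] the curve [w] changes by at most half of the excess [|w s| - E], so the
       excess would be visible before [s] already. *)
    pose m := Num.min d (Num.min (s / 2) ((`|w s| - E) / (2 * B))).
    have m0 : 0 < m.
      rewrite !lt_min d0 divr_gt0 //= divr_gt0 ?subr_gt0 //; exact: mulr_gt0.
    have md : m <= d by rewrite ge_min lexx.
    have ms : m <= s / 2 by rewrite !ge_min lexx orbT.
    have mB : m * B <= (`|w s| - E) / 2.
      rewrite -ler_pdivlMr // -mulrA -invfM.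
      by rewrite !ge_min lexx !orbT.
    have u0 : 0 <= s - m by lra.
    have h := Hd (s - m) ltac:(apply/andP; split; lra).
    have E1 : s - m - s = - m by ring.
    rewrite E1 normrN (ger0_norm (ltW m0)) in h.
    have hu := Hs (s - m) ltac:(apply/andP; split; lra).
    have hE : e * expR ((C + 1) * (s - m)) <= E.
      rewrite /E ler_wpM2l ?(ltW e0) // ler_expR ler_wpM2l ?addr_ge0 //; lra.
    have h2 : `|w s| <= `|w (s - m)| + `|w (s - m) - w s|.
      rewrite -{1}(subrK (w (s - m)) (w s)) addrC (le_trans (ler_normD _ _)) //.
      by rewrite lerD2l distrC.
    have h3 := h md; rewrite -/B mulrC in h3.
    lra.
move=> s s01; apply/eqP; rewrite -normr_eq0 eq_le normr_ge0 andbT.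
rewrite leNgt; apply/negP => ws0.
pose E := expR ((C + 1) * s); have E0 : 0 < E by exact: expR_gt0.
(* For this [e] the bound of [key] at [s] reads [|w s| <= |w s| / 2]. *)
have := key (`|w s| / (2 * E)) ltac:(by rewrite divr_gt0 // mulr_gt0) s s01.
rewrite -/E (_ : _ / _ * E = `|w s| / 2); first lra.
by field; rewrite gt_eqF.
Qed.

End EulerSmooth.

(** * Uniqueness for the lifted field and the induction on the order *)

Section EulerMain.
Variable R : realType.

Lemma sol_usubmx n (G : 'cV[R]_n -> 'cV[R]_n) Om y :
  sol (tlift (fun _ => G) 0) [set z : 'cV[R]_(n + n) | Om (usubmx z)] 1 y ->
  sol G Om 1 (fun s => usubmx (y s)).
Proof.
move=> soly s s01; have [Oy Hy] := soly s s01; split => // e e0.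
have [d d0 Hd] := Hy e e0; exists d => // u u01 us.
apply: le_trans (Hd u u01 us).
rewrite (_ : usubmx (y u) - _ - _ = usubmx (y u - y s - (u - s) *: tlift (fun _ => G) 0 (y s))).
  exact: usubmx_norm.
have E : usubmx (tlift (fun _ => G) 0 (y s)) = G (usubmx (y s)) by rewrite /tlift col_mxKu.
rewrite -E; move: (tlift _ _ _) => w.
by apply/colP => i; rewrite !mxE.
Qed.

(** The base curves coincide by uniqueness for [G], so both tangent parts solve the same linear
    equation along [Y], whose coefficient is bounded on [L]; Gronwall's inequality makes their
    difference vanish. *)
Lemma uniq_tlift n (Om : set 'cV[R]_n) F G L x v :
  open Om -> PcV 1 Om F -> ccvgon Om F G -> L `<=` Om -> compact L ->
  confined F L x -> uniq_sol G Om x ->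
  uniq_sol (tlift (fun _ => G) 0) [set z : 'cV[R]_(n + n) | Om (usubmx z)]
    (col_mx x v).
Proof.
move=> oO pF FG LOm cL HL Hu y1 y2 sol1 sol2 y10 y20.
have [Y [solY Y0 LY _]] := euler_cvg FG LOm cL HL Hu.
have su1 := sol_usubmx sol1; have su2 := sol_usubmx sol2.
have u1 : forall s, 0 <= s <= 1 -> usubmx (y1 s) = Y s.
  by apply: (Hu _ _ su1 solY) => //; rewrite y10 col_mxKu.
have u2 : forall s, 0 <= s <= 1 -> usubmx (y2 s) = Y s.
  by apply: (Hu _ _ su2 solY) => //; rewrite y20 col_mxKu.
have cJ z : L z -> ccvg (fun N => jac (F N)) z (jac G z).
  by move=> /LOm; exact: ccvg_jac oO pF FG _.
have [C C0 [N1 HC]] := uniform_bound cL (fun z Lz => ex_intro _ _ (cJ z Lz)).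
have HJ z : L z -> `|jac G z| <= C.
  move=> Lz; have := ccvg_pt (cJ z Lz) => /cvg_norm H.
  by apply: (cvgr_to_le H); exists N1 => // N /= HN; exact: HC.
pose w s := dsubmx (y1 s) - dsubmx (y2 s).
have w0 : forall s, 0 <= s <= 1 -> w s = 0.
  apply: (@gronwall_zero _ _ _ (n%:R * C)).
  - by rewrite mulr_ge0 // ltW.
  - by rewrite /w y10 y20 subrr.
  - move=> s s01 e e0; have e20 : 0 < e / 2 by rewrite divr_gt0.
    have [_ /(_ _ e20)[d1 d10 H1]] := sol1 s s01.
    have [_ /(_ _ e20)[d2 d20 H2]] := sol2 s s01.
    exists (Num.min d1 d2); first by rewrite lt_min d10.
    move=> u u01; rewrite le_min => /andP[ud1 ud2].
    have h1 := le_trans (dsubmx_norm _) (H1 u u01 ud1).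
    have h2 := le_trans (dsubmx_norm _) (H2 u u01 ud2).
    have E y : usubmx (y s) = Y s ->
       dsubmx (y u - y s - (u - s) *: tlift (fun _ => G) 0 (y s)) =
       dsubmx (y u) - dsubmx (y s) - (u - s) *: (jac G (Y s) *m dsubmx (y s)).
      by move=> yY; rewrite /tlift yY !raddfB /= linearZ /= col_mxKd.
    rewrite (E _ (u1 s s01)) in h1; rewrite (E _ (u2 s s01)) in h2.
    have -> : w u - w s = (dsubmx (y1 u) - dsubmx (y1 s)
          - (u - s) *: (jac G (Y s) *m dsubmx (y1 s)))
        - (dsubmx (y2 u) - dsubmx (y2 s) - (u - s) *: (jac G (Y s) *m dsubmx (y2 s)))
        + (u - s) *: (jac G (Y s) *m w s).
      rewrite /w mulmxBr; move: (jac _ _ *m _) (jac _ _ *m _) => a b.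
      by apply/colP => i; rewrite !mxE; ring.
    apply: (le_trans (ler_normD _ _)); rewrite normrZ.
    have h3 : `|jac G (Y s) *m w s| <= n%:R * C * `|w s|.
      rewrite (le_trans (mulmx_norm _ _)) // ler_wpM2r // ler_wpM2l //.
      by apply: HJ; exact: LY.
    have h4 : `|u - s| * `|jac G (Y s) *m w s| <= `|u - s| * (n%:R * C * `|w s|).
      by rewrite ler_wpM2l.
    have h5 := ler_normB (dsubmx (y1 u) - dsubmx (y1 s)
          - (u - s) *: (jac G (Y s) *m dsubmx (y1 s)))
       (dsubmx (y2 u) - dsubmx (y2 s) - (u - s) *: (jac G (Y s) *m dsubmx (y2 s))).
    lra.
move=> s s01; rewrite -[y1 s]vsubmxK -[y2 s]vsubmxK u1 // u2 //.
by congr col_mx; apply/eqP; rewrite -subr_eq0; apply/eqP; exact: w0.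
Qed.

Lemma col_mx_ccvg n (x : 'cV[R]_n) v :
  ccvg (fun _ z => col_mx z v : 'cV[R]_(n + n)) x (col_mx x v).
Proof.
apply: ccvg_mx => i; case: (split_ordP i) => j ->.
  rewrite col_mxEu.
  under eq_fun => N do under eq_fun => z do rewrite col_mxEu.
  by apply: (ccvg_coord (f := fun _ z => z) (l := x)); exact: ccvg_id.
rewrite col_mxEd.
under eq_fun => N do under eq_fun => z do rewrite col_mxEd.
exact: (@cvg_cst _ _ _ (filter_prod \oo (nbhs x)) _).
Qed.

Theorem euler_smooth r n (Om A : set 'cV[R]_n) F G :
  open Om -> open A -> PcV r Om F -> ccvgon Om F G ->
  (forall x, A x -> uniq_sol G Om x /\
     exists L, [/\ L `<=` Om, compact L & confined F L x]) ->
  PcV r A (fun N => iter N (euler (F) N)).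
Proof.
(* Each lift doubles the dimension, so the dimension, the domains and the fields vary in the
   induction. *)
elim: r n Om A F G => [|r IH] n Om A F G oO oA pF FG HA.
  move=> i x Ax; have [Hu [L [LO cL HL]]] := HA x Ax.
  have [Y [_ _ _ HY]] := euler_cvg FG LO cL HL Hu.
  exists (Y 1 i ord0); apply: (ccvg_coord (l := Y 1)).
  apply/cvgrPdist_le => e e0.
  have H1 : evnear x (fun N _ => (0 < N)%N).
    by apply: (@evnear_fst _ _ _ (fun N => (0 < N)%N)); exists 1%N.
  apply: filterS2 (HY e e0) H1 => p H N0; rewrite distrC.
  by have := H p.1 (leqnn _); rewrite divff // pnatr_eq0 -lt0n.
have pF1 : PcV 1 Om F by move=> i; exact: Pc_le (pF i).
have pF0 : PcV 0 Om F by move=> i; exact: Pc_le (pF i).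
have base : PcV 0 A (fun N => iter N (euler F N)).
  move=> i x Ax; have [Hu [L [LO cL HL]]] := HA x Ax.
  have [Y [_ _ _ HY]] := euler_cvg FG LO cL HL Hu.
  exists (Y 1 i ord0); apply: (ccvg_coord (l := Y 1)).
  apply/cvgrPdist_le => e e0.
  have H1 : evnear x (fun N _ => (0 < N)%N).
    by apply: (@evnear_fst _ _ _ (fun N => (0 < N)%N)); exists 1%N.
  apply: filterS2 (HY e e0) H1 => p H N0; rewrite distrC.
  by have := H p.1 (leqnn _); rewrite divff // pnatr_eq0 -lt0n.
(* On the compact set [L] the fields are differentiable from a common index on, which is what
   [iter_euler_lift] asks along the iterates. *)
have dF x : A x -> evnear x (fun N z => forall v, cdiff (iter N (euler F N)) z /\
    iter N (euler (tlift F) N) (col_mx z v) =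
      col_mx (iter N (euler F N) z) (jac (iter N (euler F N)) z *m v)).
  move=> Ax; have [_ [L [LO cL HL]]] := HA x Ax.
  have [N1 HN1] : exists N0 : nat, forall N x, (N0 <= N)%N -> L x -> cdiff (F N) x.
    apply: (compact_evnear cL) => z /LO Oz; exact: evdiff_cdiff pF1 Oz.
  have H1 : evnear x (fun N _ => (N1 <= N)%N).
    by apply: (@evnear_fst _ _ _ (fun N => (N1 <= N)%N)); exists N1.
  apply: filterS2 HL H1 => p H Np v; apply: iter_euler_lift => k kN.
  by apply: HN1 => //; apply: H; exact: ltnW.
have lifted : PcV r [set z : 'cV[R]_(n + n) | A (usubmx z)]
    (fun N => iter N (euler (tlift F) N)).
  apply: (IH _ [set z | Om (usubmx z)] _ _ (tlift (fun _ => G) 0)).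
  - exact: open_usubmx.
  - exact: open_usubmx.
  - exact: PcV_lift.
  - exact: ccvg_lift pF FG.
  - move=> z /= Az; have [Hu [L [LO cL HL]]] := HA _ Az.
    rewrite -[z]vsubmxK; split; first exact: uniq_tlift oO pF1 FG LO cL HL Hu.
    have [M HM] := confined_lift (dsubmx z) oO pF1 FG LO cL HL.
    exists [set z : 'cV[R]_(n + n) | L (usubmx z) /\ `|dsubmx z| <= M].
    split => //; first by move=> w /= [/LO].
    exact: (compact_col_mx cL (@compact_ball R n M)).
move=> i; split.
- by move=> x Ax; exact: base.
- move=> x Ax; apply: filterS (dF x Ax) => p /(_ 0)[+ _]; exact.
- move=> j.
  (* The [j]-th column of the Jacobian is the tangent part of the lifted iterate started with the
     [j]-th basis vector. *)
  have H : Pc r A (fun N z => iter N (euler (tlift F) N)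
      (col_mx z (delta_mx j ord0)) (rshift n i) ord0).
    apply: (Pc_comp (lifted (rshift n i))
      (F := fun _ z => col_mx z (delta_mx j ord0))).
      move=> k; case: (split_ordP k) => l ->.
        apply: (Pc_eq (f := fun _ z => z l ord0)); last exact: Pc_coord.
        by move=> N z; rewrite col_mxEu.
      apply: (Pc_eq (f := fun _ z => (delta_mx j ord0 : 'cV[R]_n) l ord0)).
        by move=> N z; rewrite col_mxEd.
      exact: Pc_cst.
    move=> x l Ax cl; rewrite (ccvg_unique cl (@col_mx_ccvg _ x (delta_mx j ord0))).
    by rewrite /= col_mxKu.
  apply: Pc_ext H => x Ax; apply: filterS (dF x Ax) => p /(_ (delta_mx j ord0))[_ ->].
  rewrite col_mxEd mxE (bigD1 j) //= big1 ?addr0.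
    by rewrite !mxE !eqxx mulr1.
  by move=> k kj; rewrite !mxE (negbTE kj) mulr0.
Qed.

End EulerMain.

(** * Confinement of the scheme to a tube around the orbit *)

Section Confinement.
Variable R : realType.

Definition dist_orbit n (Y : R -> 'cV[R]_n) (z : 'cV[R]_n) : R :=
  inf [set `|z - Y s| | s in `[0, 1]%classic].

Lemma has_inf_orbit n (Y : R -> 'cV[R]_n) z :
  has_inf [set `|z - Y s| | s in `[0, 1]%classic].
Proof.
split; first by exists `|z - Y 0|, 0 => //=; rewrite in_itv /= lexx ler01.
by exists 0 => _ [s _ <-].
Qed.

Lemma dist_orbit_le n (Y : R -> 'cV[R]_n) z s : 0 <= s <= 1 ->
  dist_orbit Y z <= `|z - Y s|.
Proof.
move=> s01; apply: ge_inf; first by case: (has_inf_orbit Y z).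
by exists s => //=; rewrite in_itv.
Qed.

Lemma dist_orbit_lt n (Y : R -> 'cV[R]_n) z e : dist_orbit Y z < e ->
  exists2 s, 0 <= s <= 1 & `|z - Y s| < e.
Proof.
move=> h; have e0 : 0 < e - dist_orbit Y z by rewrite subr_gt0.
have [_ [s + <-]] := inf_adherent e0 (has_inf_orbit Y z).
by rewrite /= in_itv /= -/(dist_orbit Y z) (addrC _ (e - _)) subrK => s01 hs; exists s.
Qed.

Lemma dist_orbit_lip n (Y : R -> 'cV[R]_n) z w :
  `|dist_orbit Y z - dist_orbit Y w| <= `|z - w|.
Proof.
have H a b : dist_orbit Y a - dist_orbit Y b <= `|a - b|.
  rewrite lerBlDr -lerBlDl; apply: lb_le_inf; first by case: (has_inf_orbit Y b).
  move=> _ [s /= + <-]; rewrite in_itv /= => s01.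
  rewrite lerBlDl; apply: (le_trans (dist_orbit_le Y a s01)).
  have -> : a - Y s = (a - b) + (b - Y s) by rewrite addrA subrK.
  exact: ler_normD.
by rewrite ler_norml H andbT lerNl opprB distrC H.
Qed.

Lemma dist_orbit_continuous n (Y : R -> 'cV[R]_n) : continuous (dist_orbit Y).
Proof.
move=> z; apply/(@cvgrPdist_le _ _ _ (nbhs z)) => e e0.
apply/nbhs_ballP; exists e => //= w; rewrite -ball_normE /= => zw.
by apply: le_trans (ltW zw); exact: dist_orbit_lip.
Qed.

(** Linear between the values 1 at [rho] and 0 at [2 * rho]: continuity is the regularity that order
    zero convergence asks of the cut-off field. *)
Definition cutoff (rho d : R) : R := Num.max 0 (Num.min 1 (2 - d / rho)).

Lemma cutoff_ge0 rho d : 0 <= cutoff rho d.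
Proof. by rewrite le_max lexx. Qed.

Lemma cutoff_le1 rho d : cutoff rho d <= 1.
Proof. by rewrite ge_max ler01 ge_min lexx. Qed.

Lemma cutoff1 rho d : 0 < rho -> d <= rho -> cutoff rho d = 1.
Proof.
move=> r0 dr; have h : d / rho <= 1 by rewrite ler_pdivrMr // mul1r.
rewrite /cutoff (min_l (x := 1)); last lra.
by rewrite max_r.
Qed.

Lemma cutoff0 rho d : 0 < rho -> 2 * rho <= d -> cutoff rho d = 0.
Proof.
move=> r0 dr; have h : 2 <= d / rho by rewrite ler_pdivlMr.
rewrite /cutoff max_l // ge_min; apply/orP; right; lra.
Qed.

Lemma cutoff_continuous rho : continuous (cutoff rho).
Proof.
have H : continuous ((cst 0 : R -> R^o) \max
    ((cst 1 : R -> R^o) \min (fun d => 2 - d / rho : R^o))).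
  move=> d; apply: continuous_max; first exact: cst_continuous.
  apply: continuous_min; first exact: cst_continuous.
  apply: (@cvgB _ _ _ (nbhs d)); first exact: cvg_cst.
  by apply: (@cvgM _ _ (nbhs d)); [exact: cvg_id|exact: cvg_cst].
exact: H.
Qed.

Lemma orbit_tube n (Om : set 'cV[R]_n) G Y : open Om -> sol G Om 1 Y ->
  exists2 rho, 0 < rho & forall s z, 0 <= s <= 1 -> `|z - Y s| < rho -> Om z.
Proof.
move=> oO solY.
have /compact_near_coveringP/near_covering_withinP cI := @segment_compact R 0 1.
have := cI _ (0^'+ : set_system R) (fun rho s => forall z, `|z - Y s| < rho -> Om z) _.
case.
  move=> s; rewrite /= in_itv /= => s01; have [OY _] := solY s s01.
  have /nbhs_ballP[r r0 Hr] := open_nbhs_nbhs (conj oO OY).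
  have r20 : 0 < r / 2 by rewrite divr_gt0.
  have [d d0 Hd] := sol_continuous solY s01 r20.
  exists (ball s d, [set rho | rho < r / 2]).
    by split => /=; [exact: nbhsx_ballx|exact: nbhs_right_lt].
  move=> [u rho] /= [su rr]; rewrite in_itv /= => u01 z zu.
  apply: Hr; rewrite -ball_normE /= distrC.
  have -> : z - Y s = (z - Y u) + (Y u - Y s) by rewrite addrA subrK.
  apply: (le_lt_trans (ler_normD _ _)).
  rewrite /ball /= distrC in su; have := Hd u u01 (ltW su); lra.
move=> e /= e0 He; exists (e / 2); first by rewrite divr_gt0.
move=> s z s01 zs; apply: (He (e / 2)) (zs); last first.
- by rewrite /= in_itv.
- by rewrite divr_gt0.
- rewrite /= sub0r normrN ger0_norm ?divr_ge0 ?(ltW e0) //.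
  by rewrite ltr_pdivrMr // ltr_pMr // ltr1n.
Qed.

(** The cut-off fields converge on the whole space and are bounded, so their scheme converges
    uniformly once the cut-off equation has a unique solution. As long as such a solution stays
    where the cut-off is 1 it solves the original equation, hence equals [Y], hence stays there a
    little longer. The cut-off scheme thus ends up within [rho] of [Y], where it is the original
    scheme. Uniqueness is assumed for every [b] because solutions are compared on initial time
    intervals. *)
Lemma confined_of_solution n (Om : set 'cV[R]_n) F G x Y :
  open Om -> ccvgon Om F G -> sol G Om 1 Y -> Y 0 = x ->
  (forall b y, 0 <= b <= 1 -> sol G Om b y -> y 0 = x ->
     forall s, 0 <= s <= b -> y s = Y s) ->
  exists L, [/\ L `<=` Om, compact L & confined F L x].
Proof.
move=> oO FG solY Y0 uniqY.
have [rho3 rho30 tube] := orbit_tube oO solY.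
(* Three nested tubes: the cut-off is 1 up to [rho], vanishes from [2 * rho] on, and the tube of
   radius [3 * rho] still lies in [Om]. *)
pose rho := rho3 / 3; have rho0 : 0 < rho by rewrite divr_gt0.
have rho3E : rho3 = 3 * rho by rewrite /rho; field.
pose D := dist_orbit Y.
pose L := [set z | D z <= 2 * rho].
have DOm z : D z < 3 * rho -> Om z.
  by rewrite -rho3E => /dist_orbit_lt[s s01 h]; exact: tube h.
have LOm : L `<=` Om by move=> z Lz; apply: DOm; rewrite /L /= in Lz; lra.
have [B HB] : exists B, forall s, 0 <= s <= 1 -> `|Y s| <= B.
  have /compact_near_coveringP/near_covering_withinP cI := @segment_compact R 0 1.
  have := cI _ (pinfty_nbhs R) (fun B s => `|Y s| <= B) _.
  case.
    move=> s; rewrite /= in_itv /= => s01.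
    have [d d0 Hd] := sol_continuous solY s01 ltr01.
    exists (ball s d, [set B | `|Y s| + 1 <= B]).
      split => /=; first exact: nbhsx_ballx.
      exact: nbhs_pinfty_ge (num_real _).
    move=> [u B] /= [su YB]; rewrite in_itv /= => u01; apply: le_trans YB.
    rewrite /ball /= distrC in su; have h := Hd u u01 (ltW su).
    by rewrite -(subrK (Y s) (Y u)) addrC (le_trans (ler_normD _ _)) // lerD2l.
  move=> B [_ HB]; exists (B + 1) => s s01.
  by apply: (HB (B + 1)) => //=; rewrite ?ltrDl // in_itv.
have cL : compact L.
  apply: (subclosed_compact _ (@compact_ball R n (B + 3 * rho))).
    apply: (@closed_comp _ _ D [set d | d <= 2 * rho]); last exact: closed_le.
    by move=> z _; exact: dist_orbit_continuous.
  move=> z Lz /=; have [|s s01 zs] := @dist_orbit_lt n Y z (3 * rho).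
    by rewrite /L /= -/D in Lz *; lra.
  rewrite -(subrK (Y s) z) (le_trans (ler_normD _ _)) //.
  have := HB s s01; lra.
have [C C0 [N1 HC]] := uniform_bound cL (fun z Lz => ex_intro _ _ (FG z (LOm z Lz))).
pose th z := cutoff rho (D z).
pose F' N z := th z *: F N z.
pose G' z := th z *: G z.
have thc : continuous th.
  move=> z; apply: (@continuous_comp _ _ _ D (cutoff rho)).
    exact: dist_orbit_continuous.
  exact: cutoff_continuous.
have FG' : ccvgon setT F' G'.
  (* From distance [3 * rho] on, where [F] may fail to converge, the cut-off vanishes in a whole
     neighbourhood. *)
  move=> z _; have [zO|zO] := leP (3 * rho) (D z).
    rewrite /G' /th cutoff0 //; last lra.
    rewrite scale0r; apply: ccvg_ext (@ccvg_seq _ _ _ (fun _ => 0) z 0 (@cvg_cst _ _ _ \oo _)).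
    have : evnear z (fun _ w => `|D z - D w| <= rho).
      apply: evnear_snd; have /(@cvgrPdist_le _ _ _ (nbhs z)) := @dist_orbit_continuous n Y z.
      exact.
    apply: filterS => -[N w] /= h; rewrite /F' /th cutoff0 ?scale0r //.
    by move: h; rewrite ler_norml => /andP[]; lra.
  apply: ccvgZ; last by apply: FG; exact: DOm.
  by apply: ccvg_cst; exact: thc.
have F'C N z : (N1 <= N)%N -> `|F' N z| <= C.
  move=> HN; rewrite /F' normrZ ger0_norm ?cutoff_ge0 //.
  have [zO|zO] := leP (D z) (2 * rho).
    rewrite -[C]mul1r; apply: ler_pM => //; [exact: cutoff_ge0|exact: cutoff_le1|].
    exact: HC.
  by rewrite /th cutoff0 ?mul0r ?(ltW C0) // ltW.
(* The cut-off speed is at most [C], so no iterate moves farther than [C] in unit time. *)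
have conf' : confined F' [set z | `|z| <= `|x| + 1 + C] x.
  have H1 : evnear x (fun N _ => (0 < N)%N /\ (N1 <= N)%N).
    apply: (@evnear_fst _ _ x (fun N => (0 < N)%N /\ (N1 <= N)%N)).
    by exists (maxn 1 N1) => // N /=; rewrite geq_max => /andP[].
  have H2 : evnear x (fun _ z => `|x - z| <= 1).
    by have := @ccvg_id _ _ x => /cvgrPdist_le /(_ 1 ltr01).
  apply: filterS2 H1 H2 => -[N x'] /= [N0 N1N] xx' j jN.
  have := @euler_increment R n F' N x' 0 C 0 j (leq0n _).
  rewrite scaler0 !subr0 /= => h.
  have {}h : `|iter j (euler F' N) x' - x'| <= C.
    apply: (le_trans (h _)) => [k _|]; first by rewrite subr0; exact: F'C.
    rewrite ler_piMr ?(ltW C0) // ler_pdivrMr ?ltr0n // mul1r ler_nat //.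
  rewrite -(subrK x' (iter _ _ _)) (le_trans (ler_normD _ _)) //.
  rewrite addrC lerD // -(subrK x x') addrC (le_trans (ler_normD _ _)) //.
  by rewrite lerD2l distrC.
have DY s : 0 <= s <= 1 -> D (Y s) <= 0.
  by move=> /(dist_orbit_le Y (Y s)); rewrite subrr normr0.
have uniq' : forall y, sol G' setT 1 y -> y 0 = x -> forall s, 0 <= s <= 1 -> y s = Y s.
  move=> y soly y0; apply: real_induction.
  - by rewrite y0.
  - move=> s /andP[s0 s1] Hs.
    have s01 : 0 <= s <= 1 by rewrite s0 ltW.
    have [d d0 Hd] := sol_continuous soly s01 rho0.
    exists d => // u /andP[su ud] u1; have u0 : 0 <= u by exact: le_trans su.
    have Dy v : 0 <= v <= u -> D (y v) <= rho.
      move=> /andP[v0 vu]; have [vs|sv] := leP v s.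
        rewrite Hs ?v0 // (le_trans (DY v _)) ?(ltW rho0) // v0.
        exact: le_trans u1.
      apply: (le_trans (dist_orbit_le Y _ s01)); rewrite -Hs ?s0 ?lexx //.
      apply: Hd; first by rewrite v0 (le_trans vu).
      rewrite ger0_norm; lra.
    apply: (uniqY u y) => //; rewrite ?u0 ?lexx //.
    move=> v /andP[v0 vu]; have Dv := Dy v ltac:(by rewrite v0).
    split; first by apply: DOm; lra.
    move=> e e0; have [_ /(_ e e0)[d' d'0 Hd']] := soly v ltac:(by rewrite v0 (le_trans vu)).
    exists d' => // w /andP[w0 wu] wv.
    have := Hd' w ltac:(by rewrite w0 (le_trans wu)) wv.
    by rewrite /G' /th cutoff1 // scale1r.
  - move=> s /andP[s0 s1] Hs; apply/eqP; rewrite -subr_eq0 -normr_eq0.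
    apply/eqP/le_anti; rewrite normr_ge0 andbT leNgt; apply/negP => gap.
    (* The curves agree just before [s], so by continuity their gap at [s] is at most two thirds of
       itself. *)
    pose e := `|y s - Y s| / 3; have e0 : 0 < e by rewrite divr_gt0.
    have s01 : 0 <= s <= 1 by rewrite ltW.
    have [d d0 Hd] := sol_continuous soly s01 e0.
    have [d' d'0 Hd'] := sol_continuous solY s01 e0.
    pose m := Num.min (s / 2) (Num.min d d').
    have m0 : 0 < m by rewrite !lt_min d0 d'0 divr_gt0.
    have m1 : m <= s / 2 by rewrite ge_min lexx.
    have m2 : m <= d by rewrite !ge_min lexx orbT.
    have m3 : m <= d' by rewrite !ge_min lexx !orbT.
    have u01 : 0 <= s - m <= 1 by apply/andP; split; lra.
    have us : `|s - m - s| = m by rewrite addrAC subrr sub0r normrN ger0_norm // ltW.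
    have h1 := Hd _ u01 ltac:(by rewrite us).
    have h2 := Hd' _ u01 ltac:(by rewrite us).
    rewrite (Hs (s - m)) in h1; last by apply/andP; split; lra.
    have : `|y s - Y s| <= `|Y (s - m) - Y s| + `|Y (s - m) - y s|.
      have -> : y s - Y s = (Y (s - m) - Y s) - (Y (s - m) - y s).
        by apply/colP => k; rewrite !mxE; ring.
      exact: ler_normB.
    rewrite /e in h1 h2; lra.
have [Y' [solY' Y'0 _ HY']] := euler_cvg FG' (L := [set z | `|z| <= `|x| + 1 + C])
  (fun _ _ => I) (@compact_ball R n _) conf'
  (fun y1 y2 s1 s2 h1 h2 s s01 => etrans (uniq' y1 s1 h1 s s01) (esym (uniq' y2 s2 h2 s s01))).
exists L; split => //.
have H1 : evnear x (fun N _ => (0 < N)%N).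
  by apply: (@evnear_fst _ _ x (fun N => (0 < N)%N)); exists 1%N.
apply: filterS2 (HY' rho rho0) H1 => -[N x'] /= H N0 j jN.
have DE i : (i <= N)%N -> D (iter i (euler F' N) x') <= rho.
  move=> iN; have i01 : 0 <= (i%:R / N%:R : R) <= 1.
    by rewrite divr_ge0 //= ler_pdivrMr ?ltr0n // mul1r ler_nat.
  apply: (le_trans (dist_orbit_le Y _ i01)).
  by rewrite -(uniq' Y' solY' Y'0 _ i01); exact: H.
have EE i : (i <= N)%N -> iter i (euler F N) x' = iter i (euler F' N) x'.
  elim: i => // i IHi iN; rewrite !iterS IHi ?(ltnW iN) // /euler /F' /th.
  by rewrite cutoff1 ?scale1r // DE // ltnW.
rewrite /L /= EE //; have := DE j jN; lra.
Qed.

End Confinement.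

(** * Iterated differences *)

Section OneVariable.
Variable R : realType.
Implicit Types f g h H P : R -> R.

Definition shift_diff f : R -> R := fun x => f (x + 1) - f x.

Lemma mvt_real f (df : R -> R) (a b : R) : (forall x : R, is_derive x 1 f (df x)) -> a < b ->
  exists2 c, a < c < b & f b - f a = df c * (b - a).
Proof.
move=> Hf ab; have [|c +] := @MVT R f df a b ab (fun x _ => Hf x).
  apply: continuous_subspaceT => x; apply: differentiable_continuous.
  by apply/derivable1_diffP; have [] := Hf x.
by rewrite in_itv /= => cab E; exists c.
Qed.

Lemma is_derive_continuous f (df : R -> R) : (forall x : R, is_derive x 1 f (df x)) -> continuous f.
Proof.
move=> Hf x; apply: differentiable_continuous; apply/derivable1_diffP.
by have [] := Hf x.
Qed.

Lemma is_derive_shift1 f df (c x : R) : is_derive (x + c) 1 f df ->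
  is_derive x 1 (fun y => f (y + c)) df.
Proof.
move=> [d <-].
have E : (fun h : R => h^-1 *: (((fun y : R => f (y + c)) \o shift x) (h *: 1)
    - f (x + c))) =
  (fun h : R => h^-1 *: ((f \o shift (x + c)) (h *: 1) - f (x + c))).
  by apply/funext => h /=; rewrite addrA.
by split; rewrite /derivable /derive E.
Qed.

(* Integrals from [-n] give antiderivatives on [(-n, +oo)]; normalized to vanish
   at 0 they agree with each other, and are glued. *)
Lemma antiderivative g : continuous g -> exists H, forall x : R, is_derive x 1 H (g x).
Proof.
move=> cg.
pose F0 (n : nat) (x : R) := (\int[lebesgue_measure]_(t in [set` `[- n.+1%:R, x]]) (g t))%R.
have D0 n (x : R) : - n.+1%:R < x -> is_derive x 1 (F0 n) (g x).
  move=> nx; have [||d e] := @continuous_FTC1_closed R g (- n.+1%:R) x (x + 1) _ _ nx (cg x).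
  - by rewrite ltrDl.
  - apply: continuous_compact_integrable; first exact: segment_compact.
    exact: continuous_subspaceT.
  - by split; [exact: d|rewrite -derive1E; exact: e].
pose F n x := F0 n x - F0 n 0.
have D n (x : R) : - n.+1%:R < x -> is_derive x 1 (F n) (g x).
  move=> nx; have := D0 n x nx => h.
  have hc := @is_derive_cst _ _ _ (F0 n 0) x 1.
  by rewrite -[g x]subr0; exact: is_deriveB.
have agree n m (x : R) : - n.+1%:R < x -> - m.+1%:R < x -> F n x = F m x.
  move=> nx mx; apply/eqP; rewrite -subr_eq0; apply/eqP.
  pose E y := F n y - F m y.
  have E0 : E 0 = 0 by rewrite /E /F !subrr.
  have nm0 : - n.+1%:R < 0 :> R /\ - m.+1%:R < 0 :> R by rewrite !oppr_lt0 !ltr0n.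
  have DE (y : R) : - n.+1%:R < y -> - m.+1%:R < y -> is_derive y 1 E 0.
    move=> ny my; have h1 := D n y ny; have h2 := D m y my.
    by rewrite -(subrr (g y)); exact: is_deriveB.
  have cE (y : R) : - n.+1%:R < y -> - m.+1%:R < y -> {for y, continuous E}.
    move=> ny my; apply: differentiable_continuous; apply/derivable1_diffP.
    by have [] := DE y ny my.
  rewrite -/(E x) -E0; case: nm0 => n0 m0.
  have [x0|x0|->//] := ltrgt0P x.
    have [||c _ Ec] := @MVT R E (fun _ => 0) 0 x x0.
    - move=> y; rewrite in_itv /= => /andP[y0 _]; apply: DE; exact: lt_trans y0.
    - apply: continuous_in_subspaceT => y; rewrite inE /= in_itv /= => /andP[y0 _].
      apply: cE; exact: lt_le_trans y0.
    - by apply/eqP; rewrite -subr_eq0 Ec mul0r.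
  have [||c _ Ec] := @MVT R E (fun _ => 0) x 0 x0.
  - move=> y; rewrite in_itv /= => /andP[y0 _]; apply: DE; exact: lt_trans y0.
  - apply: continuous_in_subspaceT => y; rewrite inE /= in_itv /= => /andP[y0 _].
    apply: cE; exact: lt_le_trans y0.
  - by apply/eqP; rewrite eq_sym -subr_eq0 Ec mul0r.
pose N (x : R) := Num.truncn `|x|.
have NP x : - (N x).+1%:R < x.
  have /truncn_itv/andP[_ h] := normr_ge0 x.
  by rewrite ltrNl (le_lt_trans _ h) // -normrN ler_norm.
exists (fun x => F (N x) x) => x.
apply: (@near_eq_is_derive _ _ _ (F (N x))); last exact: D.
have : \forall y \near x, - (N x).+1%:R < y.
  exact: (open_nbhs_nbhs (conj (@open_gt R _) (NP x))).
apply: filterS => y hy; exact: agree.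
Qed.

(** An antiderivative of [|g|] is nondecreasing, and its total increase is bounded by the
    integral. *)
Lemma bounded_antiderivative g : continuous g ->
  (\int[lebesgue_measure]_(x in [set: R]) (`|g x|)%:E < +oo)%E ->
  exists H (B : R), forall x : R, is_derive x 1 H `|g x| /\ `|H x| <= B.
Proof.
move=> cg gfin.
have cabs : continuous (fun x => `|g x|).
  by move=> x; apply: (continuous_comp (cg x)); exact: norm_continuous.
have [H DH] := antiderivative cabs.
have cH := is_derive_continuous DH.
pose I := (\int[lebesgue_measure]_(x in [set: R]) (`|g x|)%:E)%E.
have I0 : (0 <= I)%E by apply: integral_ge0 => x _; rewrite lee_fin.
have If : I \is a fin_num by rewrite ge0_fin_numE.
have key a b : a < b -> H b - H a <= fine I.
  move=> ab; rewrite -lee_fin fineK // EFinB.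
  rewrite -(@continuous_FTC2 R (fun x => `|g x|) H a b ab).
  - apply: ge0_subset_integral => //.
    apply/measurable_EFinP; exact: continuous_measurable_fun.
  - exact: continuous_subspaceT.
  - split.
    + by move=> x _; have [] := DH x.
    + by apply: cvg_at_right_filter; exact: cH.
    + by apply: cvg_at_left_filter; exact: cH.
  - by move=> x _; rewrite derive1E; have [_ ->] := DH x.
exists H, (`|H 0| + fine I) => x; split; first exact: DH.
have mono a b : a < b -> H a <= H b.
  move=> ab; have [c _ E] := mvt_real DH ab.
  by rewrite -subr_ge0 E mulr_ge0 // subr_ge0 ltW.
rewrite -(subrK (H 0) (H x)) addrC (le_trans (ler_normD _ _)) // lerD2l.
have [x0|x0|->] := ltrgt0P x.
- by rewrite ger0_norm ?subr_ge0 ?mono // key.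
- by rewrite distrC ger0_norm ?subr_ge0 ?mono // key.
- by rewrite subrr normr0 fine_ge0.
Qed.

(** Domination by some [h] with a bounded antiderivative passes to [shift_diff g], with [h] and [H]
    replaced by sums of translates. By induction [shift_diff g] vanishes, so [g] has period 1, and a
    nonzero periodic [g] makes [H] grow without bound. *)
Lemma shift_diff_iter_eq0 m g h H B : continuous g ->
  (forall x : R, [/\ is_derive x 1 H (h x), `|g x| <= h x & `|H x| <= B]) ->
  (forall x, iter m shift_diff g x = 0) -> forall x, g x = 0.
Proof.
elim: m g h H B => // m IH g h H B cg Hh gm.
have per : forall x, shift_diff g x = 0.
  apply: (IH _ (fun x => h (x + 1) + h x) (fun x => H (x + 1) + H x) (B + B)).
  - move=> x; apply: (@cvgB _ _ _ (nbhs x)); last exact: cg.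
    apply: (continuous_comp (f := fun y : R => y + 1) (g := g)); last exact: cg.
    by apply: (@cvgD _ _ _ (nbhs x)); [exact: cvg_id|exact: cvg_cst].
  - move=> x; have [d1 l1 b1] := Hh (x + 1); have [d0 l0 b0] := Hh x; split.
    + have d1' := is_derive_shift1 d1.
      exact: is_deriveD.
    + by rewrite (le_trans (ler_normB _ _)) // lerD.
    + by rewrite (le_trans (ler_normD _ _)) // lerD.
  - by move=> x; rewrite -iterSr.
have perk k x : g (x + k%:R) = g x.
  elim: k => [|k IHk]; first by rewrite addr0.
  rewrite -addn1 natrD addrA -IHk.
  by have /eqP := per (x + k%:R); rewrite subr_eq0 => /eqP.
have DH (x : R) : is_derive x 1 H (h x) by have [] := Hh x.
have h0 x : 0 <= h x by have [_ + _] := Hh x; apply: le_trans.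
have mono a b : a <= b -> H a <= H b.
  rewrite le_eqVlt => /orP[/eqP -> //|ab]; have [c _ E] := mvt_real DH ab.
  by rewrite -subr_ge0 E mulr_ge0 // subr_ge0 ltW.
move=> x; apply/eqP; rewrite -normr_eq0; apply/eqP/le_anti.
rewrite normr_ge0 andbT leNgt; apply/negP => gx.
pose c := `|g x| / 2; have c0 : 0 < c by rewrite divr_gt0.
have : \forall y \near x, `|g x - g y| <= c.
  by move/cvgrPdist_le : (cg x); apply.
move=> /nbhs_ballP[r /= r0 Hr].
pose d := Num.min (r / 2) 1.
have d0 : 0 < d by rewrite lt_min divr_gt0 //=.
have d1 : d <= 1 by rewrite ge_min lexx orbT.
have dr : d < r by rewrite gt_min ltr_pdivrMr // ltr_pMr // ltr1n.
(* In every period [|g|] is at least [c] on an interval of length [d]. *)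
have step k : c * d <= H (x + k.+1%:R) - H (x + k%:R).
  have kd : x + k%:R < x + k%:R + d by rewrite ltrDl.
  have [y /andP[y0 y1] E] := mvt_real DH kd.
  have gy : c <= `|g y|.
    have -> : g y = g (y - k%:R) by rewrite -(perk k (y - k%:R)) subrK.
    have : `|g x - g (y - k%:R)| <= c.
      apply: Hr; rewrite /ball /= ltr_norml; apply/andP; split; lra.
    have := lerB_normD (g x) (- (g (y - k%:R))); rewrite normrN /c; lra.
  apply: (@le_trans _ _ (H (x + k%:R + d) - H (x + k%:R))).
    rewrite E addrAC subrr add0r ler_wpM2r ?(ltW d0) // (le_trans gy) //.
    by have [] := Hh y.
  rewrite lerD2r mono // -(addn1 k) natrD addrA lerD2l //.
have sum k : k%:R * (c * d) <= H (x + k%:R) - H x.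
  elim: k => [|k IHk]; first by rewrite mul0r addr0 subrr.
  by rewrite -{1}natr1 mulrDl mul1r; have := step k; lra.
have cd0 : 0 < c * d by rewrite mulr_gt0.
have B0 : 0 <= B by have [_ _] := Hh 0; apply: le_trans.
have /truncn_itv/andP[_ hk] : 0 <= (2 * B) / (c * d).
  by rewrite divr_ge0 ?mulr_ge0 // ltW.
have := sum (Num.truncn ((2 * B) / (c * d))).+1.
rewrite ltr_pdivrMr // in hk.
have [_ _ B1] := Hh x; have [_ _ B2] := Hh (x + (Num.truncn ((2 * B) / (c * d))).+1%:R).
move: B1 B2; rewrite !ler_norml => /andP[? ?] /andP[? ?]; lra.
Qed.

End OneVariable.

(** * Smooth functions of one variable, ridge functions and Riemann sums *)

Section Smooth1.
Variable R : realType.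
Implicit Types (f g phi P : R -> R).

Fixpoint C1d (k : nat) f : Prop :=
  match k with
  | 0 => continuous f
  | k'.+1 => (forall x : R, derivable f x 1) /\ C1d k' (derive1 f)
  end.

Lemma CrR_C1d r f : CrR r f -> C1d r f.
Proof.
elim: r f => [|r IH] f [H1 H2] //; split; first exact: (H1 0%N).
apply: IH; split => [k kr x|].
  have := H1 k.+1 kr x; by rewrite derive1Sn.
by move: H2; rewrite derive1Sn.
Qed.

Lemma derivable_is_derive f : (forall x : R, derivable f x 1) ->
  forall x : R, is_derive x 1 f (derive1 f x).
Proof. by move=> H x; split => //; rewrite derive1E. Qed.

Lemma C1d_cont k f : C1d k f -> continuous f.
Proof.
by case: k => [//|k] [/derivable_is_derive H _]; exact: is_derive_continuous H.
Qed.

Lemma C1d_pred k f : C1d k.+1 f -> C1d k f.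
Proof. by elim: k f => [|k IH] f [d H]; [exact: (@C1d_cont 1)|split => //; exact: IH]. Qed.

Lemma C1d_le k m f : (k <= m)%N -> C1d m f -> C1d k f.
Proof.
elim: m => [|m IH]; first by rewrite leqn0 => /eqP ->.
by rewrite leq_eqVlt => /orP[/eqP -> //|km /C1d_pred]; exact: IH.
Qed.

Lemma derive1_eq f df : (forall x : R, is_derive x 1 f (df x)) -> derive1 f = df.
Proof. by move=> H; apply/funext => x; rewrite derive1E; have [_ ->] := H x. Qed.

Lemma is_derive_shift_diff f df : (forall x : R, is_derive x 1 f (df x)) ->
  forall x : R, is_derive x 1 (shift_diff f) (shift_diff df x).
Proof.
move=> H x; have h1 := is_derive_shift1 (H (x + 1)); have h0 := H x.
exact: is_deriveB.
Qed.

Lemma C1d_shift_diff k f : C1d k f -> C1d k (shift_diff f).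
Proof.
elim: k f => [|k IH] f /=.
  move=> cf x; apply: (@cvgB _ _ _ (nbhs x)); last exact: cf.
  apply: (continuous_comp (f := fun y : R => y + 1) (g := f)); last exact: cf.
  by apply: (@cvgD _ _ _ (nbhs x)); [exact: cvg_id|exact: cvg_cst].
move=> [/derivable_is_derive d H]; have D := is_derive_shift_diff d.
by split; [move=> x; have [] := D x|rewrite (derive1_eq D); exact: IH].
Qed.

Lemma derive1_shift_diff k f : C1d k.+1 f -> derive1 (shift_diff f) = shift_diff (derive1 f).
Proof. by move=> [/derivable_is_derive d _]; apply: derive1_eq; exact: is_derive_shift_diff. Qed.

Lemma derive1n_shift_diff j k f : C1d (k + j) f ->
  derive1n j (shift_diff f) = shift_diff (derive1n j f).
Proof.
elim: j f => [//|j IH] f; rewrite addnS => Cf.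
rewrite !derive1Sn (derive1_shift_diff Cf) IH //.
by case: Cf.
Qed.

Lemma C1d_derive1n j k f : C1d (k + j) f -> C1d k (derive1n j f).
Proof.
elim: j f => [|j IH] f; first by rewrite addn0.
by rewrite addnS derive1Sn => -[_]; exact: IH.
Qed.

Lemma C1d_iter_shift_diff m k f : C1d k f -> C1d k (iter m (@shift_diff R) f).
Proof. by move=> Cf; elim: m => //= m; exact: C1d_shift_diff. Qed.

Lemma derive1n_iter_shift_diff j k m f : C1d (k + j) f ->
  derive1n j (iter m (@shift_diff R) f) = iter m (@shift_diff R) (derive1n j f).
Proof.
move=> Cf; elim: m => // m IH.
by rewrite !iterS (@derive1n_shift_diff j k) ?IH //; exact: C1d_iter_shift_diff.
Qed.

Lemma unif_cont f (a b e : R) : continuous f -> 0 < e ->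
  exists2 d, 0 < d & forall y h, a <= y <= b -> `|h| <= d -> `|f (y + h) - f y| <= e.
Proof.
move=> cf e0.
have /compact_near_coveringP/near_covering_withinP cI := @segment_compact R a b.
have := cI R (nbhs (0 : R)) (fun h y => `|f (y + h) - f y| <= e) _.
case.
  move=> y _; have e20 : 0 < e / 2 by rewrite divr_gt0.
  have : \forall z \near y, `|f y - f z| <= e / 2 by move/cvgrPdist_le : (cf y); apply.
  move=> /nbhs_ballP[r /= r0 Hr]; have r20 : 0 < r / 2 by rewrite divr_gt0.
  exists (ball y (r / 2), ball (0 : R) (r / 2)).
    by split => /=; exact: nbhsx_ballx.
  move=> [z h] /=; rewrite /ball /= sub0r normrN => -[yz hr] _.
  have h1 : `|f y - f z| <= e / 2 by apply: Hr; rewrite /ball /= (lt_trans yz) // ltr_pdivrMr // ltr_pMr // ltr1n.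
  have h2 : `|f y - f (z + h)| <= e / 2.
    apply: Hr; rewrite /ball /= opprD addrA.
    by apply: (le_lt_trans (ler_normB _ _)); lra.
  have -> : f (z + h) - f z = (f y - f z) - (f y - f (z + h)) by ring.
  by apply: (le_trans (ler_normB _ _)); lra.
move=> d /= d0 Hd; exists (d / 2); first by rewrite divr_gt0.
move=> y h yab hd; apply: (Hd h); last by rewrite /= in_itv.
by rewrite /= sub0r normrN (le_lt_trans hd) // ltr_pdivrMr // ltr_pMr // ltr1n.
Qed.

(** Moves functions of one real variable to ['cV_1], where the calculus of [Pc] and [Pc_comp]
    applies. *)
Definition lift1 f : 'cV[R]_1 -> R := fun x => f (x ord0 ord0).

Lemma differentiable_lift1 f (x : 'cV[R]_1) : derivable f (x ord0 ord0) 1 -> differentiable (lift1 f) x.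
Proof.
move=> /derivable1_diffP df.
apply: (@differentiable_comp _ _ _ _ (fun x : 'cV[R]_1 => x ord0 ord0) f) => //.
exact: differentiable_coord.
Qed.

Lemma pd_lift1 f i : (forall x : R, derivable f x 1) -> pd i (lift1 f) = lift1 (derive1 f).
Proof.
move=> df; apply/funext => x.
have E : (fun h : R => h^-1 *: ((lift1 f \o shift x) (h *: delta_mx i ord0) - lift1 f x)) =
   (fun h : R => h^-1 *: ((f \o shift (x ord0 ord0)) (h *: 1) - f (x ord0 ord0))).
  apply/funext => h /=; congr (_ *: (f _ - _)); rewrite !mxE (ord1 i) !eqxx.
  by rewrite mulr1 [h *: 1]mulr1.
by rewrite /pd /lift1 derive1E /derive E.
Qed.

Lemma Pc_lift1 k f : C1d k f -> Pc k setT (fun _ => lift1 f).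
Proof.
have cc g x : continuous g -> exists l, ccvg (fun _ => lift1 g) x l.
  move=> cg; exists (lift1 g x); apply: ccvg_cst.
  apply: (continuous_comp (f := fun x : 'cV[R]_1 => x ord0 ord0) (g := g)).
    exact: coord_continuous.
  exact: cg.
elim: k f => [|k IH] f Cf; first by move=> x _; exact: cc.
split; first by move=> x _; apply: cc; exact: C1d_cont Cf.
- by move=> x _; apply: nearW => p; apply: differentiable_lift1; case: Cf.
- by case: Cf => d Cf i; rewrite pd_lift1 //; exact: IH.
Qed.

Definition dot n (w z : 'cV[R]_n) : R := \sum_i w i ord0 * z i ord0.

Lemma ccvg_affine n (w : nat -> 'cV[R]_n) (b : nat -> R) (w0 : 'cV[R]_n) (b0 : R) x :
  w @ \oo --> w0 -> b @ \oo --> b0 ->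
  ccvg (fun N z => dot (w N) z + b N) x (dot w0 x + b0).
Proof.
move=> cw cb; apply: ccvgD; last exact: ccvg_seq.
apply: ccvg_sum => i; apply: ccvgM; last exact: (ccvg_coord (ccvg_id (x := x))).
apply: ccvg_seq; apply: (cvg_comp _ (fun v : 'cV[R]_n => v i ord0) cw).
exact: coord_continuous.
Qed.

Lemma Pc_affine n k (w : nat -> 'cV[R]_n) (b : nat -> R) (w0 : 'cV[R]_n) (b0 : R) A :
  w @ \oo --> w0 -> b @ \oo --> b0 -> Pc k A (fun N z => dot (w N) z + b N).
Proof.
move=> cw cb; apply: Pc_add; last exact: Pc_seq cb.
apply: Pc_sum => i; apply: Pc_mul; last exact: Pc_coord.
apply: (Pc_seq _ _ (c := fun N => w N i ord0) (l := w0 i ord0)).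
apply: (cvg_comp _ (fun v : 'cV[R]_n => v i ord0) cw); exact: coord_continuous.
Qed.

Lemma Pc_ridge_seq n k (phi : nat -> R -> R) (w : nat -> 'cV[R]_n) (b : nat -> R) (w0 : 'cV[R]_n) (b0 : R) :
  Pc k setT (fun N => lift1 (phi N)) ->
  w @ \oo --> w0 -> b @ \oo --> b0 ->
  Pc k setT (fun N z => phi N (dot (w N) z + b N)).
Proof.
move=> pphi cw cb.
pose F (N : nat) (z : 'cV[R]_n) : 'cV[R]_1 := \col_(_ < 1) (dot (w N) z + b N).
apply: (Pc_eq (f := fun N z => lift1 (phi N) (F N z))).
  by move=> N z; rewrite /lift1 /F mxE.
apply: (Pc_comp pphi) => // j.
apply: (Pc_eq (f := fun N z => dot (w N) z + b N)); first by move=> N z; rewrite mxE.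
exact: Pc_affine cw cb.
Qed.

Lemma Pc_ridge n k phi (w : nat -> 'cV[R]_n) (b : nat -> R) (w0 : 'cV[R]_n) (b0 : R) : C1d k phi ->
  w @ \oo --> w0 -> b @ \oo --> b0 ->
  Pc k setT (fun N z => phi (dot (w N) z + b N)).
Proof. by move=> /Pc_lift1 Cphi cw cb; exact: (Pc_ridge_seq Cphi cw cb). Qed.

(** A Riemann sum of [f] over [[x, x + 1]]: a finite combination of translates whose limit
    [P (x + 1) - P x], for [P' = f], has one derivative more than [f]. *)
Definition avg (M : nat) f : R -> R :=
  fun x => \sum_(j < M.+1) M.+1%:R^-1 * f (x + j%:R / M.+1%:R).

Lemma is_derive_avg M f df : (forall x : R, is_derive x 1 f (df x)) ->
  forall x : R, is_derive x 1 (avg M f) (avg M df x).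
Proof.
move=> H x.
have -> : avg M f = \sum_(j < M.+1) (fun x => M.+1%:R^-1 *: f (x + j%:R / M.+1%:R)).
  by apply/funext => y; rewrite fct_sumE.
apply: is_derive_sum => j.
have h := is_derive_shift1 (H (x + j%:R / M.+1%:R)).
exact: is_deriveZ.
Qed.

Lemma avg_ccvg f P x : continuous f -> (forall x : R, is_derive x 1 P (f x)) ->
  ccvg (fun M => lift1 (avg M f)) x (lift1 (shift_diff P) x).
Proof.
move=> cf DP.
have cP := is_derive_continuous DP.
have c0 : ccvg (fun _ => lift1 (shift_diff P)) x (lift1 (shift_diff P) x).
  apply: ccvg_cst.
  apply: (continuous_comp (f := fun x : 'cV[R]_1 => x ord0 ord0) (g := shift_diff P)).
    exact: coord_continuous.
  exact: (@C1d_shift_diff 0).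
rewrite -[lift1 _ x]addr0.
suff c1 : ccvg (fun M z => lift1 (avg M f) z - lift1 (shift_diff P) z) x 0.
  by apply: ccvg_ext (ccvgD c0 c1); apply: nearW => p /=; ring.
apply/cvgrPdist_le => e e0.
(* This interval contains [[y, y + 1]] for every [y] within distance 1 of [x]. *)
have [d d0 Hd] := unif_cont (x ord0 ord0 - 1) (x ord0 ord0 + 2) cf e0.
have [N0 N00 HN0] := invn_small d0.
suff : evnear x (fun M z => `|0 - (lift1 (avg M f) z - lift1 (shift_diff P) z)| <= e) by [].
apply/evnearP; exists N0, 1 => // M z N0M xz.
rewrite sub0r normrN /lift1.
have /ltr_normlP[z1 z2] : `|z ord0 ord0 - x ord0 ord0| < 1.
  by apply: le_lt_trans xz; have := coord_le_norm (z - x) ord0 ord0; rewrite !mxE.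
set y : R := z ord0 ord0 in z1 z2 *; set x0 : R := x ord0 ord0 in z1 z2 Hd *.
pose t (j : nat) : R := y + j%:R / M.+1%:R.
have M0 : M.+1%:R != 0 :> R by rewrite pnatr_eq0.
have tele : shift_diff P y = \sum_(j < M.+1) (P (t j.+1) - P (t j)).
  rewrite -(big_mkord xpredT (fun j => P (t j.+1) - P (t j))) telescope_sumr //.
  by rewrite /t divff // mul0r addr0.
rewrite tele /avg -sumrB (le_trans (ler_norm_sum _ _ _)) //.
apply: (@le_trans _ _ (\sum_(j < M.+1) M.+1%:R^-1 * e)); last first.
  by rewrite sumr_const card_ord -mulrnAl -mulr_natr mulVf // mul1r.
apply: ler_sum => j _.
have tS : t j.+1 - t j = M.+1%:R^-1.
  by rewrite /t -natr1; field; rewrite addrC natr1.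
have tj : t j < t j.+1 by rewrite -subr_gt0 tS invr_gt0 ltr0n.
have [c /andP[c1 c2] ->] := mvt_real DP tj.
rewrite tS [f c * _]mulrC -mulrBr normrM ger0_norm ?invr_ge0 // ler_wpM2l ?invr_ge0 //.
rewrite distrC (_ : f c = f (t j + (c - t j))); last by congr f; ring.
apply: Hd.
  have j1 : 0 <= (j%:R / M.+1%:R : R) <= 1.
    by rewrite divr_ge0 //= ler_pdivrMr ?ltr0n // mul1r ler_nat ltnW.
  rewrite /t; move: (_ / _) j1 => q /andP[q0 q1]; apply/andP; split; lra.
have : M.+1%:R^-1 <= d by apply: HN0; exact: leq_trans N0M _.
rewrite -tS => h.
by rewrite ger0_norm ?subr_ge0 ?(ltW c1) // (le_trans _ h) // lerD2r ltW.
Qed.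

Lemma Pc_avg k f P : C1d k f -> (forall x : R, is_derive x 1 P (f x)) ->
  Pc k setT (fun M => lift1 (avg M f)).
Proof.
elim: k f P => [|k IH] f P Cf DP.
  by move=> x _; exists (lift1 (shift_diff P) x); exact: avg_ccvg.
have cf := C1d_cont Cf; case: Cf => /derivable_is_derive df Cf.
have Da M := is_derive_avg M df; split.
- by move=> x _; exists (lift1 (shift_diff P) x); exact: avg_ccvg.
- by move=> x _; apply: nearW => p; apply: differentiable_lift1; have [] := Da p.1 (p.2 ord0 ord0).
- move=> i; have -> : (fun M => pd i (lift1 (avg M f))) = (fun M => lift1 (avg M (derive1 f))).
    apply/funext => M; rewrite pd_lift1; first by rewrite (derive1_eq (Da M)).
    by move=> x; have [] := Da M x.
  exact: IH Cf df.
Qed.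

End Smooth1.

(** * Approximation by networks *)

Section Nets.
Variables (R : realType) (n k : nat) (S : R -> R) (L B : set 'cV[R]_n).
Hypotheses (CS : C1d k S) (cL : compact L) (LB : L `<=` B) (oB : open B).

Definition smooth (g : 'cV[R]_n -> R) : Prop := Pc k setT (fun _ => g).

Definition net (s : seq (R * 'cV[R]_n * R)) (z : 'cV[R]_n) : R :=
  \sum_(p <- s) p.1.1 * S (dot p.1.2 z + p.2).

Definition net_approx (g : 'cV[R]_n -> R) : Prop := smooth g /\
  forall e, 0 < e -> exists s, forall l, (size l <= k)%N -> forall x, L x ->
    `|pdl l (net s) x - pdl l g x| <= e.

Lemma smooth_diff j (g : 'cV[R]_n -> R) x : Pc j.+1 setT (fun _ => g) -> differentiable g x.
Proof.
move=> [_ /(_ x I)/evnear_seq[N _ H] _].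
exact: (nbhs_singleton (H N (leqnn N))).
Qed.

Lemma pdl_add j l (f g : 'cV[R]_n -> R) : Pc j setT (fun _ => f) ->
  Pc j setT (fun _ => g) -> (size l <= j)%N ->
  pdl l (fun z => f z + g z) = (fun z => pdl l f z + pdl l g z).
Proof.
elim/last_ind: l j f g => [//|l i IH] [|j] f g; rewrite size_rcons // => pf pg lj.
rewrite !pdl_rcons.
have -> : pd i (fun z => f z + g z) = (fun z => pd i f z + pd i g z).
  by apply/funext => z; rewrite pdD //; exact: (smooth_diff (j := j)).
by apply: (IH j) => //; [have [_ _] := pf|have [_ _] := pg]; exact.
Qed.

Lemma pdl_scale j l c (f : 'cV[R]_n -> R) : Pc j setT (fun _ => f) ->
  (size l <= j)%N -> pdl l (fun z => c * f z) = (fun z => c * pdl l f z).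
Proof.
elim/last_ind: l j f => [//|l i IH] [|j] f; rewrite size_rcons // => pf lj.
rewrite !pdl_rcons.
have -> : pd i (fun z => c * f z) = (fun z => c * pd i f z).
  apply/funext => z; rewrite pdM ?pd_cst ?mulr0 ?addr0 //.
  exact: (smooth_diff (j := j) _ pf).
by apply: (IH j) => //; have [_ _] := pf; exact.
Qed.

Lemma smooth_ridge phi (w : 'cV[R]_n) b : C1d k phi ->
  smooth (fun z => phi (dot w z + b)).
Proof.
move=> Cphi; exact: (Pc_ridge Cphi (@cvg_cst _ w _ \oo _) (@cvg_cst _ b _ \oo _)).
Qed.

Lemma smooth_net s : smooth (net s).
Proof. by apply: Pc_sum => p; apply: Pc_scale; exact: smooth_ridge. Qed.

Lemma net_approx_add f g : net_approx f -> net_approx g ->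
  net_approx (fun z => f z + g z).
Proof.
move=> [sf Hf] [sg Hg]; split; first exact: Pc_add.
move=> e e0; have e20 : 0 < e / 2 by rewrite divr_gt0.
have [s1 H1] := Hf _ e20; have [s2 H2] := Hg _ e20.
exists (s1 ++ s2) => l lk x Lx.
have -> : net (s1 ++ s2) = (fun z => net s1 z + net s2 z).
  by apply/funext => z; rewrite /net big_cat.
rewrite !(@pdl_add k) //; try exact: smooth_net.
have := H1 l lk x Lx; have := H2 l lk x Lx.
have -> : pdl l (net s1) x + pdl l (net s2) x - (pdl l f x + pdl l g x) =
  (pdl l (net s1) x - pdl l f x) + (pdl l (net s2) x - pdl l g x) by ring.
have := ler_normD (pdl l (net s1) x - pdl l f x) (pdl l (net s2) x - pdl l g x).
lra.
Qed.

Lemma net_approx_scale c f : net_approx f -> net_approx (fun z => c * f z).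
Proof.
move=> [sf Hf]; split; first exact: Pc_scale.
move=> e e0; have c0 : 0 < `|c| + 1 by rewrite ltr_wpDl.
have [s Hs] := Hf (e / (`|c| + 1)) ltac:(by rewrite divr_gt0).
exists [seq (c * p.1.1, p.1.2, p.2) | p <- s] => l lk x Lx.
have -> : net [seq (c * p.1.1, p.1.2, p.2) | p <- s] = (fun z => c * net s z).
  apply/funext => z; rewrite /net big_map mulr_sumr; apply: eq_bigr => p _ /=.
  by rewrite mulrA.
rewrite !(@pdl_scale k) //; last exact: smooth_net.
rewrite -mulrBr normrM; have := Hs l lk x Lx.
rewrite ler_pdivlMr // mulrC; apply: le_trans.
by rewrite ler_wpM2r // lerDl.
Qed.

Lemma net_approx_eq f g : (forall z, f z = g z) -> net_approx f -> net_approx g.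
Proof. by move=> /funext ->. Qed.

Lemma net_approx_sum (J : Type) (s : seq J) (f : J -> 'cV[R]_n -> R) :
  (forall j, net_approx (f j)) -> net_approx (fun z => \sum_(j <- s) f j z).
Proof.
move=> Hf; elim: s => [|j s IH].
  apply: (@net_approx_eq (fun _ => 0)) => [z|]; first by rewrite big_nil.
  split; first exact: Pc_cst.
  move=> e e0; exists [::] => l lk x _.
  have -> : net [::] = (fun _ => 0) by apply/funext => z; rewrite /net big_nil.
  by rewrite subrr normr0 ltW.
apply: (@net_approx_eq (fun z => f j z + \sum_(j <- s) f j z)).
  by move=> z; rewrite big_cons.
exact: net_approx_add.
Qed.

(** Approximable functions are closed under limits of class [C^k]. Convergence is required on the
    open set [B] around [L], where derivatives of the limit make sense. *)
Lemma net_approx_lim (f : nat -> 'cV[R]_n -> R) g : smooth g -> Pc k B f ->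
  (forall x, B x -> ccvg f x (g x)) -> (forall M, net_approx (f M)) -> net_approx g.
Proof.
move=> sg pf fg Hf; split => // e e0.
have e20 : 0 < e / 2 by rewrite divr_gt0.
(* Sequences of length at most [k] form the finite type [k.-bseq], so a single index serves all
   derivatives. *)
have [N0 HN0] : exists N0 : nat, forall N x, (N0 <= N)%N -> L x ->
    forall l : k.-bseq 'I_n, `|pdl l g x - pdl l (f N) x| <= e / 2.
  apply: (compact_evnear cL (P := fun N x => forall l : k.-bseq 'I_n,
    `|pdl l g x - pdl l (f N) x| <= e / 2)).
  move=> x Lx; apply: (@filter_forall _ _ _ _ _) => l.
  have c1 := Pc_pdl_limit oB pf fg (size_bseq l) (LB Lx).
  have cg y : B y -> ccvg (fun _ => g) y (g y).
    by move=> By; apply: ccvg_cst; exact: (Pc_limit_continuous oB pf fg By).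
  have c2 := Pc_pdl_limit oB (Pc_limit oB pf fg) cg (size_bseq l) (LB Lx).
  have := ccvgB c2 c1; rewrite subrr => /cvgrPdist_le /(_ _ e20).
  by apply: filterS => p; rewrite sub0r normrN.
have [_ /(_ _ e20)[s Hs]] := Hf N0; exists s => l lk x Lx.
have h1 := Hs l lk x Lx; have h2 := HN0 N0 x (leqnn _) Lx (Bseq lk).
rewrite distrC in h2.
have -> : pdl l (net s) x - pdl l g x =
  (pdl l (net s) x - pdl l (f N0) x) + (pdl l (f N0) x - pdl l g x) by ring.
by apply: (le_trans (ler_normD _ _)); rewrite /= in h2; lra.
Qed.

Definition ridges_approx (phi : R -> R) : Prop :=
  forall w b, net_approx (fun z => phi (dot w z + b)).

Lemma ridges_approx_S : ridges_approx S.
Proof.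
move=> w b; split; first exact: smooth_ridge.
move=> e e0; exists [:: (1, w, b)] => l lk x Lx.
have -> : net [:: (1, w, b)] = (fun z => S (dot w z + b)).
  by apply/funext => z; rewrite /net big_seq1 mul1r.
by rewrite subrr normr0 ltW.
Qed.

Lemma ridges_approx_avg phi P : C1d k phi -> (forall x : R, is_derive x 1 P (phi x)) ->
  ridges_approx phi -> ridges_approx (shift_diff P).
Proof.
move=> Cphi DP Hphi w b.
have CP : C1d k P.
  apply: C1d_pred; split; first by move=> x; have [] := DP x.
  by rewrite (derive1_eq DP).
have cw : (fun _ : nat => w) @ \oo --> w by exact: cvg_cst.
have cb : (fun _ : nat => b) @ \oo --> b by exact: cvg_cst.
apply: (@net_approx_lim (fun M z => avg M phi (dot w z + b))).
- by apply: smooth_ridge; exact: C1d_shift_diff.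
- apply: (@Pc_sub _ _ _ setT) => //.
  exact: (Pc_ridge_seq (Pc_avg Cphi DP) cw cb).
- move=> x _; pose F (_ : nat) (z : 'cV[R]_n) : 'cV[R]_1 := \col_(_ < 1) (dot w z + b).
  have cF : ccvg F x (F 0 x).
    apply: ccvg_mx => j; rewrite mxE; apply: ccvg_ext (ccvg_affine (x := x) cw cb).
    by apply: nearW => p; rewrite mxE.
  have := ccvg_comp cF (avg_ccvg (x := F 0 x) (C1d_cont Cphi) DP).
  rewrite {2}/lift1 mxE; apply: ccvg_ext; apply: nearW => p.
  by rewrite /lift1 mxE.
- move=> M; rewrite /avg; apply: net_approx_sum => j; apply: net_approx_scale.
  by apply: net_approx_eq (Hphi w (b + j%:R / M.+1%:R)) => z; rewrite addrA.
Qed.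

Lemma dotDl (u v z : 'cV[R]_n) : dot (u + v) z = dot u z + dot v z.
Proof. by rewrite /dot -big_split; apply: eq_bigr => i _; rewrite !mxE mulrDl. Qed.

Lemma dot_scale_delta c i (z : 'cV[R]_n) : dot (c *: delta_mx i ord0) z = c * z i ord0.
Proof.
rewrite /dot (bigD1 i) //= big1 ?addr0; first by rewrite !mxE !eqxx mulr1.
by move=> j ji; rewrite !mxE (negbTE ji) mulr0 mul0r.
Qed.

(** The quotient is taken in the weight [w], in the direction [i]: its limit is [z_i] times the
    ridge function of [phi'], which is how a monomial factor is gained. *)
Definition dq (phi : R -> R) (w : 'cV[R]_n) (b : R) i (N : nat) (z : 'cV[R]_n) : R :=
  N.+1%:R * (phi (dot (w + N.+1%:R^-1 *: delta_mx i ord0) z + b) - phi (dot w z + b)).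

Lemma inv_succ_cvg0 : (fun N => N.+1%:R^-1 : R) @ \oo --> (0 : R).
Proof.
apply/cvgrPdist_le => e e0; have [N0 N00 HN] := invn_small e0.
exists N0 => // N /= N0N; rewrite sub0r normrN ger0_norm ?invr_ge0 // HN //.
exact: leq_trans N0N _.
Qed.

Lemma dq_dir_cvg (w : 'cV[R]_n) i :
  (fun N => w + N.+1%:R^-1 *: delta_mx i ord0) @ \oo --> w.
Proof.
rewrite -{2}[w]addr0 -(scale0r (delta_mx i ord0)).
apply: cvgD; first exact: cvg_cst.
by apply: cvgZ; [exact: inv_succ_cvg0|exact: cvg_cst].
Qed.

Lemma dq_ccvg phi w b i x : C1d 1 phi ->
  ccvg (dq phi w b i) x (x i ord0 * derive1 phi (dot w x + b)).
Proof.
move=> [/derivable_is_derive dphi cphi].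
have cc : ccvg (fun N z => dot w z + b) x (dot w x + b).
  exact: (ccvg_affine (@cvg_cst _ w _ \oo _) (@cvg_cst _ b _ \oo _)).
have cw : ccvg (fun N z => dot (w + N.+1%:R^-1 *: delta_mx i ord0) z + b) x (dot w x + b).
  by apply: ccvg_affine; [exact: dq_dir_cvg|exact: cvg_cst].
have ci : ccvg (fun _ (z : 'cV[R]_n) => z i ord0) x (x i ord0).
  exact: (ccvg_coord (ccvg_id (x := x))).
(* The intermediate point of the mean value theorem as a function of [N] and [z]. It converges
   continuously, being squeezed between two convergent arguments. *)
pose psi (N : nat) (z : 'cV[R]_n) := xget 0 [set c |
  `|c - (dot w z + b)| <= `|dot (w + N.+1%:R^-1 *: delta_mx i ord0) z + b - (dot w z + b)| /\
  dq phi w b i N z = z i ord0 * derive1 phi c].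
have Hpsi N z : [set c |
  `|c - (dot w z + b)| <= `|dot (w + N.+1%:R^-1 *: delta_mx i ord0) z + b - (dot w z + b)| /\
  dq phi w b i N z = z i ord0 * derive1 phi c] (psi N z).
  apply: xgetPex.
  have N0 : N.+1%:R != 0 :> R by rewrite pnatr_eq0.
  pose h := N.+1%:R^-1 * z i ord0.
  have E : dot (w + N.+1%:R^-1 *: delta_mx i ord0) z + b = h *: 1 + (dot w z + b).
    by rewrite dotDl dot_scale_delta [h *: 1]mulr1 addrAC addrC.
  have [|s hs Es] := @mvt_line R _ phi (dot w z + b) 1 h.
    by move=> s _; have [] := dphi (s *: 1 + (dot w z + b)).
  exists (s *: 1 + (dot w z + b)); rewrite /= /dq E; split.
    by rewrite !addrK ![_ *: 1]mulr1.
  by rewrite Es -derive1E /h mulrA mulrA mulfV // mul1r.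
have cpsi : ccvg psi x (dot w x + b).
  have c0 := ccvgB cw cc; rewrite subrr in c0.
  rewrite -[X in ccvg _ _ X]addr0 .
  have c1 : ccvg (fun N z => psi N z - (dot w z + b)) x 0.
    apply/cvgrPdist_le => e e0; move/cvgrPdist_le : c0 => /(_ e e0).
    apply: filterS => p; rewrite !sub0r !normrN; apply: le_trans.
    by have [] := Hpsi p.1 p.2.
  by apply: ccvg_ext (ccvgD cc c1); apply: nearW => p /=; ring.
have c2 : ccvg (fun N z => derive1 phi (psi N z)) x (derive1 phi (dot w x + b)).
  exact: (cvg_comp _ (derive1 phi) cpsi (cphi _)).
apply: ccvg_ext (ccvgM ci c2).
by apply: nearW => p; have [_ ->] := Hpsi p.1 p.2.
Qed.

Lemma dot_sum (u : 'cV[R]_n) : dot u = \sum_l (fun z : 'cV[R]_n => u l ord0 *: z l ord0).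
Proof. by apply/funext => y; rewrite fct_sumE. Qed.

Lemma differentiable_dot (u z : 'cV[R]_n) : differentiable (dot u) z.
Proof.
rewrite dot_sum; apply: differentiable_sum => l; apply: differentiableZ.
exact: differentiable_coord.
Qed.

Lemma pd_dot (u : 'cV[R]_n) i z : pd i (dot u) z = u i ord0.
Proof.
have dl (l : 'I_n) : differentiable (fun z : 'cV[R]_n => z l ord0 : R) z.
  exact: differentiable_coord.
have pc l : 'D_(delta_mx i ord0) (fun x : 'cV[R]_n => x l ord0 : R) z = (i == l)%:R.
  by rewrite -[LHS]/(pd i _ z) pd_coord.
rewrite dot_sum /pd derive_sum; last by move=> l; apply: derivableZ; exact: diff_derivable.
rewrite (bigD1 i) //= big1 ?addr0.
  rewrite deriveZ; last exact: diff_derivable.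
  by rewrite pc eqxx [_ *: _]mulr1.
move=> l li; rewrite deriveZ; last exact: diff_derivable.
by rewrite pc eq_sym (negbTE li) scaler0.
Qed.

Lemma pd_ridge phi (u : 'cV[R]_n) b i z : (forall x : R, derivable phi x 1) ->
  pd i (fun z => phi (dot u z + b)) z = u i ord0 * derive1 phi (dot u z + b).
Proof.
move=> dphi; pose F (z : 'cV[R]_n) : 'cV[R]_1 := \col_(_ < 1) (dot u z + b).
have Fj j' : (fun z => F z j' ord0) = (fun z => dot u z + b).
  by apply/funext => y; rewrite mxE.
have -> : (fun z => phi (dot u z + b)) = (fun z => lift1 phi (F z)).
  by apply/funext => y; rewrite /lift1 mxE.
rewrite pd_comp.
- rewrite big_ord1 Fj pd_lift1 // /lift1 mxE; congr (_ * _).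
  have dd := differentiable_dot u z.
  by rewrite pdD ?pd_cst ?addr0 ?pd_dot.
- move=> j'; rewrite Fj; apply: differentiableD; first exact: differentiable_dot.
  exact: differentiable_cst.
- by apply: differentiable_lift1.
Qed.

(** Differentiating [dq phi] in the coordinate [i'] gives [w_i'] times [dq] of [phi'], plus, if
    [i' = i], a ridge function of [phi'] at the shifted weight; hence the induction on [j]. *)
Lemma Pc_dq j phi w b i : C1d j.+1 phi -> Pc j setT (dq phi w b i).
Proof.
elim: j phi => [|j IH] phi Cphi.
  by move=> x _; eexists; exact: dq_ccvg.
have C1phi : C1d 1 phi by exact: C1d_le Cphi.
have pr N : Pc j.+2 setT (fun _ z => phi (dot (w + N.+1%:R^-1 *: delta_mx i ord0) z + b)).
  exact: (Pc_ridge Cphi (@cvg_cst _ _ _ \oo _) (@cvg_cst _ b _ \oo _)).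
have p0 : Pc j.+2 setT (fun _ (z : 'cV[R]_n) => phi (dot w z + b)).
  exact: (Pc_ridge Cphi (@cvg_cst _ _ _ \oo _) (@cvg_cst _ b _ \oo _)).
have dr N z := smooth_diff z (pr N); have d0 z := smooth_diff z p0.
have dphi x : derivable phi x 1 by case: Cphi.
have pdr u i' z := pd_ridge u b i' z dphi.
split.
- by move=> x _; eexists; exact: dq_ccvg.
- move=> x _; apply: nearW => -[N z] /=; rewrite /dq.
  apply: (@differentiableZ _ _ _ (fun z => phi (dot (w + N.+1%:R^-1 *: delta_mx i ord0) z + b) - phi (dot w z + b))).
  exact: differentiableB.
- move=> i'.
  have C' : C1d j.+1 (derive1 phi) by case: Cphi.
  apply: (Pc_eq (f := fun N z => w i' ord0 * dq (derive1 phi) w b i N z +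
     (i' == i)%:R * derive1 phi (dot (w + N.+1%:R^-1 *: delta_mx i ord0) z + b))).
    move=> N z; rewrite /dq.
    have -> : (fun z => N.+1%:R * (phi (dot (w + N.+1%:R^-1 *: delta_mx i ord0) z + b)
        - phi (dot w z + b))) =
      (fun z => N.+1%:R *: (phi (dot (w + N.+1%:R^-1 *: delta_mx i ord0) z + b)
        - phi (dot w z + b))) by [].
    have d1 := @diff_derivable _ _ _ _ _ (delta_mx i' ord0) (dr N z).
    have d2 := @diff_derivable _ _ _ _ _ (delta_mx i' ord0) (d0 z).
    have p1 := pdr (w + N.+1%:R^-1 *: delta_mx i ord0) i' z; have p2 := pdr w i' z.
    rewrite /pd in p1 p2.
    rewrite /pd (deriveZ _ (derivableB d1 d2)) (deriveB d1 d2) p1 p2 !mxE eqxx andbT [RHS]mulrBr.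
    have N0 : N.+1%:R != 0 :> R by rewrite pnatr_eq0.
    by field; rewrite addrC natr1.
  apply: Pc_add; first by apply: Pc_scale; exact: IH.
  apply: Pc_scale; apply: (Pc_ridge (C1d_pred C') (@dq_dir_cvg w i) (@cvg_cst _ b _ \oo _)).
Qed.

End Nets.

(** * Approximation of monomials *)

Section Monomials.
Variables (R : realType) (n k : nat) (S : R -> R) (L B : set 'cV[R]_n).
Hypotheses (CS : C1d k S) (cL : compact L) (LB : L `<=` B) (oB : open B).
Hypothesis nonpoly : forall m, exists b, iter m (@shift_diff R) S b != 0.

Definition mono (ls : seq 'I_n) (z : 'cV[R]_n) : R := \prod_(i <- ls) z i ord0.

Lemma smooth_mono j A ls : Pc j A (fun _ => mono ls).
Proof.
elim: ls => [|i ls IH].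
  apply: (Pc_eq (f := fun _ _ => 1)); last exact: Pc_cst.
  by move=> _ z; rewrite /mono big_nil.
apply: (Pc_eq (f := fun _ z => z i ord0 * mono ls z)).
  by move=> _ z; rewrite /mono big_cons.
by apply: Pc_mul => //; exact: Pc_coord.
Qed.

Lemma ccvg_mono ls x : ccvg (fun _ => mono ls) x (mono ls x).
Proof.
elim: ls => [|i ls IH].
  have -> : mono [::] = (fun _ => 1) by apply/funext => z; rewrite /mono big_nil.
  exact: cvg_cst.
rewrite {2}/mono big_cons.
apply: ccvg_ext (ccvgM (ccvg_coord (j := i) (ccvg_id (x := x))) IH).
by apply: nearW => p; rewrite /mono big_cons.
Qed.

(** The premise covers all weights because the difference quotient also involves weights near [w];
    the weight is set to 0 only after all derivatives have been taken. *)
Lemma approx_derive_step phi ls : C1d k.+1 phi ->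
  (forall w b, net_approx k S L (fun z => mono ls z * phi (dot w z + b))) ->
  forall i w b, net_approx k S L (fun z => mono (i :: ls) z * derive1 phi (dot w z + b)).
Proof.
move=> Cphi H i w b.
apply: (net_approx_eq (f := fun z => mono ls z * (z i ord0 * derive1 phi (dot w z + b)))).
  by move=> z; rewrite /mono big_cons; ring.
apply: (net_approx_lim cL LB oB (f := fun N z => mono ls z * (dq phi w b i N z))).
- apply: Pc_mul; first exact: smooth_mono.
  apply: Pc_mul; first exact: Pc_coord.
  by apply: smooth_ridge; case: Cphi.
- apply: Pc_mul; first exact: smooth_mono.
  by apply: (@Pc_sub _ _ _ setT) => //; exact: Pc_dq.
- move=> x _; apply: ccvgM; first exact: ccvg_mono.
  by apply: dq_ccvg; exact: C1d_le Cphi.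
- move=> N; apply: (net_approx_eq (f := fun z =>
    N.+1%:R * (mono ls z * phi (dot (w + N.+1%:R^-1 *: delta_mx i ord0) z + b)) +
    (- N.+1%:R) * (mono ls z * phi (dot w z + b)))).
    by move=> z; rewrite /dq; ring.
  by apply: net_approx_add => //; apply: net_approx_scale => //; exact: H.
Qed.

Lemma approx_mono_ridge ls phi : C1d (k + size ls) phi -> ridges_approx k S L phi ->
  forall w b, net_approx k S L (fun z => mono ls z * derive1n (size ls) phi (dot w z + b)).
Proof.
elim: ls phi => [|i ls IH] phi Cphi Hphi w b.
  apply: net_approx_eq (Hphi w b) => z.
  by rewrite /mono big_nil mul1r.
rewrite /= addnS in Cphi.
apply: approx_derive_step; first by apply: C1d_derive1n; rewrite addSn.
by apply: IH => //; exact: C1d_pred.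
Qed.

(* Each averaging step replaces [phi] by [P (x + 1) - P x] with [P' = phi]. *)
Lemma smoothed_ridge m : exists phi, [/\ C1d (k + m) phi, ridges_approx k S L phi &
  derive1n m phi = iter m (@shift_diff R) S].
Proof.
elim: m => [|m [phi [Cphi Hphi Dphi]]].
  by exists S; rewrite addn0; split => //; exact: ridges_approx_S.
have [P DP] := antiderivative (C1d_cont Cphi).
have DsP := is_derive_shift_diff DP.
exists (shift_diff P); split.
- rewrite addnS; split; first by move=> x; have [] := DsP x.
  by rewrite (derive1_eq DsP); exact: C1d_shift_diff.
- apply: (@ridges_approx_avg _ _ k S L B CS cL LB oB phi P) => //.
  by apply: C1d_le Cphi; rewrite leq_addr.
- rewrite derive1Sn (derive1_eq DsP) iterS -Dphi.
  exact: (@derive1n_shift_diff R m k).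
Qed.

Lemma approx_mono ls : net_approx k S L (mono ls).
Proof.
have [phi [Cphi Hphi Dphi]] := smoothed_ridge (size ls).
have [b Hb] := nonpoly (size ls).
(* At weight 0 the ridge factor is the constant [Delta^m S] at [b], nonzero by the choice of [b]. *)
have := approx_mono_ridge Cphi Hphi 0 b; rewrite Dphi => H.
apply: (net_approx_eq (f := fun z => (iter (size ls) (@shift_diff R) S b)^-1 *
  (mono ls z * iter (size ls) (@shift_diff R) S (dot 0 z + b)))).
  move=> z; have -> : dot 0 z = 0.
    by rewrite /dot big1 // => i _; rewrite mxE mul0r.
  by rewrite add0r mulrC -mulrA mulfV // mulr1.
exact: net_approx_scale.
Qed.

End Monomials.

(** * Bernstein polynomials in one coordinate *)

Section Bernstein.
Variables (R : realType) (n : nat) (i : 'I_n) (a : R).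
Hypothesis a0 : 0 < a.
Implicit Types (g : nat -> 'cV[R]_n -> R) (z : 'cV[R]_n).

Definition setc z (u : R) : 'cV[R]_n := \col_j (if j == i then u else z j ord0).

Definition bx z : R := (z i ord0 + a) / (2 * a).

(* The Bernstein operator in the coordinate [i], as the expectation of [G] over
   binomial trials with success probability [bx z], by conditioning on the first
   trial. *)
Fixpoint bern (m : nat) (G : nat -> 'cV[R]_n -> R) z : R :=
  match m with
  | 0 => G 0 z
  | m'.+1 => bx z * bern m' (fun j => G j.+1) z + (1 - bx z) * bern m' G z
  end.

Definition node (m j : nat) : R := - a + 2 * a * (j%:R / m.+1%:R).

(** [s] counts the derivatives already taken in the coordinate [i]: each of them removes one trial
    but leaves the grid of mesh [2 * a / m.+1] as it is. *)
Definition bernstein (s : nat) g (m : nat) z : R :=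
  bern (m.+1 - s) (fun j z => g m (setc z (node m j))) z.

Lemma bern_ext m G H z : (forall j, G j z = H j z) -> bern m G z = bern m H z.
Proof.
elim: m G H => [|m IH] G H GH; first exact: GH.
by rewrite /= (IH (fun j => G j.+1) (fun j => H j.+1)) // (IH G H).
Qed.

Lemma bernD m G H z : bern m (fun j z => G j z + H j z) z = bern m G z + bern m H z.
Proof. by elim: m G H => //= m IH G H; rewrite !IH; ring. Qed.

Lemma bernZ m c G z : bern m (fun j z => c * G j z) z = c * bern m G z.
Proof. by elim: m G => //= m IH G; rewrite !IH; ring. Qed.

Lemma bern_cst m c z : bern m (fun _ _ => c) z = c.
Proof. by elim: m => //= m IH; rewrite IH; ring. Qed.

Lemma bern_le m G H z : 0 <= bx z <= 1 -> (forall j, (j <= m)%N -> G j z <= H j z) ->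
  bern m G z <= bern m H z.
Proof.
move=> /andP[x0 x1]; elim: m G H => [|m IH] G H GH /=; first exact: GH.
apply: lerD; apply: ler_wpM2l => //; rewrite ?subr_ge0 //; apply: IH => j jm; apply: GH => //.
exact: leqW.
Qed.

Lemma bern_norm m G z : 0 <= bx z <= 1 ->
  `|bern m G z| <= bern m (fun j z => `|G j z|) z.
Proof.
move=> /andP[x0 x1]; elim: m G => //= m IH G.
apply: (le_trans (ler_normD _ _)); rewrite (normrM (bx z)) (normrM (1 - bx z)).
have y0 : 0 <= 1 - bx z by rewrite subr_ge0.
by rewrite (ger0_norm x0) (ger0_norm y0); apply: lerD; apply: ler_wpM2l.
Qed.

(** The second moment of a binomial variable about [c]: its variance plus the squared distance of
    its mean from [c]. *)
Lemma bern_variance m c z : bern m (fun j _ => (j%:R - c) ^+ 2) z =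
  m%:R * bx z * (1 - bx z) + (m%:R * bx z - c) ^+ 2.
Proof.
elim: m c => [|m IH] c /=; first by ring.
rewrite IH (@bern_ext _ _ (fun j _ => (j%:R - (c - 1)) ^+ 2)) ?IH.
  by rewrite -natr1; ring.
by move=> j; rewrite -natr1; congr (_ ^+ 2); ring.
Qed.

Lemma differentiable_bx z : differentiable bx z.
Proof.
apply: differentiableM; last exact: differentiable_cst.
by apply: differentiableD; [exact: differentiable_coord|exact: differentiable_cst].
Qed.

Lemma pd_bx l z : pd l bx z = (l == i)%:R / (2 * a).
Proof.
have dc : differentiable (fun z : 'cV[R]_n => z i ord0 : R) z.
  exact: differentiable_coord.
rewrite /bx pdM ?pd_cst ?mulr0 ?add0r; last first.
- exact: differentiable_cst.
- by apply: differentiableD => //; exact: differentiable_cst.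
rewrite pdD //.
by rewrite pd_cst addr0 pd_coord mulrC.
Qed.

Lemma differentiable_bern m G z : (forall j, (j <= m)%N -> differentiable (G j) z) ->
  differentiable (bern m G) z.
Proof.
elim: m G => [|m IH] G dG /=; first exact: dG.
apply: differentiableD; apply: differentiableM.
- exact: differentiable_bx.
- by apply: IH => j jm; exact: dG.
- by apply: differentiableB; [exact: differentiable_cst|exact: differentiable_bx].
- by apply: IH => j jm; apply: dG; exact: leqW.
Qed.

(** Besides the derivatives of the [G j], the weights contribute in the direction [i] only: the
    derivative in the success probability is [m] times the expectation of the forward difference
    over [m - 1] trials, and [bx] has slope [1 / (2 * a)]. For [m = 0] the factor [m%:R] removes the
    term with the predecessor. *)
Lemma pd_bern m G l z : (forall j, (j <= m)%N -> differentiable (G j) z) ->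
  pd l (bern m G) z = bern m (fun j => pd l (G j)) z +
    (l == i)%:R / (2 * a) * (m%:R * bern m.-1 (fun j z => G j.+1 z - G j z) z).
Proof.
elim: m G => [|m IH] G dG; first by rewrite /= mul0r mulr0 addr0.
have dG1 j : (j <= m)%N -> differentiable (G j.+1) z by move=> jm; exact: dG.
have dG0 j : (j <= m)%N -> differentiable (G j) z by move=> jm; apply: dG; exact: leqW.
have d1 := differentiable_bern dG1; have d0 := differentiable_bern dG0.
have dx := differentiable_bx z.
have dy : differentiable (fun z => 1 - bx z) z.
  by apply: differentiableB => //; exact: differentiable_cst.
have py : pd l (fun z => 1 - bx z) z = - pd l bx z.
  rewrite -[LHS]/(pd l (fun z => 1 + - bx z) z) pdD //; last exact: differentiableN.
    rewrite pd_cst add0r /pd deriveN //; exact: diff_derivable.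
have -> : bern m.+1 G =
    (fun z => bx z * bern m (fun j => G j.+1) z + (1 - bx z) * bern m G z) by [].
rewrite pdD; [|exact: differentiableM|exact: differentiableM].
rewrite (pdM _ dx d1) (pdM _ dy d0) py pd_bx (IH _ dG1) (IH _ dG0) [bern m.+1 _]/=.
have -> : bern m (fun j z => G j.+1 z - G j z) z =
    bern m (fun j => G j.+1) z - bern m G z.
  have := bernD m (fun j => G j.+1) (fun j z => -1 * G j z) z.
  rewrite bernZ mulN1r => <-; apply: bern_ext => j; by rewrite mulN1r.
case: m {IH dG dG1 dG0 d1 d0} => [|m].
  by rewrite /= !mul0r !mulr0 !addr0; ring.
rewrite [m.+1.-1]/=.
have D : bern m.+1 (fun j => G j.+1) z - bern m.+1 G z =
  bx z * bern m (fun j z => G j.+2 z - G j.+1 z) z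
    + (1 - bx z) * bern m (fun j z => G j.+1 z - G j z) z.
  have E H : bern m (fun j z => H j.+1 z - H j z) z = bern m (fun j => H j.+1) z - bern m H z.
    have := bernD m (fun j => H j.+1) (fun j z => -1 * H j z) z.
    by rewrite bernZ mulN1r => <-; apply: bern_ext => j; rewrite mulN1r.
  by rewrite (E (fun j => G j.+1)) (E G) /=; ring.
by rewrite D -(subrK (bern m.+1 G z) (bern m.+1 (fun j => G j.+1) z)) D -(natr1 m.+1); ring.
Qed.

Lemma setc_dist z z' u u' r : 0 < r -> `|z - z'| < r -> `|u - u'| < r ->
  `|setc z u - setc z' u'| < r.
Proof.
move=> r0 zz uu; pose q := Num.max `|z - z'| `|u - u'|.
apply: (@le_lt_trans _ _ q); last by rewrite gt_max zz.
apply: mx_norm_le => [|j l]; first by rewrite le_max normr_ge0.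
rewrite (ord1 l) !mxE; case: ifP => _; first by rewrite le_max lexx orbT.
by rewrite le_max; have := coord_le_norm (z - z') j ord0; rewrite !mxE => ->.
Qed.

(** The tube lemma for the compact interval of values of the replaced coordinate. *)
Lemma evnear_setc P z : (forall y, evnear y P) ->
  evnear z (fun m z' => forall u, - a <= u <= a -> P m (setc z' u)).
Proof.
move=> HP.
have /compact_near_coveringP/near_covering_withinP cI := @segment_compact R (- a) a.
have := cI _ (filter_prod \oo (nbhs z)) (fun p u => P p.1 (setc p.2 u)) _.
case.
  move=> u _; have /evnearP[N0 [r r0 Hr]] := HP (setc z u).
  exists (ball u r, [set p | (N0 <= p.1)%N /\ `|p.2 - z| < r]).
    split => /=; first exact: nbhsx_ballx.
    exists ([set N | (N0 <= N)%N], ball z r) => /=.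
      by split; [exists N0|exact: nbhsx_ballx].
    by move=> [N z'] /= [N0N]; rewrite -ball_normE /= distrC.
  move=> [u' [N z']] /= [uu' [N0N zz']] _; apply: Hr => //.
  by apply: setc_dist => //; move: uu'; rewrite /ball /= distrC.
move=> [A C] /= [HA HC] HAC; by exists (A, C).
Qed.

Lemma node_itv m j : (j <= m.+1)%N -> - a <= node m j <= a.
Proof.
move=> jm; have q01 : 0 <= (j%:R / m.+1%:R : R) <= 1.
  by rewrite divr_ge0 //= ler_pdivrMr ?ltr0n // mul1r ler_nat.
rewrite /node; move: (_ / _) q01 => q /andP[q0 q1].
have h0 : 0 <= 2 * a * q by rewrite !mulr_ge0 // ltW.
have h1 : 2 * a * q <= 2 * a * 1 by rewrite ler_wpM2l // mulr_ge0 // ltW.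
apply/andP; split; lra.
Qed.

(** Chebyshev's argument: nodes near [z_i] contribute little by continuous convergence of [g], and
    far nodes are rare by the second moment. *)
Lemma bernstein_ccvg s g gl z : (forall y, ccvg g y (gl y)) -> `|z i ord0| < a ->
  ccvg (bernstein s g) z (gl z).
Proof.
move=> cg zi; apply/cvgrPdist_le => e e0.
have e20 : 0 < e / 2 by rewrite divr_gt0.
have /evnearP[N0 [r r0 Hr]] : evnear z (fun N y => `|gl z - g N y| <= e / 2).
  by move/cvgrPdist_le : (cg z); apply.
have [C C0 [N1 HC]] := uniform_bound (@compact_ball R n (`|z| + 1 + a))
  (fun x _ => ex_intro _ _ (cg x)).
pose c := gl z.
pose C' := C + `|c|; have C'0 : 0 < C' by rewrite ltr_pwDl.
(* [C'] bounds the error at a far node, [4 / r ^+ 2] is the Chebyshev factor for distance [r / 2],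
   and the last factor divided by [m.+1] bounds the mean square distance of the nodes. *)
pose K := C' * (4 / r ^+ 2) * (4 * a ^+ 2 * (1 + s%:R ^+ 2)).
have K0 : 0 < K.
  have s0 : 0 < 1 + s%:R ^+ 2 :> R.
    by have : 0 <= s%:R ^+ 2 :> R by []; lra.
  rewrite /K; apply: mulr_gt0; first by rewrite mulr_gt0 // divr_gt0 // exprn_gt0.
  by rewrite mulr_gt0 // mulr_gt0 // exprn_gt0.
have [N2 N20 HN2] := invn_small (e := e / (2 * K)) ltac:(by rewrite divr_gt0 // mulr_gt0).
pose rr := Num.min (r / 2) (Num.min 1 (a - `|z i ord0|)).
have rr0 : 0 < rr by rewrite !lt_min divr_gt0 //= ltr01 subr_gt0.
suff : evnear z (fun m z' => `|gl z - bernstein s g m z'| <= e) by [].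
apply/evnearP; exists (maxn (maxn N0 N1) (maxn N2 s)), rr => // m z'.
rewrite !geq_max => /andP[/andP[mN0 mN1] /andP[mN2 ms]].
rewrite !lt_min => /andP[zr /andP[z1 za]].
have zi' : `|z' i ord0 - z i ord0| <= `|z' - z|.
  by have := coord_le_norm (z' - z) i ord0; rewrite !mxE.
have zi'a : `|z' i ord0| < a.
  have := ler_normD (z' i ord0 - z i ord0) (z i ord0); rewrite subrK; lra.
have a20 : 0 < 2 * a by rewrite mulr_gt0.
have x01 : 0 <= bx z' <= 1.
  move: zi'a; rewrite ltr_norml => /andP[h1 h2]; rewrite /bx.
  rewrite divr_ge0 ?(ltW a20) //=; last by lra.
  by rewrite ler_pdivrMr // mul1r; lra.
have m0 : m.+1%:R != 0 :> R by rewrite pnatr_eq0.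
have nodeE j : node m j - z' i ord0 = (2 * a / m.+1%:R) * (j%:R - m.+1%:R * bx z').
  by rewrite /node /bx; field; rewrite nat1r m0 gt_eqF.
rewrite distrC -/c.
have -> : bernstein s g m z' - c =
   bern (m.+1 - s) (fun j z => g m (setc z (node m j)) - c) z'.
  have := bernD (m.+1 - s) (fun j z => g m (setc z (node m j))) (fun _ _ => - c) z'.
  by rewrite bern_cst => ->.
apply: (le_trans (bern_norm _ _ x01)).
have cst0 : 0 <= C' * (4 / r ^+ 2) * (2 * a / m.+1%:R) ^+ 2.
  by rewrite mulr_ge0 ?sqr_ge0 // mulr_ge0 ?(ltW C'0) // divr_ge0 ?sqr_ge0.
pose Q j : R := e / 2 + (C' * (4 / r ^+ 2) * (2 * a / m.+1%:R) ^+ 2)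
    * (j%:R - m.+1%:R * bx z') ^+ 2.
apply: (le_trans (bern_le (H := fun j _ => Q j) x01 _)).
  move=> j jm; have jm1 : (j <= m.+1)%N by apply: leq_trans jm _; exact: leq_subr.
  have [near|far] := ltP `|node m j - z' i ord0| (r / 2).
    apply: (@le_trans _ _ (e / 2)).
      rewrite distrC; apply: Hr => //.
      have -> : setc z' (node m j) - z = setc z' (node m j) - setc z (z i ord0).
        congr (_ - _); apply/colP => l; rewrite mxE; by case: eqP => [->|].
      apply: setc_dist => //; first lra.
      have -> : node m j - z i ord0 = (node m j - z' i ord0) + (z' i ord0 - z i ord0) by ring.
      by apply: (le_lt_trans (ler_normD _ _)); lra.
    by rewrite /Q lerDl mulr_ge0 // sqr_ge0.
  apply: (@le_trans _ _ C').
    rewrite (le_trans (ler_normB _ _)) // lerD2r; apply: HC => //=.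
    apply: mx_norm_le => [|l q]; first by rewrite !addr_ge0 // ltW.
    rewrite (ord1 q) mxE; case: ifP => _.
      have := node_itv jm1; rewrite -ler_norml => h; apply: (le_trans h).
      by rewrite lerDr addr_ge0.
    have := coord_le_norm z' l ord0; have := ler_normD (z' - z) z; rewrite subrK; lra.
  rewrite /Q -[X in X <= _]add0r; apply: lerD; first exact: ltW.
  have -> : C' * (4 / r ^+ 2) * (2 * a / m.+1%:R) ^+ 2 * (j%:R - m.+1%:R * bx z') ^+ 2 =
    C' * ((4 / r ^+ 2) * (node m j - z' i ord0) ^+ 2).
    by rewrite nodeE exprMn; ring.
  rewrite ler_peMr ?(ltW C'0) // -[X in _ * X]real_normK ?num_real //.
  have far2 : (r / 2) ^+ 2 <= `|node m j - z' i ord0| ^+ 2.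
    by rewrite lerXn2r ?nnegrE // divr_ge0 // ltW.
  apply: (@le_trans _ _ (4 / r ^+ 2 * (r / 2) ^+ 2)).
    have -> : 4 / r ^+ 2 * (r / 2) ^+ 2 = 1 by field; rewrite gt_eqF.
    by [].
  by rewrite ler_wpM2l // divr_ge0 // exprn_ge0 // ltW.
rewrite /Q bernD bern_cst bernZ bern_variance.
rewrite [leRHS](splitr e) lerD2l.
have /andP[x0 x1] : 0 <= (bx z' : R) <= 1 by [].
move: (bx z') x0 x1 => x x0 x1.
have ms' : (s <= m.+1)%N by exact: leqW.
rewrite natrB //.
(* With [m.+1 - s] trials on a grid of [m.+1] cells the mean is off by [s * x], whence the summand
   [s ^+ 2]. *)
have var : (m.+1%:R - s%:R) * x * (1 - x) + ((m.+1%:R - s%:R) * x - m.+1%:R * x) ^+ 2 <=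
    m.+1%:R * (1 + s%:R ^+ 2).
  have -> : (m.+1%:R - s%:R) * x - m.+1%:R * x = - (s%:R * x) by ring.
  rewrite sqrrN exprMn [leRHS]mulrDr mulr1; apply: lerD.
    have h1 : (m.+1%:R - s%:R) * x * (1 - x) <= (m.+1%:R - s%:R) * x * 1.
      by rewrite ler_wpM2l ?mulr_ge0 ?subr_ge0 ?ler_nat // lerBlDr lerDl.
    have h2 : (m.+1%:R - s%:R) * x <= (m.+1%:R - s%:R) * 1.
      by rewrite ler_wpM2l ?subr_ge0 ?ler_nat.
    have h3 : 0 <= s%:R :> R by [].
    lra.
  apply: (@le_trans _ _ (s%:R ^+ 2)).
    by rewrite ler_piMr ?exprn_ge0 // exprn_ile1.
  by rewrite ler_peMl ?exprn_ge0 // ler1n.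
apply: (le_trans (ler_wpM2l cst0 var)).
have -> : C' * (4 / r ^+ 2) * (2 * a / m.+1%:R) ^+ 2 * (m.+1%:R * (1 + s%:R ^+ 2)) =
    K * m.+1%:R^-1.
  by rewrite /K; field; rewrite nat1r m0 gt_eqF.
have hm : m.+1%:R^-1 <= e / (2 * K) by apply: HN2; exact: leqW.
apply: (le_trans (ler_wpM2l (ltW K0) hm)).
have -> // : K * (e / (2 * K)) = e / 2 by field; rewrite gt_eqF.
Qed.

End Bernstein.

Lemma pd_shift (R : realType) n (g : 'cV[R]_n -> R) l v z :
  pd l (fun y => g (v + y)) z = pd l g (v + z).
Proof.
have E : (fun t : R => t^-1 *: (((fun y => g (v + y)) \o shift z) (t *: delta_mx l ord0)
    - g (v + z))) =
  (fun t => t^-1 *: ((g \o shift (v + z)) (t *: delta_mx l ord0) - g (v + z))).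
  by apply/funext => t /=; rewrite addrCA.
by rewrite /pd /derive E.
Qed.

(** * Derivatives of the Bernstein operator *)

Section BernsteinDerivatives.
Variables (R : realType) (n : nat) (i : 'I_n) (a : R).
Hypothesis a0 : 0 < a.
Implicit Types (g : nat -> 'cV[R]_n -> R) (z : 'cV[R]_n).

Let h (m : nat) : R := 2 * a / m.+1%:R.

(** The step is the spacing of the nodes, so that differences of consecutive node values are
    multiples of values of [fdiff g]. *)
Definition fdiff g (m : nat) z : R :=
  (h m)^-1 * (g m (h m *: delta_mx i ord0 + z) - g m z).

Lemma step_gt0 m : 0 < h m.
Proof. by rewrite divr_gt0 // mulr_gt0. Qed.

Lemma step_cvg0 : h @ \oo --> (0 : R).
Proof.
rewrite -(mulr0 (2 * a)).
by apply: cvgM; [exact: cvg_cst|exact: inv_succ_cvg0].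
Qed.

Lemma ccvg_step x : ccvg (fun m z => h m *: delta_mx i ord0 + z) x x.
Proof.
rewrite -[X in ccvg _ _ X]add0r -(scale0r (delta_mx i ord0)).
apply: ccvgD; last exact: ccvg_id.
by apply: ccvgZ; [exact: (ccvg_seq x step_cvg0)|apply: ccvg_seq; exact: cvg_cst].
Qed.

Lemma delta_norm_le1 (j : 'I_n) : `|delta_mx j ord0 : 'cV[R]_n| <= 1.
Proof. by apply: mx_norm_le => // k l; rewrite mxE; case: andb; rewrite ?normr1 ?normr0. Qed.

Lemma fdiff_ccvg g x q : evnear x (fun m z => differentiable (g m) z) ->
  ccvg (fun m => pd i (g m)) x q -> ccvg (fdiff g) x q.
Proof.
move=> dg cg; apply/cvgrPdist_le => e e0.
have near1 : evnear x (fun m z => `|q - pd i (g m) z| <= e).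
  by move/cvgrPdist_le : cg; apply.
have /evnearP[N0 [r r0 Hr]] := evnearI dg near1.
have r20 : 0 < r / 2 by rewrite divr_gt0.
have /cvgrPdist_lt/(_ _ r20)[N1 _ HN1] := step_cvg0.
suff : evnear x (fun m z => `|q - fdiff g m z| <= e) by [].
apply/evnearP; exists (maxn N0 N1), (r / 2) => // m z.
rewrite geq_max => /andP[mN0 mN1] zx.
have := HN1 m mN1; rewrite /= sub0r normrN (gtr0_norm (step_gt0 m)) => hr.
have seg (s : R) : `|s| <= `|h m| -> `|s *: delta_mx i ord0 + z - x| < r.
  rewrite (gtr0_norm (step_gt0 m)) => sh; rewrite -addrA.
  apply: (le_lt_trans (ler_normD _ _)); rewrite normrZ.
  have : `|s| * `|delta_mx i ord0 : 'cV[R]_n| <= `|s| * 1.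
    by rewrite ler_wpM2l // delta_norm_le1.
  by move=> hs; lra.
have [|s sh Es] := @mvt_line R _ (g m) z (delta_mx i ord0) (h m).
  by move=> s sh; apply: diff_derivable; have [] := Hr m _ mN0 (seg s sh).
have [_] := Hr m _ mN0 (seg s sh).
by rewrite /fdiff Es mulrA mulVf ?mul1r // gt_eqF // step_gt0.
Qed.

(** Difference quotients commute with [pd], and by the mean value theorem they converge like the
    derivative [pd i (g m)], at the price of one order. *)
Lemma Pc_fdiff k g : Pc k.+1 setT g -> Pc k setT (fdiff g).
Proof.
elim: k g => [|k IH] g pg; have [cg dg pdg] := pg.
  move=> x _; have [q Hq] := pdg i x I; exists q.
  by apply: fdiff_ccvg => //; exact: dg.
have dd x : evnear x (fun m z => differentiable (fun y => g m (h m *: delta_mx i ord0 + y)) z).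
  have := evnear_comp (@ccvg_step x) (dg x I); apply: filterS => p dp.
  apply: (@differentiable_comp _ _ _ _ (fun y => h p.1 *: delta_mx i ord0 + y) (g p.1)) => //.
split.
- move=> x _; have [cgi _ _] := pdg i; have [q Hq] := cgi x I; exists q.
  by apply: fdiff_ccvg => //; exact: dg.
- move=> x _; have := evnearI (dd x) (dg x I); apply: filterS => p [d1 d2].
  apply: (@differentiableZ _ _ _
    (fun y => g p.1 (h p.1 *: delta_mx i ord0 + y) - g p.1 y)).
  exact: differentiableB.
- move=> l; apply: Pc_ext (IH _ (pdg l)) => x _.
  have := evnearI (dd x) (dg x I); apply: filterS => p [d1 d2].
  have e1 := @diff_derivable _ _ _ _ _ (delta_mx l ord0) d1.
  have e2 := @diff_derivable _ _ _ _ _ (delta_mx l ord0) d2.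
  have E := deriveZ ((h p.1)^-1) (derivableB e1 e2); have E' := deriveB e1 e2.
  rewrite -!/(pd l _ _) pd_shift in E'.
  rewrite -/(pd l _ _) in E.
  by rewrite /fdiff -E'; exact: esym E.
Qed.

Lemma setc_step z m j : setc i z (node a m j.+1) = h m *: delta_mx i ord0 + setc i z (node a m j).
Proof.
apply/colP => l; rewrite !mxE eqxx andbT; case: eqP => _; last by rewrite mulr0 add0r.
by rewrite mulr1 /node -natr1 /h; ring.
Qed.

Lemma pd_setc (f : 'cV[R]_n -> R) l u z :
  pd l (fun y => f (setc i y u)) z = if l == i then 0 else pd l f (setc i z u).
Proof.
case: eqP => [->|/eqP li].
  have E t : setc i (t *: delta_mx i ord0 + z) u = setc i z u.
    apply/colP => j; rewrite !mxE eqxx andbT.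
    by case: eqP => // _; rewrite mulr0 add0r.
  have := congr1 (fun f => f z) (pd_cst i (f (setc i z u))).
  by rewrite /pd /derive /comp /=; under [in X in _ -> X]eq_fun do rewrite E.
have E t : setc i (t *: delta_mx l ord0 + z) u = t *: delta_mx l ord0 + setc i z u.
  apply/colP => j; rewrite !mxE eqxx andbT.
  by case: (j =P i) => // ->; rewrite eq_sym (negbTE li) mulr0 add0r.
by rewrite /pd /derive /comp /=; under eq_fun do rewrite E.
Qed.

Lemma differentiable_setc (f : 'cV[R]_n -> R) u z : differentiable f (setc i z u) ->
  differentiable (fun y => f (setc i y u)) z.
Proof.
move=> df; apply: (@differentiable_comp _ _ _ _ (fun y => setc i y u) f) => //.
apply: differentiable_cV => j.
have -> : (fun y => setc i y u j ord0) = if j == i then (fun _ => u) else (fun y : 'cV[R]_n => y j ord0).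
  by apply/funext => y; rewrite mxE; case: ifP.
by case: ifP => _; [exact: differentiable_cst|exact: differentiable_coord].
Qed.

Lemma evnear_nodes s g z : (forall x, evnear x (fun m y => differentiable (g m) y)) ->
  evnear z (fun m z' => forall j, (j <= m.+1 - s)%N ->
    differentiable (fun y => g m (setc i y (node a m j))) z').
Proof.
move=> dg; have := evnear_setc i a (P := fun m y => differentiable (g m) y) z dg.
apply: filterS => p H j jm; apply: differentiable_setc; apply: H.
by apply: node_itv => //; apply: (leq_trans jm); exact: leq_subr.
Qed.

(** A derivative in another coordinate falls on [g]. In the coordinate [i] it gives the operator
    with parameter [s.+1] on [fdiff g], times [(m.+1 - s) / m.+1], which tends to 1; the induction
    therefore needs every [s] and sequences [g]. *)
Lemma Pc_bernstein k s g : Pc k setT g ->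
  Pc k [set z | `|z i ord0| < a] (bernstein i a s g).
Proof.
elim: k s g => [|k IH] s g pg.
  have [gl Hgl] := choice (fun y => pg y I).
  by move=> x xa; exists (gl x); exact: bernstein_ccvg.
have [cg dg pdg] := pg.
split.
- have [gl Hgl] := choice (fun y => cg y I).
  by move=> x xa; exists (gl x); exact: bernstein_ccvg.
- move=> x xa; have := evnear_nodes s x (fun y => dg y I).
  by apply: filterS => p H; apply: differentiable_bern.
- move=> l; case: (eqVneq l i) => [->|li].
    have H := Pc_mul (Pc_seq k [set z | `|z i ord0| < a] (c := fun m => (m.+1 - s)%N%:R / m.+1%:R) (l := 1) _)
      (IH s.+1 _ (Pc_fdiff pg)).
    apply: Pc_ext (H _).
      move=> x xa; have := evnear_nodes s x (fun y => dg y I).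
      apply: filterS => -[m z] /= HH; rewrite /bernstein pd_bern // eqxx.
      have -> : bern i a (m.+1 - s) (fun j => pd i (fun y => g m (setc i y (node a m j)))) z = 0.
        rewrite (@bern_ext _ _ _ _ _ _ (fun _ _ => 0)) ?bern_cst // => j.
        by rewrite pd_setc eqxx.
      rewrite add0r subnS mulrA -!bernZ; apply: bern_ext => j.
      rewrite /fdiff setc_step /h mulr1n.
      by field; rewrite nat1r pnatr_eq0 /= gt_eqF.
    have E : {near \oo, (fun m => 1 - s%:R * m.+1%:R^-1) =1
        (fun m => (m.+1 - s)%N%:R / m.+1%:R : R)}.
      exists s => // m /= sm; rewrite natrB; last exact: leqW.
      by rewrite mulrBl mulfV // pnatr_eq0.
    have c1 : (fun m => 1 - s%:R * m.+1%:R^-1 : R) @ \oo --> (1 - s%:R * 0 : R).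
      apply: cvgB; first exact: cvg_cst.
      by apply: cvgM; [exact: cvg_cst|exact: inv_succ_cvg0].
    rewrite mulr0 subr0 in c1; exact: cvg_trans (near_eq_cvg E) c1.
  apply: Pc_ext (IH s _ (pdg l)) => x xa.
  have := evnear_nodes s x (fun y => dg y I).
  apply: filterS => -[m z] /= HH; rewrite /bernstein pd_bern // (negbTE li) !mul0r addr0.
  by apply: bern_ext => j; rewrite pd_setc (negbTE li).
Qed.

End BernsteinDerivatives.

Lemma Pc_cst_ccvg (R : realType) n (f : 'cV[R]_n -> R) y l :
  ccvg (fun _ => f) y l -> ccvg (fun _ => f) y (f y).
Proof.
move=> Hl; have c1 := ccvg_pt Hl.
have c2 : (fun _ : nat => f y) @ \oo --> f y by exact: cvg_cst.
by rewrite (cvg_unique _ c2 c1).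
Qed.

(** * Density of networks, by induction on the number of coordinates *)

Section Density.
Variables (R : realType) (n k : nat) (S : R -> R) (a : R).
Hypotheses (a0 : 0 < a) (CS : C1d k S).
Hypothesis nonpoly : forall m, exists b, iter m (@shift_diff R) S b != 0.
Variable L : set 'cV[R]_n.
Hypotheses (cL : compact L) (La : L `<=` [set z | `|z| < a]).

Let B := [set z : 'cV[R]_n | `|z| < a].

Lemma open_norm_ball : open B.
Proof.
have -> : B = ball (0 : 'cV[R]_n) a.
  by rewrite -ball_normE; apply/seteqP; split => z /=; rewrite sub0r normrN.
exact: ball_open.
Qed.

Definition dep (m : nat) (f : 'cV[R]_n -> R) : Prop :=
  forall z z' : 'cV[R]_n, (forall j : 'I_n, (j < m)%N -> z j ord0 = z' j ord0) -> f z = f z'.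

Lemma Pc_setc_cst (f : 'cV[R]_n -> R) i u : Pc k setT (fun _ => f) ->
  Pc k setT (fun _ z => f (setc i z u)).
Proof.
move=> pf; apply: (Pc_comp (F := fun _ z => setc i z u) pf) => // j.
apply: (Pc_eq (f := if j == i then (fun _ _ => u) else (fun _ (z : 'cV[R]_n) => z j ord0))).
  by move=> N z; rewrite mxE; case: ifP.
by case: ifP => _; [exact: Pc_cst|exact: Pc_coord].
Qed.

(** The weights [bx z] and [1 - bx z] are affine in [z_i], so each trial at most adds [i] to the
    monomial; this is why a monomial factor is carried along. *)
Lemma net_approx_bern i m (G : nat -> 'cV[R]_n -> R) ls :
  (forall j ls, net_approx k S L (fun z => mono ls z * G j z)) ->
  net_approx k S L (fun z => mono ls z * bern i a m G z).
Proof.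
elim: m G ls => [|m IH] G ls HG; first exact: HG.
have H1 := IH (fun j => G j.+1) _ (fun j ls => HG j.+1 ls); have H0 := IH G _ HG.
have a20 : 2 * a != 0 by rewrite mulf_neq0 // gt_eqF.
apply: (net_approx_eq (f := fun z =>
  ((2 * a)^-1 * (mono (i :: ls) z * bern i a m (fun j => G j.+1) z) +
   2^-1 * (mono ls z * bern i a m (fun j => G j.+1) z)) +
  ((- (2 * a)^-1) * (mono (i :: ls) z * bern i a m G z) +
   2^-1 * (mono ls z * bern i a m G z)))).
  move=> z; rewrite /= /bx /mono big_cons; field.
  by rewrite gt_eqF.
by apply: (net_approx_add CS); apply: (net_approx_add CS); apply: (net_approx_scale CS).
Qed.

(** The Bernstein operator freezes the last relevant coordinate at the nodes, which leaves
    coefficients in fewer coordinates; at [m = 0] the function is constant and a multiple of a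
    monomial remains. *)
Lemma smooth_net_approx_dep m : (m <= n)%N -> forall f ls, dep m f ->
  Pc k setT (fun _ => f) -> net_approx k S L (fun z => mono ls z * f z).
Proof.
elim: m => [|m IH] mn f ls df pf.
  apply: (net_approx_eq (f := fun z => f 0 * mono ls z)).
    by move=> z; rewrite mulrC (df z 0).
  by apply: (net_approx_scale CS); exact: (approx_mono CS cL La open_norm_ball nonpoly).
pose i := Ordinal mn.
have Bi : B `<=` [set z | `|z i ord0| < a].
  by move=> z /=; apply: le_lt_trans; exact: coord_le_norm.
apply: (net_approx_lim cL La open_norm_ball (f := fun M z => mono ls z * bernstein i a 0 (fun _ => f) M z)).
- by apply: Pc_mul => //; exact: smooth_mono.
- apply: Pc_mul; first exact: smooth_mono.
  by apply: (Pc_sub Bi); exact: Pc_bernstein.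
- move=> x Bx; apply: ccvgM; first exact: ccvg_mono.
  apply: bernstein_ccvg => //; last exact: Bi.
  move=> y; have [l Hl] := Pc_lim pf (I : setT y).
  exact: Pc_cst_ccvg Hl.
- move=> M; rewrite /bernstein; apply: net_approx_bern => j ls'.
  apply: IH; first exact: ltnW.
    move=> z z' zz'; apply: df => q; rewrite ltnS => qm; rewrite !mxE.
    by case: eqP => // qi; apply: zz'; rewrite ltn_neqAle qm andbT; apply/eqP => E; apply: qi; exact: val_inj.
  exact: Pc_setc_cst.
Qed.

Lemma smooth_net_approx f : Pc k setT (fun _ => f) -> net_approx k S L f.
Proof.
move=> pf; apply: (net_approx_eq (f := fun z => mono [::] z * f z)).
  by move=> z; rewrite /mono big_nil mul1r.
apply: (smooth_net_approx_dep (leqnn n)) => // z z' zz'; congr f.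
by apply/colP => j; exact: zz'.
Qed.

End Density.

(** If [Delta^m S] vanished, so would its derivative of order [r + 1], which is [Delta^m] of
    [sigma^(r)]. As [sigma^(r)] is integrable it would vanish itself, against the positivity of its
    integral. *)
Lemma rfinite_nonpolynomial (R : realType) r (sigma S : R -> R) : CrR r sigma -> rfinite r sigma ->
  (forall x : R, is_derive x 1 S (sigma x)) ->
  forall m, exists b, iter m (@shift_diff R) S b != 0.
Proof.
move=> Hsig [Hpos Hfin] DS m; apply: contrapT => H.
have S0 : iter m (@shift_diff R) S = (fun _ => 0).
  by apply/funext => b; apply/eqP; apply: contrapT => /negP nb; apply: H; exists b.
have CS : C1d r.+1 S.
  by split; [move=> x; have [] := DS x|rewrite (derive1_eq DS); exact: CrR_C1d].
have [_ cg] := Hsig.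
have [h [B Hh]] := bounded_antiderivative cg Hfin.
have g0 : forall x, derive1n r sigma x = 0.
  apply: (@shift_diff_iter_eq0 R m _ (fun x => `|derive1n r sigma x|) h B) => //.
    by move=> x; have [] := Hh x; split.
  move=> x; have := @derive1n_iter_shift_diff R r.+1 0 m S CS.
  rewrite S0 [derive1n r.+1 S]derive1Sn (derive1_eq DS) => <-.
  suff -> : derive1n r.+1 (fun _ : R => 0 : R) = (fun _ => 0) by [].
  elim: r.+1 => // j IH; rewrite derive1Sn -[RHS]IH; congr derive1n.
  by apply/funext => y; exact: derive1_cst.
move: Hpos; rewrite (eq_integral (fun _ => 0%E)) ?integral0 ?ltxx // => x _.
by rewrite g0 normr0.
Qed.

(** Iterated antiderivatives of [max(x, 0)], that is, multiples of the power [k + 1] of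
    [max(x, 0)]. *)
Lemma one_sided_bump (R : realType) k : exists q : R -> R,
  [/\ C1d k q, (forall x, x <= 0 -> q x = 0) & (forall x, 0 < x -> 0 < q x)].
Proof.
elim: k => [|k [q [Cq q0 q1]]].
  exists (fun x => Num.max x 0); split => [x|x x0|x x0].
  - by apply: (@continuous_max _ _ id (cst 0)); [exact: cvg_id|exact: cvg_cst].
  - by rewrite max_r.
  - by rewrite max_l // ltW.
have [P DP] := antiderivative (C1d_cont Cq).
have DQ (x : R) : is_derive x 1 (fun x => P x - P 0) (q x).
  by rewrite -[X in is_derive _ _ _ X]subr0; apply: is_deriveB.
exists (fun x => P x - P 0); split.
- by split; [move=> x; have [] := DQ x|rewrite (derive1_eq DQ)].
- move=> x; rewrite le_eqVlt => /orP[/eqP ->|x0]; first by rewrite subrr.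
  have [c /andP[_ c0] E] := mvt_real DP x0.
  by rewrite -opprB E q0 ?mul0r ?oppr0 // ltW.
- move=> x x0; have [c /andP[c0 _] E] := mvt_real DP x0.
  by rewrite E mulr_gt0 ?q1 // subr0.
Qed.

(** * Cut-off functions and extension to the whole space *)

Section Cutoff.
Variables (R : realType) (n k : nat).
Implicit Types (f g : 'cV[R]_n -> R) (Om L : set 'cV[R]_n).

Lemma Pc_local (A : set 'cV[R]_n) (f : nat -> 'cV[R]_n -> R) j :
  (forall x, A x -> exists2 U, U x & Pc j U f) -> Pc j A f.
Proof.
elim: j f => [|j IH] f H.
  by move=> x Ax; have [U Ux pU] := H x Ax; exact: pU.
split.
- by move=> x Ax; have [U Ux [c _ _]] := H x Ax; exact: c.
- by move=> x Ax; have [U Ux [_ d _]] := H x Ax; exact: d.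
- by move=> i; apply: IH => x Ax; have [U Ux [_ _ p]] := H x Ax; exists U => //; exact: p.
Qed.

Lemma Pc_lift1_comp phi g : C1d k phi -> Pc k setT (fun _ => g) ->
  Pc k setT (fun _ z => phi (g z)).
Proof.
move=> Cphi pg.
apply: (Pc_eq (f := fun _ z => lift1 phi (\col_(_ < 1) g z))).
  by move=> N z; rewrite /lift1 mxE.
apply: (Pc_comp (F := fun _ z => \col_(_ < 1) g z) (Pc_lift1 Cphi)) => // j.
by apply: (Pc_eq (f := fun _ => g)) => // N z; rewrite mxE.
Qed.

Lemma Pc_prod (I : Type) (s : seq I) (F : I -> 'cV[R]_n -> R) :
  (forall i, Pc k setT (fun _ => F i)) -> Pc k setT (fun _ z => \prod_(i <- s) F i z).
Proof.
move=> HF; elim: s => [|i s IH].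
  by apply: (Pc_eq (f := fun _ _ => 1)); [move=> N z; rewrite big_nil|exact: Pc_cst].
apply: (Pc_eq (f := fun _ z => F i z * \prod_(i <- s) F i z)).
  by move=> N z; rewrite big_cons.
exact: Pc_mul.
Qed.

Lemma Pc_continuous f : Pc k setT (fun _ => f) -> continuous f.
Proof.
move=> pf x; apply: (Pc_limit_continuous openT pf) => // y _.
by have [l Hl] := Pc_lim pf (I : setT y); exact: Pc_cst_ccvg Hl.
Qed.

(** A product over the coordinates of one-sided bumps in [(d / 2) ^+ 2 - (z_i - x_i) ^+ 2],
    supported in a cube. Half of the radius [d] is kept as a margin, so the product vanishes near
    every point outside [Om]; the factor [2 / b x] makes its value at [x] equal to 2. *)
Lemma point_bump Om x : open Om -> exists b, [/\ Pc k setT (fun _ => b),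
  forall z, 0 <= b z, Om x -> 1 < b x & forall y, ~ Om y -> \forall z \near y, b z = 0].
Proof.
(* The zero function serves at points outside [Om], so that [choice] can later be applied to all
   points. *)
move=> oOm; have [Omx|] := pselect (Om x); last first.
  move=> nx; exists (fun _ => 0); split => //; first exact: Pc_cst.
  by move=> y _; exact: filterE.
have /nbhs_ballP[d d0 Hd] := open_nbhs_nbhs (conj oOm Omx).
rewrite -ball_normE /= in Hd.
have [q [Cq q0 q1]] := one_sided_bump R k.
pose u (i : 'I_n) (z : 'cV[R]_n) := (d / 2) ^+ 2 - (z i ord0 - x i ord0) ^+ 2.
have d20 : 0 < d / 2 by rewrite divr_gt0.
pose b z := \prod_(i <- enum 'I_n) q (u i z).
have pu i : Pc k setT (fun _ => u i).
  have pz : Pc k setT (fun _ z => z i ord0 - x i ord0 : R).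
    by apply: Pc_add; [exact: Pc_coord|exact: Pc_cst].
  apply: Pc_add; first exact: Pc_cst.
  by apply: Pc_opp; apply: (Pc_eq (f := fun _ z => (z i ord0 - x i ord0) * (z i ord0 - x i ord0)));
    [move=> N z; rewrite expr2|exact: Pc_mul].
have q_ge0 t : 0 <= q t by have [/q0 ->//|/q1/ltW] := leP t 0.
have bx0 : 0 < b x.
  by apply: prodr_gt0 => i _; apply: q1; rewrite /u subrr expr0n subr0 exprn_gt0.
exists (fun z => 2 / b x * b z); split.
- by apply: Pc_scale; apply: Pc_prod => i; exact: Pc_lift1_comp.
- by move=> z; rewrite mulr_ge0 ?divr_ge0 ?(ltW bx0) // prodr_ge0.
- by move=> _; rewrite -mulrA mulVf ?mulr1 ?ltr1n // gt_eqF.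
- move=> y nOy; have yx : d <= `|y - x|.
    by rewrite leNgt; apply/negP => yx; apply: nOy; apply: Hd; rewrite /= distrC.
  apply/nbhs_ballP; exists (d / 2) => //= z; rewrite -ball_normE /= => yz.
  have zx : d / 2 <= `|z - x|.
    have := ler_normD (y - z) (z - x); rewrite addrA subrK; lra.
  suff [i /q0 qi] : exists i, u i z <= 0.
    have -> : b z = 0 by rewrite /b (bigD1_seq i) ?mem_enum ?enum_uniq //= qi mul0r.
    exact: mulr0.
  apply: contrapT => H.
  have : `|z - x| < d / 2.
    rewrite /Num.norm /= mx_normrE; apply: bigmax_lt => // -[i j] _ /=.
    rewrite (ord1 j) !mxE -(ltr_pXn2r (n := 2)) ?nnegrE ?(ltW d20) //.
    rewrite real_normK ?num_real // ltNge; apply/negP => h; apply: H; exists i.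
    by rewrite /u subr_le0.
  by rewrite ltNge zx.
Qed.

(** Agreement is obtained in a neighbourhood of each point of [L], so that all derivatives agree on
    [L] too. *)
Lemma smooth_extension Om L f : open Om -> compact L -> L `<=` Om -> Pc k Om (fun _ => f) ->
  exists fb, Pc k setT (fun _ => fb) /\ forall x, L x -> \forall z \near x, fb z = f z.
Proof.
move=> oOm cL LOm pf.
have [b Hb] := choice (fun x => @point_bump Om x oOm).
have bc x : continuous (b x) by have [pb _ _ _] := Hb x; exact: Pc_continuous.
have := cL; rewrite compact_cover => /(_ 'cV[R]_n Om (fun x => [set z | 1 < b x z])).
case.
- by move=> x _; exact: (open_comp (fun z _ => bc x z) (@open_gt _ 1)).
- by move=> x Lx; exists x; [exact: LOm|have [_ _ + _] := Hb x; apply; exact: LOm].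
move=> s sOm Ls; pose be z := \sum_(x <- finmap.enum_fset s) b x z.
have pbe : Pc k setT (fun _ => be) by apply: Pc_sum => x; have [] := Hb x.
have be0 y : ~ Om y -> \forall z \near y, be z = 0.
  move=> ny; rewrite /be; elim: (finmap.enum_fset s) => [|x t IH].
    by apply: filterE => z; rewrite big_nil.
  have [_ _ _ /(_ y ny) hx] := Hb x; apply: filterS (filterI hx IH) => z [bz tz].
  by rewrite big_cons bz tz addr0.
have be1 x : L x -> \forall z \near x, 1 <= be z.
  move=> /Ls[y ys /= byx].
  have : \forall z \near x, 1 < b y z by exact: (bc y x _ (open_nbhs_nbhs (conj (@open_gt _ 1) byx))).
  apply: filterS => z bz; rewrite /be (big_rem y) //=.
  rewrite (le_trans (ltW bz)) // lerDl sumr_ge0 // => i _.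
  by have [_ + _ _] := Hb i; exact.
have [q [Cq q0 q1]] := one_sided_bump R k.
(* [chi] is 1 where [be >= 1], hence near [L], and 0 where [be = 0], hence near every point outside
   [Om]. *)
pose chi z := 1 - (q 1)^-1 * q (1 - be z).
have pchi : Pc k setT (fun _ => chi).
  apply: Pc_add; first exact: Pc_cst.
  apply: Pc_opp; apply: Pc_scale; apply: Pc_lift1_comp => //.
  by apply: Pc_add; [exact: Pc_cst|exact: Pc_opp].
pose fb z := if `[< Om z >] then chi z * f z else 0.
exists fb; split.
- apply: Pc_local => x _; have [Omx|nx] := pselect (Om x).
    exists Om => //; apply: Pc_ext (Pc_mul (Pc_sub _ pchi) pf) => //.
    move=> y Omy; apply: evnear_snd; apply: filterS (open_nbhs_nbhs (conj oOm Omy)) => z Oz.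
    by rewrite /fb asboolT.
  exists [set y | \forall z \near y, be z = 0]; first exact: be0.
  apply: Pc_ext (Pc_cst _ _ 0) => y /= Hy; apply: evnear_snd; apply: filterS Hy => z bz.
  rewrite /fb; case: asboolP => // _.
  by rewrite /chi bz subr0 mulVf ?subrr ?mul0r // gt_eqF // q1.
- move=> x Lx; apply: filterS (filterI (be1 x Lx) (open_nbhs_nbhs (conj oOm (LOm _ Lx)))) => z [bz Oz].
   rewrite /fb asboolT // /chi (q0 (1 - be z)) ?subr_le0 //.
  by rewrite mulr0 subr0 mul1r.
Qed.

End Cutoff.

Lemma near_eq_pdl (R : realType) n l (f g : 'cV[R]_n -> R) (x : 'cV[R]_n) :
  (\forall y \near x, f y = g y) -> \forall y \near x, pdl l f y = pdl l g y.
Proof.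
move=> fg; elim: l => [//|i l IH] /=.
by apply: filterS (nbhs_interior IH) => y; exact: pd_near_eq.
Qed.

Section NetSequence.
Variables (R : realType) (n k : nat) (S : R -> R).
Hypothesis CS : C1d k S.
Hypothesis nonpoly : forall m, exists b, iter m (@shift_diff R) S b != 0.
Variables (Om : set 'cV[R]_n) (f : 'cV[R]_n -> R).
Hypotheses (oOm : open Om) (pf : Pc k Om (fun _ => f)).

(** A compact exhaustion of [Om]: every point of [Om] has a neighbourhood contained in all late
    members. *)
Definition exhaust (N : nat) : set 'cV[R]_n :=
  [set z | `|z| <= N%:R /\ forall y, `|y - z| < N.+1%:R^-1 -> Om y].

Lemma exhaust_compact N : compact (exhaust N).
Proof.
apply: (@subclosed_compact _ _ [set z | `|z| <= N%:R]); last 2 first.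
- exact: compact_ball.
- by move=> z [].
have -> : exhaust N = [set z | `|z| <= N%:R] `&`
    ~` (\bigcup_(y in ~` Om) ball y N.+1%:R^-1).
  apply/seteqP; split => z /= [zN H]; split => //.
  - by move=> [y nOy]; rewrite -ball_normE /= => /H.
  - move=> y yz; apply: contrapT => nOy; apply: H; exists y => //.
    by rewrite -ball_normE.
apply: closedI; first exact: (compact_closed (@norm_hausdorff _ _) (@compact_ball _ _ _)).
by apply: open_closedC; apply: bigcup_open => y _; exact: ball_open.
Qed.

Lemma evnear_exhaust x : Om x -> evnear x exhaust.
Proof.
move=> Omx; have /nbhs_ballP[r r0 Hr] := open_nbhs_nbhs (conj oOm Omx).
rewrite -ball_normE /= in Hr.
have r20 : 0 < r / 2 by rewrite divr_gt0.
have [N0 N00 HN0] := invn_small r20.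
have [N1 HN1] : exists N1 : nat, `|x| + r <= N1%:R.
  by exists (Num.truncn (`|x| + r)).+1; rewrite ltW // truncnS_gt.
apply/evnearP; exists (maxn N0 N1), (r / 2) => // N z.
rewrite geq_max => /andP[NN0 NN1] zx; split.
  have := ler_normD (z - x) x; rewrite subrK.
  have : N1%:R <= N%:R :> R by rewrite ler_nat.
  lra.
move=> y yz; apply: Hr; rewrite /= distrC.
have h : N.+1%:R^-1 <= r / 2 by apply: HN0; exact: leqW.
have -> : y - x = (y - z) + (z - x) by rewrite addrA subrK.
rewrite [r]splitr; apply: (le_lt_trans (ler_normD _ _)).
by apply: ltrD; [exact: lt_le_trans yz h|exact: zx].
Qed.

Lemma net_sequence : exists s : nat -> seq (R * 'cV[R]_n * R),
  forall l, (size l <= k)%N -> forall x, Om x ->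
    ccvg (fun N => pdl l (net S (s N))) x (pdl l f x).
Proof.
have ex N : exists s, forall l, (size l <= k)%N -> forall x, exhaust N x ->
    `|pdl l (net S s) x - pdl l f x| <= N.+1%:R^-1.
  have sub : exhaust N `<=` Om.
    by move=> z [_ /(_ z)]; rewrite subrr normr0; apply; rewrite invr_gt0.
  have [fb [pfb Hfb]] := smooth_extension oOm (@exhaust_compact N) sub pf.
  have bnd : exhaust N `<=` [set z | `|z| < N.+1%:R].
    by move=> z [zN _] /=; apply: (le_lt_trans zN); rewrite ltr_nat.
  have N0 : 0 < N.+1%:R :> R by [].
  have [_ /(_ N.+1%:R^-1)[|s Hs]] := smooth_net_approx N0 CS nonpoly (@exhaust_compact N) bnd pfb.
    by rewrite invr_gt0.
  exists s => l lk x Ex; rewrite -(nbhs_singleton (near_eq_pdl l (Hfb x Ex))).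
  exact: Hs.
have [s Hs] := choice ex; exists s => l lk x Omx.
have cf y : Om y -> ccvg (fun _ => f) y (f y).
  by move=> Oy; have [q Hq] := Pc_lim pf Oy; exact: Pc_cst_ccvg Hq.
have cl := Pc_pdl_limit oOm pf cf lk Omx.
have c0 : ccvg (fun N z => pdl l (net S (s N)) z - pdl l f z) x 0.
  apply/cvgrPdist_le => e e0; have [N0 N00 HN0] := invn_small e0.
  suff : evnear x (fun N z => `|0 - (pdl l (net S (s N)) z - pdl l f z)| <= e) by [].
  have n0 : evnear x (fun N _ => (N0 <= N)%N) by apply: evnear_fst; exists N0.
  apply: filterS (evnearI n0 (evnear_exhaust Omx)) => -[N z] /= [NN0 Ez].
  by rewrite sub0r normrN (le_trans (Hs N l lk z Ez)) // HN0 // leqW.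
have := ccvgD c0 cl; rewrite add0r; apply: ccvg_ext.
by apply: nearW => p; rewrite subrK.
Qed.

End NetSequence.

(** * Gradient modules as an Euler scheme *)

Section Scheme.
Variables (R : realType) (d : nat).
Implicit Types (z : 'cV[R]_(1 + 1 + (d + d))) (s : seq (R * 'cV[R]_(d + 1) * R)).

Lemma zh_pack h t (x : 'cV[R]_(d + d)) : zh (pack h t x) = h.
Proof. by rewrite /zh /pack !col_mxKu mxE eqxx. Qed.

Lemma zt_pack h t (x : 'cV[R]_(d + d)) : zt (pack h t x) = t.
Proof. by rewrite /zt /pack col_mxKu col_mxKd mxE eqxx. Qed.

Lemma zx_pack h t (x : 'cV[R]_(d + d)) : zx (pack h t x) = x.
Proof. by rewrite /zx /pack col_mxKd. Qed.

Lemma mx11_eq (M : 'cV[R]_1) : (M ord0 ord0)%:M = M.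
Proof. by apply/colP => i; rewrite !mxE !ord1 eqxx mulr1n. Qed.

Lemma pack_eta z : pack (zh z) (zt z) (zx z) = z.
Proof. by rewrite /pack /zh /zt /zx !mx11_eq !vsubmxK. Qed.

Definition gradient (f : 'cV[R]_(d + 1) -> R) (y : 'cV[R]_d) (t : R) : 'cV[R]_d :=
  \col_j pd (lshift 1 j) f (col_mx y t%:M).

Lemma pd_uncurry (K : 'cV[R]_d -> R -> R) j y t :
  'D_(delta_mx j ord0) (fun y => K y t) y = pd (lshift 1 j) (uncurry_t K) (col_mx y t%:M).
Proof.
have D0 (h : R) : usubmx (h *: delta_mx (lshift 1 j) ord0 + col_mx y t%:M : 'cV[R]_(d + 1)) =
    h *: delta_mx j ord0 + y.
  by apply/colP => i; rewrite [LHS]mxE [LHS]mxE col_mxEu !mxE eq_lshift.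
have D1 (h : R) : dsubmx (h *: delta_mx (lshift 1 j) ord0 + col_mx y t%:M : 'cV[R]_(d + 1)) = t%:M.
  by apply/colP => i; rewrite [LHS]mxE [LHS]mxE col_mxEd !mxE eq_rlshift mulr0 add0r.
rewrite /pd /derive /uncurry_t /comp /=.
by under [in RHS]eq_fun do rewrite D0 D1 col_mxKu col_mxKd mxE eqxx mulr1n.
Qed.

Lemma invmx_Jmx : invmx (Jmx R d) = block_mx 0 (- 1%:M) 1%:M 0.
Proof.
have E : block_mx 0 (- 1%:M) 1%:M 0 *m Jmx R d = 1%:M.
  rewrite /Jmx mulmx_block !mul0mx !mulmx0 !addr0 !add0r mulmx1 mulNmx mulmxN mul1mx opprK.
  by rewrite -scalar_mx_block.
have [_ uJ] := mulmx1_unit E.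
by rewrite -[LHS]mul1mx -E mulmxK.
Qed.

Lemma hamF_gradient (K V : 'cV[R]_d -> R -> R) x t :
  hamF K V x t = col_mx (- gradient (uncurry_t V) (dsubmx x) t)
    (gradient (uncurry_t K) (usubmx x) t).
Proof.
have gE : gradc (fun y => Ham K V y t) x =
    col_mx (gradient (uncurry_t K) (usubmx x) t) (gradient (uncurry_t V) (dsubmx x) t).
  apply/colP => i; rewrite mxE; case: (split_ordP i) => j ->.
    have E (h : R) : Ham K V (h *: delta_mx (lshift d j) ord0 + x) t - Ham K V x t =
        K (h *: delta_mx j ord0 + usubmx x) t - K (usubmx x) t.
      have -> : h *: delta_mx (lshift d j) ord0 + x =
          col_mx (h *: delta_mx j ord0 + usubmx x) (dsubmx x).
        apply/colP => k; case: (split_ordP k) => l ->.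
          by rewrite col_mxEu !mxE eq_lshift.
        by rewrite col_mxEd !mxE eq_rlshift mulr0 add0r.
      by rewrite /Ham col_mxKu col_mxKd opprD addrACA subrr addr0.
    rewrite col_mxEu mxE -pd_uncurry /derive /comp /=.
    by under eq_fun do rewrite E.
  have E (h : R) : Ham K V (h *: delta_mx (rshift d j) ord0 + x) t - Ham K V x t =
      V (h *: delta_mx j ord0 + dsubmx x) t - V (dsubmx x) t.
    have -> : h *: delta_mx (rshift d j) ord0 + x =
        col_mx (usubmx x) (h *: delta_mx j ord0 + dsubmx x).
      apply/colP => k; case: (split_ordP k) => l ->.
        by rewrite col_mxEu !mxE eq_lrshift mulr0 add0r.
      by rewrite col_mxEd !mxE eq_rshift.
    by rewrite /Ham col_mxKu col_mxKd opprD addrACA subrr add0r.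
  rewrite col_mxEd mxE -pd_uncurry /derive /comp /=.
  by under eq_fun do rewrite E.
rewrite /hamF gE invmx_Jmx mul_block_col !mul0mx mulNmx !mul1mx add0r addr0 //.
Qed.

Variables (S sigma : R -> R).
Hypothesis DS : forall x : R, is_derive x 1 S (sigma x).
Hypothesis csigma : continuous sigma.

(** The inner weights of a network in [(y, t)] split into a space part, used as [K0], and a time
    part, used as [c]; since [S' = sigma], the module then evaluates the gradient in [y] of that
    network. *)
Definition gradient_module (up : bool) (c : R) s : natg_module R d :=
  @NATGModule R d up (size s)
    (\matrix_(i < size s, j < d) (tnth (in_tuple s) i).1.2 (lshift 1 j) ord0)
    (\row_(i < size s) (c * (tnth (in_tuple s) i).1.1))
    (\col_(i < size s) (tnth (in_tuple s) i).2)
    (\col_(i < size s) (tnth (in_tuple s) i).1.2 (rshift d ord0) ord0).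

Lemma pd_net s j (z : 'cV[R]_(d + 1)) : pd j (net S s) z =
  \sum_(p <- s) p.1.1 * (p.1.2 j ord0 * sigma (dot p.1.2 z + p.2)).
Proof.
have dS (x : R) : derivable S x 1 by have [] := DS x.
have CS : C1d 1 S by split; [exact: dS|rewrite (derive1_eq DS); exact: csigma].
have dn s' : differentiable (net S s') z
  by apply: (smooth_diff (j := 0)); exact: (smooth_net CS).
have dr (p : R * 'cV[R]_(d + 1) * R) : differentiable (fun y => S (dot p.1.2 y + p.2)) z.
  by apply: (smooth_diff (j := 0)); exact: (smooth_ridge _ _ CS).
elim: s => [|p s IH].
  rewrite big_nil; have -> : net S [::] = (fun _ : 'cV[R]_(d + 1) => 0).
    by apply/funext => y; rewrite /net big_nil.
  by rewrite pd_cst.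
have -> : net S (p :: s) = (fun y => p.1.1 * S (dot p.1.2 y + p.2) + net S s y).
  by apply/funext => y; rewrite /net big_cons.
have dc : differentiable (fun y => p.1.1 * S (dot p.1.2 y + p.2)) z.
  by apply: (@differentiableZ _ _ _ (fun y => S (dot p.1.2 y + p.2))).
rewrite pdD // pdM // pd_cst mulr0 addr0 IH big_cons.
by rewrite pd_ridge // (derive1_eq DS).
Qed.

Lemma hat_sigma_gradient_module up c s y t :
  hat_sigma sigma (gradient_module up c s) y t = c *: gradient (net S s) y t.
Proof.
apply/colP => j; rewrite /hat_sigma mul_mx_diag !mxE pd_net mulr_sumr [RHS]big_tnth.
apply: eq_bigr => i _; rewrite !mxE.
set w := tnth _ _.
have -> : dot w.1.2 (col_mx y t%:M) =
   \sum_j w.1.2 (lshift 1 j) ord0 * y j ord0 + t * w.1.2 (rshift d ord0) ord0.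
  rewrite /dot big_split_ord /= big_ord1 col_mxEd mxE eqxx mulr1n (mulrC _ t); congr (_ + _).
  by apply: eq_bigr => q _; rewrite col_mxEu.
under eq_bigr do rewrite mxE.
by rewrite /=; ring.
Qed.

(* The low half-step acts after the up half-step: [g] is evaluated at the updated
   [p] and at the intermediate time [t + h / (2 N)]. *)
Definition scheme (f g : nat -> 'cV[R]_d -> R -> 'cV[R]_d) (N : nat) z :
    'cV[R]_(1 + 1 + (d + d)) :=
  let h := zh z in let t := zt z in
  let p := usubmx (zx z) in let q := dsubmx (zx z) in
  pack 0 h (col_mx (h *: f N q t)
    (h *: g N (p + (N%:R^-1 * h) *: f N q t) (t + 2^-1 * (N%:R^-1 * h)))).

(** A module multiplies its increment by the whole of [h], so the Euler step size [1 / N] goes into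
    the outer weights, with the minus sign of the equation for [p]. *)
Definition half_steps (sK sV : nat -> seq (R * 'cV[R]_(d + 1) * R)) (N : nat) :=
  [:: gradient_module true (- N%:R^-1) (sV N); gradient_module false N%:R^-1 (sK N)].

Definition layers sK sV (N : nat) := flatten (nseq N (half_steps sK sV N)).

Lemma size_layers sK sV N : size (layers sK sV N) = (2 * N)%N.
Proof.
rewrite /layers size_flatten /shape map_nseq sumn_nseq /=.
by rewrite mulnC.
Qed.

Lemma zh_add z c z' : zh (z + c *: z') = zh z + c * zh z'.
Proof. by rewrite /zh !mxE. Qed.

Lemma zt_add z c z' : zt (z + c *: z') = zt z + c * zt z'.
Proof. by rewrite /zt !mxE. Qed.

Lemma zx_add z c z' : zx (z + c *: z') = zx z + c *: zx z'.
Proof. by apply/colP => i; rewrite !mxE. Qed.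

Lemma zh_euler_scheme f g N z : zh (euler (scheme f g) N z) = zh z.
Proof. by rewrite zh_add zh_pack mulr0 addr0. Qed.

Lemma natg_psi_scheme sK sV N z : (0 < N)%N ->
  let F := scheme (fun N y t => - gradient (net S (sV N)) y t)
                  (fun N => gradient (net S (sK N))) in
  natg_psi_x sigma (layers sK sV N) (zh z) (zt z) (zx z) = zx (iter N (euler F N) z).
Proof.
move=> N0 F; rewrite /natg_psi_x /natg_psi size_layers.
suff H k z' : zh z' = zh z ->
   foldl (fun tx u => module_step sigma (2 * N) u (zh z) tx) (zt z', zx z')
      (flatten (nseq k (half_steps sK sV N))) =
   (zt (iter k (euler F N) z'), zx (iter k (euler F N) z')).
  by rewrite H.
elim: k z' => [//|k IH] z' hz'.
have N1 : N%:R != 0 :> R by rewrite pnatr_eq0 -lt0n.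
have hE : zh z / (2 * N)%:R = 2^-1 * (N%:R^-1 * zh z').
  by rewrite hz' natrM; field.
rewrite iterSr -IH ?zh_euler_scheme //= /module_step /= !hat_sigma_gradient_module.
rewrite !col_mxKu !col_mxKd hE -hz'.
rewrite zt_add zx_add !zt_pack !zx_pack.
have -> : zt z' + 2^-1 * (N%:R^-1 * zh z') + 2^-1 * (N%:R^-1 * zh z') = zt z' + N%:R^-1 * zh z'.
  by field.
have E v : zh z' *: (- N%:R^-1 *: v) = (N%:R^-1 * zh z') *: - v.
  by rewrite scalerA scalerN -scaleNr mulrN mulrC.
rewrite E.
set p := usubmx (zx z'); set q := dsubmx (zx z').
have -> : zx z' = col_mx p q by rewrite vsubmxK.
rewrite scale_col_mx add_col_mx !scalerA.
by rewrite (mulrC (zh z')).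
Qed.

End Scheme.

(** * The limiting vector field of the scheme *)

Section SchemeLimit.
Variables (R : realType) (d : nat).
Notation state := 'cV[R]_(1 + 1 + (d + d)).
Implicit Types (z : state).

Lemma zhE z : zh z = z (lshift (d + d) (lshift 1 ord0)) ord0.
Proof. by rewrite /zh !mxE. Qed.

Lemma ztE z : zt z = z (lshift (d + d) (rshift 1 ord0)) ord0.
Proof. by rewrite /zt !mxE. Qed.

Lemma zxE z i : zx z i ord0 = z (rshift (1 + 1) i) ord0.
Proof. by rewrite mxE. Qed.

Lemma Pc_zh k A : Pc k A (fun _ => @zh R d).
Proof. by apply: Pc_eq (Pc_coord _ _ _) => N z; rewrite zhE. Qed.

Lemma Pc_zt k A : Pc k A (fun _ => @zt R d).
Proof. by apply: Pc_eq (Pc_coord _ _ _) => N z; rewrite ztE. Qed.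

Lemma Pc_zx k A i : Pc k A (fun _ z => zx z i ord0).
Proof. by apply: Pc_eq (Pc_coord _ _ _) => N z; rewrite zxE. Qed.

Lemma ccvg_zh z : ccvg (fun _ => @zh R d) z (zh z).
Proof.
rewrite zhE; apply: ccvg_ext (ccvg_coord (ccvg_id (x := z))).
by apply: nearW => p; rewrite zhE.
Qed.

Lemma ccvg_zt z : ccvg (fun _ => @zt R d) z (zt z).
Proof.
rewrite ztE; apply: ccvg_ext (ccvg_coord (ccvg_id (x := z))).
by apply: nearW => p; rewrite ztE.
Qed.

Lemma ccvg_zx z i : ccvg (fun _ z => zx z i ord0) z (zx z i ord0).
Proof.
rewrite zxE; apply: ccvg_ext (ccvg_coord (ccvg_id (x := z))).
by apply: nearW => p; rewrite zxE.
Qed.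

Lemma ccvg_col_mx m n (f : nat -> state -> 'cV[R]_m) (g : nat -> state -> 'cV[R]_n) z a b :
  ccvg f z a -> ccvg g z b -> ccvg (fun N y => col_mx (f N y) (g N y)) z (col_mx a b).
Proof.
move=> cf cg; apply: ccvg_mx => i; case: (split_ordP i) => j ->.
  rewrite col_mxEu; apply: ccvg_ext (ccvg_coord (j := j) cf).
  by apply: nearW => p; rewrite col_mxEu.
rewrite col_mxEd; apply: ccvg_ext (ccvg_coord (j := j) cg).
by apply: nearW => p; rewrite col_mxEd.
Qed.

Lemma ccvg_scalar_mx (f : nat -> state -> R) z a :
  ccvg f z a -> ccvg (fun N y => (f N y)%:M : 'cV[R]_1) z a%:M.
Proof.
move=> cf; apply: ccvg_mx => i; rewrite !mxE ord1 eqxx mulr1n.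
by apply: ccvg_ext cf; apply: nearW => p; rewrite mxE eqxx mulr1n.
Qed.

Lemma ccvg_pq z : ccvg (fun _ z => usubmx (zx z)) z (usubmx (zx z)) /\
  ccvg (fun _ z => dsubmx (zx z)) z (dsubmx (zx z)).
Proof.
split; apply: ccvg_mx => i; rewrite mxE.
  by apply: ccvg_ext (@ccvg_zx z _); apply: nearW => p; rewrite [RHS]mxE.
by apply: ccvg_ext (@ccvg_zx z _); apply: nearW => p; rewrite [RHS]mxE.
Qed.

Lemma PcV_col_mx k A m n (f : nat -> state -> 'cV[R]_m) (g : nat -> state -> 'cV[R]_n) :
  PcV k A f -> PcV k A g -> PcV k A (fun N y => col_mx (f N y) (g N y)).
Proof.
move=> pf pg i; case: (split_ordP i) => j ->.
  by apply: Pc_eq (pf j) => N z; rewrite col_mxEu.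
by apply: Pc_eq (pg j) => N z; rewrite col_mxEd.
Qed.

Lemma PcV_scalar_mx k A (f : nat -> state -> R) :
  Pc k A f -> PcV k A (fun N y => (f N y)%:M : 'cV[R]_1).
Proof. by move=> pf i; apply: Pc_eq pf => N z; rewrite mxE ord1 eqxx mulr1n. Qed.

Lemma PcV_scale k A n (c : nat -> state -> R) (f : nat -> state -> 'cV[R]_n) :
  Pc k A c -> PcV k A f -> PcV k A (fun N y => c N y *: f N y).
Proof. by move=> pc pf i; apply: Pc_eq (Pc_mul pc (pf i)) => N z; rewrite mxE. Qed.

Variables (r : nat) (Up Uq : set 'cV[R]_d).
Variables (f g : nat -> 'cV[R]_(d + 1) -> 'cV[R]_d) (f0 g0 : 'cV[R]_(d + 1) -> 'cV[R]_d).
Hypotheses (pf : PcV r [set w | Uq (usubmx w)] f) (pg : PcV r [set w | Up (usubmx w)] g).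
Hypotheses (cf : ccvgon [set w | Uq (usubmx w)] f f0)
           (cg : ccvgon [set w | Up (usubmx w)] g g0).

Let Om : set state := [set z | prodU Up Uq (zx z)].
Let F := scheme (fun N y t => f N (col_mx y t%:M)) (fun N y t => g N (col_mx y t%:M)).

Definition scheme_limit z : state :=
  pack 0 (zh z) (zh z *: col_mx (f0 (col_mx (dsubmx (zx z)) (zt z)%:M))
                               (g0 (col_mx (usubmx (zx z)) (zt z)%:M))).

Let qt z : 'cV[R]_(d + 1) := col_mx (dsubmx (zx z)) (zt z)%:M.
(** The argument of the low half-step. It differs from [(p, t)] by terms of order [1 / N], so the
    splitting leaves no trace in the limiting field. *)
Let pt N z : 'cV[R]_(d + 1) :=
  col_mx (usubmx (zx z) + (N%:R^-1 * zh z) *: f N (qt z)) (zt z + 2^-1 * (N%:R^-1 * zh z))%:M.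

Lemma ccvg_qt z : ccvg (fun _ => qt) z (qt z).
Proof.
apply: ccvg_col_mx; first by have [] := ccvg_pq z.
by apply: ccvg_scalar_mx; exact: ccvg_zt.
Qed.

Lemma ccvg_force z : Om z -> ccvg (fun N z => f N (qt z)) z (f0 (qt z)).
Proof.
move=> [_ Uz]; apply: (ccvg_comp (ccvg_qt (z := z))); apply: cf.
by rewrite /= /qt col_mxKu.
Qed.

Lemma invn_cvg0 : (fun N => N%:R^-1 : R) @ \oo --> (0 : R).
Proof.
apply/cvgrPdist_le => e e0; have [N0 N00 HN] := invn_small e0.
by exists N0 => // N /= N0N; rewrite sub0r normrN ger0_norm ?invr_ge0 // HN.
Qed.

Lemma ccvg_step_size z : ccvg (fun N z => N%:R^-1 * zh z) z 0.
Proof.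
rewrite -(mul0r (zh z)); apply: ccvgM; last exact: ccvg_zh.
exact: (ccvg_seq z invn_cvg0).
Qed.

Lemma ccvg_pt_half z : Om z -> ccvg pt z (col_mx (usubmx (zx z)) (zt z)%:M).
Proof.
move=> Oz; apply: ccvg_col_mx.
  rewrite -[X in ccvg _ _ X]addr0 -(scale0r (f0 (qt z))).
  apply: ccvgD; first by have [] := ccvg_pq z.
  by apply: ccvgZ; [exact: ccvg_step_size|exact: ccvg_force].
apply: ccvg_scalar_mx; rewrite -[X in ccvg _ _ X]addr0 -(mulr0 2^-1).
apply: ccvgD; first exact: ccvg_zt.
by apply: ccvgM; [apply: ccvg_seq; exact: cvg_cst|exact: ccvg_step_size].
Qed.

Lemma vector_field_ccvg z : Om z -> ccvg (fun N z => col_mx (f N (qt z)) (g N (pt N z))) z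
  (col_mx (f0 (qt z)) (g0 (col_mx (usubmx (zx z)) (zt z)%:M))).
Proof.
move=> Oz; have [Up_z _] := Oz; apply: ccvg_col_mx; first exact: ccvg_force.
apply: (ccvg_comp (ccvg_pt_half Oz)); apply: cg.
by rewrite /= col_mxKu.
Qed.

Lemma scheme_ccvg : ccvgon Om F scheme_limit.
Proof.
move=> z Oz; apply: ccvg_col_mx.
  apply: ccvg_col_mx; apply: ccvg_scalar_mx; last exact: ccvg_zh.
  by apply: ccvg_seq; exact: cvg_cst.
have H := ccvgZ (@ccvg_zh z) (vector_field_ccvg Oz); apply: ccvg_ext H.
by apply: nearW => p; rewrite scale_col_mx.
Qed.

Lemma PcV_force : PcV r Om (fun N z => f N (qt z)).
Proof.
move=> j; apply: (Pc_comp (F := fun _ => qt) (pf j)).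
  apply: PcV_col_mx => [i|].
    by apply: Pc_eq (Pc_zx _ _ _) => N z; rewrite [RHS]mxE.
  by apply: PcV_scalar_mx; exact: Pc_zt.
by move=> z l [_ Uz] cl; rewrite (ccvg_unique cl (ccvg_qt (z := z))) /= /qt col_mxKu.
Qed.

Lemma Pc_step_size : Pc r Om (fun N z => N%:R^-1 * zh z).
Proof. by apply: Pc_mul; [exact: Pc_seq invn_cvg0|exact: Pc_zh]. Qed.

Lemma PcV_scheme : PcV r Om F.
Proof.
apply: PcV_col_mx.
  by apply: PcV_col_mx; apply: PcV_scalar_mx; [exact: Pc_cst|exact: Pc_zh].
apply: PcV_col_mx; apply: PcV_scale; [exact: Pc_zh|exact: PcV_force|exact: Pc_zh|].
move=> j; apply: (Pc_comp (F := pt) (pg j)).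
  apply: PcV_col_mx => [i|].
    apply: (Pc_eq (f := fun N z => zx z (lshift d i) ord0 +
        (N%:R^-1 * zh z) * f N (qt z) i ord0)).
      by move=> N z; rewrite !mxE.
    apply: Pc_add; first exact: Pc_zx.
    by apply: Pc_mul; [exact: Pc_step_size|exact: PcV_force].
  apply: PcV_scalar_mx; apply: Pc_add; first exact: Pc_zt.
  by apply: Pc_scale; exact: Pc_step_size.
by move=> z l Oz cl; have [Uz _] := Oz; rewrite (ccvg_unique cl (ccvg_pt_half Oz)) /= col_mxKu.
Qed.

End SchemeLimit.

(** * Curves with prescribed derivative and changes of time *)

Section Curves.
Variables (R : realType) (n : nat).
Implicit Types (y w x v : R -> 'cV[R]_n).

Lemma is_derive_frechet y (s : R) (v : 'cV[R]_n) : is_derive s 1 y v -> forall e, 0 < e ->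
  exists2 d, 0 < d & forall u, `|u - s| <= d ->
    `|y u - y s - (u - s) *: v| <= e * `|u - s|.
Proof.
move=> [dy <-] e e0; have /derivable1_diffP df := dy.
have /nbhs_ballP[d d0 Hd] := differentiable_frechet df e0.
have d20 : 0 < d / 2 by rewrite divr_gt0.
exists (d / 2) => // u us.
have -> : (u - s) *: 'D_1 y s = 'd y s (u - s).
  by rewrite -[in RHS](mulr1 (u - s)) -[(u - s) * 1]/((u - s) *: 1) linearZ deriveE.
apply: Hd; rewrite -ball_normE /= distrC; apply: (le_lt_trans us).
by rewrite ltr_pdivrMr // ltr_pMr // ltr1n.
Qed.

Lemma frechet_is_derive y (s : R) (v : 'cV[R]_n) : (forall e, 0 < e ->
  exists2 d, 0 < d & forall u, `|u - s| <= d ->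
    `|y u - y s - (u - s) *: v| <= e * `|u - s|) -> is_derive s 1 y v.
Proof.
move=> H; have c : (fun h : R => h^-1 *: ((y \o shift s) (h *: 1) - y s)) @ 0^' --> v.
  apply/cvgrPdist_le => e e0; have [d d0 Hd] := H e e0.
  rewrite near_withinE; apply/nbhs_ballP; exists d => // h.
  rewrite -ball_normE /= sub0r normrN => hd h0.
  have hn : 0 < `|h| by rewrite normr_gt0.
  have := Hd (h *: 1 + s); rewrite addrK [h *: 1]mulr1 => /(_ (ltW hd)).
  have E : v - h^-1 *: (y (h + s) - y s) = - (h^-1 *: (y (h + s) - y s - h *: v)).
    by rewrite [in RHS]scalerBr scalerA mulVf // scale1r opprB.
  by rewrite E normrN normrZ normfV ler_pdivrMl // mulrC.
split; first by apply/cvg_ex; exists v.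
exact: cvg_lim c.
Qed.

(** Gronwall's inequality with [C = 0], after rescaling [[0, b]] to [[0, 1]]. *)
Lemma zero_slope w (b : R) : 0 <= b <= 1 ->
  (forall s, 0 <= s <= b -> forall e, 0 < e -> exists2 d, 0 < d &
    forall u, 0 <= u <= b -> `|u - s| <= d -> `|w u - w s| <= e * `|u - s|) ->
  forall s, 0 <= s <= b -> w s = w 0.
Proof.
move=> /andP[b0 b1] H s /andP[s0 sb].
have [b00|bn0] := eqVneq b 0.
  by congr w; apply/eqP; rewrite eq_le s0 -b00 sb.
have bp : 0 < b by rewrite lt_neqAle eq_sym bn0.
have sc u : 0 <= (u : R) <= 1 -> 0 <= b * u <= b.
  by move=> /andP[u0 u1]; rewrite mulr_ge0 //= ler_piMr.
have sE : s = b * (s / b) by rewrite mulrC divfK.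
suff E : w (b * (s / b)) - w 0 = 0.
  by rewrite sE; apply/eqP; rewrite -subr_eq0 E.
apply: (@gronwall_zero R n (fun u => w (b * u) - w 0) 0 (lexx 0)).
- by rewrite mulr0 subrr.
- move=> u u01 e e0; have [d d0 Hd] := H _ (sc u u01) e e0.
  exists d => // u' u'01 uu.
  have bu : `|b * u' - b * u| = b * `|u' - u| by rewrite -mulrBr normrM ger0_norm.
  have bu1 : b * `|u' - u| <= `|u' - u| by rewrite ler_piMl.
  have := Hd _ (sc u' u'01); rewrite bu => /(_ (le_trans bu1 uu)) h.
  rewrite mul0r add0r opprB addrA subrK; apply: (le_trans h).
  by rewrite ler_wpM2l // ltW.
- by rewrite divr_ge0 //= ler_pdivrMr // mul1r.
Qed.

Definition clamp (b s : R) : R := Num.max 0 (Num.min b s).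

Lemma clampP b s s0 : 0 <= s0 <= b ->
  [/\ 0 <= clamp b s <= b, `|clamp b s - s0| <= `|s - s0| & `|s - clamp b s| <= `|s - s0|].
Proof.
move=> /andP[h0 hb]; rewrite /clamp; have b0 : 0 <= b := le_trans h0 hb.
have [bs|sb] := leP b s.
  rewrite max_r //; split; first by rewrite b0 lexx.
    by rewrite !ger0_norm ?subr_ge0 //; lra.
  by rewrite !ger0_norm ?subr_ge0 //; lra.
have [s00|s00] := leP 0 s.
  by split => //; [rewrite s00 ltW|rewrite subrr normr0].
split; first by rewrite lexx b0.
  by rewrite sub0r normrN ger0_norm // ler0_norm; lra.
by rewrite subr0 !ler0_norm; lra.
Qed.

Lemma clamp_id b s : 0 <= s <= b -> clamp b s = s.
Proof. by move=> /andP[s0 sb]; rewrite /clamp min_r // max_r. Qed.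

(* A curve on a closed interval is continued linearly past the endpoints, where its
   two-sided derivative then exists. *)
Lemma time_change_extension x v (b h : R) : h != 0 ->
  (forall s, 0 <= s <= b -> forall e, 0 < e -> exists2 d, 0 < d &
    forall u, 0 <= u <= b -> `|u - s| <= d ->
      `|x u - x s - (u - s) *: (h *: v s)| <= e * `|u - s|) ->
  (forall s, 0 <= s <= b -> forall e, 0 < e -> exists2 d, 0 < d &
    forall u, 0 <= u <= b -> `|u - s| <= d -> `|v u - v s| <= e) ->
  exists w, forall s, 0 <= s <= b -> w (s * h) = x s /\ is_derive (s * h) 1 w (v s).
Proof.
move=> hn0 Hx Hv; have hp : 0 < `|h| by rewrite normr_gt0.
pose c (t : R) := clamp b (t / h).
pose w t := x (c t) + (t - c t * h) *: v (c t).
have wE s : 0 <= s <= b -> w (s * h) = x s.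
  by move=> sb; rewrite /w /c mulfK // clamp_id // subrr scale0r addr0.
exists w => s sb; split; first exact: wE.
apply: frechet_is_derive => e e0.
have [|d1 d10 Hd1] := Hx s sb (e * `|h| / 2); first by rewrite divr_gt0 // mulr_gt0.
have [|d2 d20 Hd2] := Hv s sb (e / 2); first by rewrite divr_gt0.
pose d := Num.min d1 d2; have d0 : 0 < d by rewrite lt_min d10.
exists (d * `|h|); first by rewrite mulr_gt0.
move=> t ts; have [cb cs tc] := clampP (t / h) sb.
have E : t - s * h = (t / h - s) * h by rewrite mulrBl divfK.
rewrite E normrM ler_pM2r // in ts.
have cd1 : `|c t - s| <= d1 by rewrite (le_trans cs) // (le_trans ts) // ge_min lexx.
have cd2 : `|c t - s| <= d2 by rewrite (le_trans cs) // (le_trans ts) // ge_min lexx orbT.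
have h1 := Hd1 _ cb cd1; have h2 := Hd2 _ cb cd2.
rewrite wE // /w.
have -> : x (c t) + (t - c t * h) *: v (c t) - x s - (t - s * h) *: v s =
    (x (c t) - x s - (c t - s) *: (h *: v s)) + (t - c t * h) *: (v (c t) - v s).
  by apply/colP => k; rewrite !mxE; ring.
apply: (le_trans (ler_normD _ _)).
have E2 : t - c t * h = (t / h - c t) * h by rewrite mulrBl divfK.
rewrite normrZ E2 normrM E normrM.
have -> : e * (`|t / h - s| * `|h|) =
   e * `|h| / 2 * `|t / h - s| + `|t / h - s| * `|h| * (e / 2) by field.
apply: lerD.
  apply: (le_trans h1); apply: ler_wpM2l => //.
  by rewrite divr_ge0 // mulr_ge0 // ltW.
by apply: ler_pM => //; rewrite ler_pM2r.
Qed.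

End Curves.

Lemma usubmx_increment (R : realType) m n (a b e : 'cV[R]_(m + n)) c :
  usubmx (a - b - c *: e) = usubmx a - usubmx b - c *: usubmx e.
Proof. by apply/colP => i; rewrite !mxE. Qed.

Lemma dsubmx_increment (R : realType) m n (a b e : 'cV[R]_(m + n)) c :
  dsubmx (a - b - c *: e) = dsubmx a - dsubmx b - c *: dsubmx e.
Proof. by apply/colP => i; rewrite !mxE. Qed.

(** * The flow as the unit-time map of an autonomous system *)

Section Orbits.
Variables (R : realType) (d : nat) (U : set 'cV[R]_(d + d)).
Variables (ham : 'cV[R]_(d + d) -> R -> 'cV[R]_(d + d)).
Variables (Phi : R -> R -> 'cV[R]_(d + d) -> 'cV[R]_(d + d)).
Variable (D : set 'cV[R]_(1 + 1 + (d + d))).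
Hypothesis oD : open D.
Hypothesis HDU : forall z, D z -> U (zx z) /\ U (Phi (zh z) (zt z) (zx z)).
Hypothesis Hinit : forall t0 x0, U x0 -> Phi 0 t0 x0 = x0.
Hypothesis Hode : forall z, D z ->
  is_derive (zh z) 1 (fun s => Phi s (zt z) (zx z))
    (ham (Phi (zh z) (zt z) (zx z)) (zt z + zh z)).
Hypothesis Huniq : forall t0 x0 (y : R -> 'cV[R]_(d + d)) (a b : R),
  a <= 0 -> 0 <= b -> y 0 = x0 ->
  (forall s, a <= s <= b -> U (y s) /\ is_derive s 1 y (ham (y s) (t0 + s))) ->
  forall s, a <= s <= b -> D (pack s t0 x0) -> y s = Phi s t0 x0.

Notation state := 'cV[R]_(1 + 1 + (d + d)).
Implicit Types (z : state).

(** In unit time its orbits run through [Phi] up to time [h], so that dependence on [h] becomes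
    dependence on the initial state. *)
Definition ham_field z : state := pack 0 (zh z) (zh z *: ham (zx z) (zt z)).

Let Om : set state := [set z | U (zx z)].
Hypothesis ham_continuous : forall z, Om z -> {for z, continuous (fun z => ham (zx z) (zt z))}.

(** [D] is only assumed open, so the whole time segment from 0 to [h] is required to stay in it. The
    set remains open by compactness of [[0, 1]] and admits negative [h]. *)
Definition time_interval_dom : set state :=
  [set z | forall s, 0 <= s <= 1 -> D (pack (s * zh z) (zt z) (zx z))].

Definition flow_curve z (s : R) : state :=
  pack (zh z) (zt z + s * zh z) (Phi (s * zh z) (zt z) (zx z)).

Lemma pack_add (h t h' t' c : R) (x x' : 'cV[R]_(d + d)) :
  pack h t x + c *: pack h' t' x' = pack (h + c * h') (t + c * t') (x + c *: x').
Proof.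
rewrite -[LHS]pack_eta zh_add zt_add zx_add.
by rewrite !zh_pack !zt_pack !zx_pack.
Qed.

Lemma pack0_norm (x : 'cV[R]_(d + d)) e : `|x| <= e -> `|pack 0 0 x| <= e.
Proof.
move=> xe; have e0 : 0 <= e by apply: le_trans xe.
apply: col_mx_norm => //; apply: col_mx_norm; rewrite ?raddf0 ?normr0 //.
Qed.

Lemma flow_curve_sol z : time_interval_dom z -> sol ham_field Om 1 (flow_curve z).
Proof.
move=> Dz s s01; have Ds := Dz s s01.
have := Hode Ds; have := HDU Ds; rewrite zh_pack zt_pack zx_pack => -[_ UP] der.
split; first by rewrite /Om /= /flow_curve zx_pack.
(* The summand 1 keeps [k] positive when [h = 0]. *)
move=> e e0; pose k := `|zh z| + 1; have k0 : 0 < k by rewrite ltr_wpDl.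
have [|r r0 Hr] := is_derive_frechet der (e := e / k); first by rewrite divr_gt0.
exists (r / k); first by rewrite divr_gt0.
move=> u _ us.
have E : u * zh z - s * zh z = (u - s) * zh z by rewrite mulrBl.
have hk : `|zh z| <= k by rewrite lerDl.
have usk : `|(u - s) * zh z| <= `|u - s| * k by rewrite normrM ler_wpM2l.
have := Hr (u * zh z); rewrite E => /(_ _) h.
have usr : `|u - s| * k <= r by rewrite -ler_pdivlMr.
have {}h := h (le_trans usk usr).
rewrite /flow_curve /ham_field zh_pack zt_pack zx_pack.
rewrite -[X in _ - X - _]scale1r -2!scaleNr !pack_add.
set X := (X in pack _ _ X); set a := (X in pack X _ _); set b := (X in pack _ X _).
have -> : a = 0 by rewrite /a; ring.
have -> : b = 0 by rewrite /b; ring.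
apply: pack0_norm; rewrite /X scalerA scaleN1r mulNr scaleNr.
apply: (le_trans h); apply: (@le_trans _ _ (e / k * (`|u - s| * k))).
  by rewrite ler_wpM2l // divr_ge0 // ltW.
by rewrite mulrCA divfK ?gt_eqF // mulrC.
Qed.

Lemma flow_curve0 z : time_interval_dom z -> flow_curve z 0 = z.
Proof.
move=> Dz; have [] := HDU (Dz 0 ltac:(by rewrite lexx ler01)).
rewrite zx_pack => Ux _.
by rewrite /flow_curve mul0r addr0 Hinit // pack_eta.
Qed.

Section Uniqueness.
Variables (z : state) (b : R) (y : R -> state).
Hypotheses (Dz : time_interval_dom z) (b01 : 0 <= b <= 1).
Hypotheses (sy : sol ham_field Om b y) (y0 : y 0 = z).

Lemma sol_zh s : 0 <= s <= b -> zh (y s) = zh z.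
Proof.
have H s' : 0 <= s' <= b -> usubmx (usubmx (y s')) = usubmx (usubmx (y 0)).
  apply: (zero_slope (w := fun s => usubmx (usubmx (y s))) b01) => {}s' sb e e0.
  have [_ /(_ e e0)[r r0 Hr]] := sy sb; exists r => // u ub us.
  apply: le_trans (Hr u ub us).
  apply: le_trans (usubmx_norm _); apply: le_trans (usubmx_norm _).
  rewrite le_eqVlt; apply/orP; left; apply/eqP; congr `|_|.
  rewrite !usubmx_increment /ham_field /pack !col_mxKu.
  by apply/colP => i; rewrite !mxE mul0rn mulr0 subr0.
by move=> sb; rewrite /zh (H s sb) y0.
Qed.

Lemma sol_zt s : 0 <= s <= b -> zt (y s) = zt z + s * zh z.
Proof.
pose w s := dsubmx (usubmx (y s)) - s *: (zh z)%:M.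
have H s' : 0 <= s' <= b -> w s' = w 0.
  apply: (zero_slope b01) => {}s' sb e e0.
  have [_ /(_ e e0)[r r0 Hr]] := sy sb; exists r => // u ub us.
  apply: le_trans (Hr u ub us).
  apply: le_trans (usubmx_norm _); apply: le_trans (dsubmx_norm _).
  rewrite le_eqVlt; apply/orP; left; apply/eqP; congr `|_|.
  rewrite usubmx_increment dsubmx_increment /ham_field /pack col_mxKu col_mxKd sol_zh //.
  by apply/colP => i; rewrite /w !mxE; ring.
move=> sb; have := congr1 (fun v : 'cV[R]_1 => v ord0 ord0) (H s sb).
rewrite /w !mxE eqxx mulr1n mul0r subr0 => E.
have -> : zt (y s) = zt (y 0) + s * zh z.
  by apply/eqP; rewrite -subr_eq; apply/eqP; rewrite /zt !mxE; exact: E.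
by rewrite y0.
Qed.

Let v s := ham (zx (y s)) (zt z + s * zh z).

Lemma sol_zx s : 0 <= s <= b -> forall e, 0 < e -> exists2 r, 0 < r &
  forall u, 0 <= u <= b -> `|u - s| <= r ->
    `|zx (y u) - zx (y s) - (u - s) *: (zh z *: v s)| <= e * `|u - s|.
Proof.
move=> sb e e0; have [_ /(_ e e0)[r r0 Hr]] := sy sb; exists r => // u ub us.
apply: le_trans (Hr u ub us); apply: le_trans (dsubmx_norm _).
rewrite le_eqVlt; apply/orP; left; apply/eqP; congr `|_|.
rewrite dsubmx_increment /ham_field /pack col_mxKd sol_zh //.
by rewrite /v -sol_zt.
Qed.

Lemma sol_speed_continuous s : 0 <= s <= b -> forall e, 0 < e -> exists2 r, 0 < r &
  forall u, 0 <= u <= b -> `|u - s| <= r -> `|v u - v s| <= e.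
Proof.
move=> sb e e0; have [Oys /(_ 1 ltr01)[r r0 Hr]] := sy sb.
have /cvgrPdist_le/(_ e e0)/nbhs_ballP[q q0 Hq] := ham_continuous Oys.
pose C := 1 + `|ham_field (y s)|; have C0 : 0 < C by rewrite ltr_pwDl.
have q20 : 0 < q / 2 by rewrite divr_gt0.
exists (Num.min r (q / 2 / C)); first by rewrite lt_min r0 divr_gt0.
move=> u ub; rewrite le_min => /andP[ur uq].
have near_y : `|y s - y u| < q.
  have -> : y s - y u = - ((y u - y s - (u - s) *: ham_field (y s)) + (u - s) *: ham_field (y s)).
    by rewrite subrK opprB.
  rewrite normrN; apply: (le_lt_trans (ler_normD _ _)).
  rewrite normrZ; have := Hr u ub ur; rewrite mul1r => h.
  apply: (@le_lt_trans _ _ (`|u - s| * C)); first by rewrite mulrDr mulr1 lerD2r.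
  apply: (@le_lt_trans _ _ (q / 2)); first by rewrite -ler_pdivlMr.
  by rewrite ltr_pdivrMr // ltr_pMr // ltr1n.
have := Hq (y u); rewrite -ball_normE /= => /(_ near_y).
by rewrite distrC !sol_zt.
Qed.

(** The components [h] and [t] are integrated explicitly. For [h != 0] the phase component, in the
    time [s * h], is a solution in the sense of [Huniq]; for [h = 0] it is constant. *)
Lemma sol_unique s : 0 <= s <= b -> y s = flow_curve z s.
Proof.
move=> sb; rewrite -[y s]pack_eta sol_zh // sol_zt // /flow_curve; congr pack.
have /andP[b0 b1] := b01.
have s01 : 0 <= s <= 1 by case/andP: sb => h1 h2; rewrite h1 (le_trans h2).
have Uz : U (zx z) by have [] := HDU (Dz s01); rewrite zx_pack.
have [h0|hn0] := eqVneq (zh z) 0.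
  rewrite h0 mulr0 Hinit // -[in RHS]y0.
  apply: (zero_slope (w := fun s => zx (y s)) b01) => // s' sb' e e0.
  have [r r0 Hr] := sol_zx sb' e0; exists r => // u ub us.
  by have := Hr u ub us; rewrite h0 scale0r scaler0 subr0.
have [w Hw] := time_change_extension hn0 sol_zx sol_speed_continuous.
have w0 : w 0 = zx z.
  by have [] := Hw 0 ltac:(by rewrite lexx b0); rewrite mul0r y0.
have sw t : Num.min 0 (b * zh z) <= t <= Num.max 0 (b * zh z) ->
    exists2 s', 0 <= s' <= b & t = s' * zh z.
  move=> tb; exists (t / zh z); last by rewrite divfK.
  have [hp|hp] := ltP 0 (zh z).
    have bh : 0 <= b * zh z by rewrite mulr_ge0 // ltW.
    move: tb; rewrite min_l // max_r // => /andP[t1 t2].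
    by rewrite divr_ge0 // ?(ltW hp) //= ler_pdivrMr.
  have hn : zh z < 0 by rewrite lt_neqAle hn0.
  have bh : b * zh z <= 0 by rewrite mulr_ge0_le0.
  move: tb; rewrite min_r // max_l // => /andP[t1 t2].
  by rewrite mulr_le0 ?invr_le0 //= ler_ndivrMr.
(* The time segment lies to the left of 0 when [h < 0], hence the minimum and the maximum. [Huniq]
   asks for two-sided derivatives at its ends too, which the extended curve [w] has. *)
have [<- _] := Hw s sb; apply: (Huniq (a := Num.min 0 (b * zh z)) (b := Num.max 0 (b * zh z))).
- by rewrite ge_min lexx.
- by rewrite le_max lexx.
- exact: w0.
- move=> t /sw[s' sb' ->]; have [-> dw] := Hw s' sb'; split => //.
  by have [] := sy sb'.
- case/andP: sb => s0 sb'; rewrite ge_min le_max.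
  have [hp|hp] := leP 0 (zh z).
    by rewrite mulr_ge0 //= ler_wpM2r ?orbT.
  have hn := ltW hp.
  by rewrite mulr_ge0_le0 //= (ler_wnM2r hn) ?orbT.
- exact: Dz.
Qed.

End Uniqueness.

Lemma open_time_interval_dom : open time_interval_dom.
Proof.
rewrite openE => z Dz; rewrite /interior.
have /compact_near_coveringP/near_covering_withinP cI := @segment_compact R 0 1.
suff key : \forall z' \near z, `[0, 1]%classic `<=` (fun s => D (pack (s * zh z') (zt z') (zx z'))).
  by apply: filterS key => z' H s s01; apply: H; rewrite /= in_itv.
have H := cI _ (nbhs z) (fun z' s => D (pack (s * zh z') (zt z') (zx z'))) _.
apply: H => s; rewrite /= in_itv /= => s01.
have cs : (fun p : R * state => p.1) @ filter_prod (nbhs s) (nbhs z) --> s by exact: cvg_fst.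
have cz : (fun p : R * state => p.2) @ filter_prod (nbhs s) (nbhs z) --> z by exact: cvg_snd.
have cc i : (fun p : R * state => p.2 i ord0) @ filter_prod (nbhs s) (nbhs z) --> z i ord0.
  exact: (cvg_comp _ (fun y : state => y i ord0) cz (@coord_continuous _ _ _ i ord0 z)).
have : (fun p : R * state => pack (p.1 * zh p.2) (zt p.2) (zx p.2)) @
    filter_prod (nbhs s) (nbhs z) --> pack (s * zh z) (zt z) (zx z).
  apply: cvg_mx => i j; rewrite (ord1 j) /pack; case: (split_ordP i) => k ->.
    rewrite col_mxEu; under eq_fun do rewrite col_mxEu.
    case: (split_ordP k) => l ->.
      rewrite col_mxEu; under eq_fun do rewrite col_mxEu.
      rewrite !mxE ord1 eqxx mulr1n; under eq_fun do rewrite !mxE eqxx mulr1n zhE.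
      by rewrite zhE; apply: cvgM => //; exact: cc.
    rewrite col_mxEd; under eq_fun do rewrite col_mxEd.
    rewrite !mxE ord1 eqxx mulr1n; under eq_fun do rewrite !mxE eqxx mulr1n ztE.
    by rewrite ztE; exact: cc.
  rewrite col_mxEd; under eq_fun do rewrite col_mxEd zxE.
  by rewrite zxE; exact: cc.
move=> /(_ _ (open_nbhs_nbhs (conj oD (Dz s s01)))).
move=> H'; have {}H' : filter_prod (nbhs s) (nbhs z)
  (fun p => D (pack (p.1 * zh p.2) (zt p.2) (zx p.2))) by exact: H'.
by apply: filterS H' => p Dp _.
Qed.

End Orbits.

(** * From continuous convergence to the [C^r] norm *)

Section FinalEstimates.
Variable R : realType.

Lemma compact_scalar (A : set R) : compact A -> compact [set v : 'cV[R]_1 | A (v ord0 ord0)].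
Proof.
move=> cA; have -> : [set v : 'cV[R]_1 | A (v ord0 ord0)] = (fun a => a%:M) @` A.
  apply/seteqP; split => [v /= Av|_ [a Aa <-] /=]; last by rewrite mxE eqxx mulr1n.
  by exists (v ord0 ord0) => //; exact: mx11_eq.
apply: continuous_compact => //; apply: continuous_subspaceT => x.
apply: (@cvg_mx _ _ (nbhs x)) => i j; rewrite !mxE !ord1 eqxx mulr1n.
by under eq_fun do rewrite mxE eqxx mulr1n; exact: cvg_id.
Qed.

Lemma Cr_norm_lt_eventually n k r (Dom A : set 'cV[R]_n) (G : nat -> 'cV[R]_n -> 'cV[R]_k) eps :
  open A -> compact Dom -> Dom `<=` A -> PcV r A G ->
  (forall z, A z -> ccvg G z 0) -> 0 < eps ->
  exists N0 : nat, forall N, (N0 <= N)%N -> Cr_norm_lt r Dom (G N) eps.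
Proof.
move=> oA cD DA pG G0 e0; pose T := {ffun 'I_n -> 'I_r.+1}.
(* One bound for all multi-indices; the successor makes their sum strictly smaller than [eps]. *)
pose M := eps / (#|T|.+1)%:R; have M0 : 0 < M by rewrite divr_gt0.
have [N0 HN0] : exists N0 : nat, forall N z, (N0 <= N)%N -> Dom z ->
    forall (al : T) (j : 'I_k), mindex_le al ->
    `|dalpha (fun i => al i : nat) (fun z => G N z j ord0) z| <= M.
  apply: (compact_evnear cD (P := fun N z => forall (al : T) (j : 'I_k), mindex_le al ->
    `|dalpha (fun i => al i : nat) (fun z => G N z j ord0) z| <= M)) => z Dz.
  apply: (@filter_forall _ _ _ _ _) => al; apply: (@filter_forall _ _ _ _ _) => j.
  have [al_r|/negP nal] := boolP (mindex_le al); last by apply: nearW => p h; case: nal.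
  have c0 y : A y -> ccvg (fun N z => G N z j ord0) y ((fun _ => 0) y).
    by move=> Ay; have := ccvg_coord (j := j) (G0 y Ay); rewrite mxE.
  set l := flatten [seq nseq (al i) i | i <- enum 'I_n].
  have lr : (size l <= r)%N.
    rewrite /l size_flatten /shape -map_comp sumnE big_map big_enum /=.
    by under eq_bigr do rewrite size_nseq.
  have pl0 : pdl l (fun _ : 'cV[R]_n => 0 : R) = fun _ => 0.
    by elim: l {lr} => //= i l ->; rewrite pd_cst.
  have := Pc_pdl_limit oA (pG j) c0 lr (DA _ Dz); rewrite pl0.
  move=> /cvgrPdist_le /(_ _ M0); apply: filterS => p; rewrite sub0r normrN => h _.
  by rewrite dalpha_pdl.
exists N0 => N NN0; exists (fun _ => M); split.
  by move=> al al_r z Dz j; exact: HN0.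
rewrite big_const iter_addr_0 -mulr_natr /M mulrAC ltr_pdivrMr // ltr_pM2l // ltr_nat ltnS.
exact: max_card.
Qed.

(** The potentials are approximated to order [r + 1], so that their gradients converge to order
    [r]. *)
Lemma gradient_nets r d (S : R -> R) (Om : set 'cV[R]_(d + 1)) f : C1d r.+1 S ->
  (forall m, exists b, iter m (@shift_diff R) S b != 0) -> open Om -> Ck r.+1 Om f ->
  exists s, PcV r Om (fun N w => \col_(j < d) pd (lshift 1 j) (net S (s N)) w) /\
    ccvgon Om (fun N w => \col_(j < d) pd (lshift 1 j) (net S (s N)) w)
      (fun w => \col_(j < d) pd (lshift 1 j) f w).
Proof.
move=> CS np oOm Cf; have [s Hs] := net_sequence CS np oOm (Ck_Pc oOm Cf).
exists s; split.
  move=> j; apply: (Pc_eq (f := fun N w => pd (lshift 1 j) (net S (s N)) w)).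
    by move=> N w; rewrite mxE.
  apply: Pc_of_pdl => l lr.
    move=> x _; apply: nearW => -[N z] /=.
    have lr1 : (size (rcons l (lshift 1 j)) <= r.+1)%N by rewrite size_rcons ltnW.
    have := Pc_pdl (smooth_net CS (s N)) lr1.
    rewrite size_rcons subSS -(subnSK lr) pdl_rcons; exact: smooth_diff.
  move=> x Ox; exists (pdl l (pd (lshift 1 j) f) x).
  under eq_fun do rewrite -pdl_rcons; rewrite -pdl_rcons.
  by apply: Hs => //; rewrite size_rcons.
move=> w Ow; apply: ccvg_mx => j; rewrite mxE.
apply: ccvg_ext (Hs [:: lshift 1 j] _ w Ow) => //.
by apply: nearW => p; rewrite mxE.
Qed.

End FinalEstimates.

Theorem theorem4p6 (R : realType) (d r : nat) (sigma : R -> R)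
  (Hsig : CrR r sigma) (Hfin : rfinite r sigma)
  (Up Uq : set 'cV[R]_d) (oUp : open Up) (oUq : open Uq)
  (K V : 'cV[R]_d -> R -> R)
  (HK : Ck r.+1 [set z : 'cV[R]_(d + 1) | Up (usubmx z)] (uncurry_t K))
  (HV : Ck r.+1 [set z : 'cV[R]_(d + 1) | Uq (usubmx z)] (uncurry_t V))
  (Phi : R -> R -> 'cV[R]_(d + d) -> 'cV[R]_(d + d))
  (D : set 'cV[R]_(1 + 1 + (d + d)))
  (oD : open D)
  (HDex : forall h t0 x0, 0 <= h -> 0 <= t0 -> prodU Up Uq x0 -> D (pack h t0 x0))
  (HDU : forall z, D z -> prodU Up Uq (zx z) /\
                          prodU Up Uq (Phi (zh z) (zt z) (zx z)))
  (Hinit : forall t0 x0, prodU Up Uq x0 -> Phi 0 t0 x0 = x0)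
  (Hode : forall z, D z ->
     is_derive (zh z) 1 (fun s => Phi s (zt z) (zx z))
               (hamF K V (Phi (zh z) (zt z) (zx z)) (zt z + zh z)))
  (Huniq : forall t0 x0 (y : R -> 'cV[R]_(d + d)) (a b : R),
     a <= 0 -> 0 <= b -> y 0 = x0 ->
     (forall s, a <= s <= b ->
        prodU Up Uq (y s) /\ is_derive s 1 y (hamF K V (y s) (t0 + s))) ->
     forall s, a <= s <= b -> D (pack s t0 x0) -> y s = Phi s t0 x0)
  (T : R) (HT : 0 < T)
  (Wt : set R) (cWt : compact Wt) (Wt0 : Wt `<=` [set t | 0 <= t])
  (W : set 'cV[R]_(d + d)) (cW : compact W) (WU : W `<=` prodU Up Uq)
  (eps : R) (Heps : 0 < eps) :
  exists us : seq (natg_module R d),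
    (0 < size us)%N /\
    Cr_norm_lt r [set z | 0 <= zh z <= T /\ Wt (zt z) /\ W (zx z)]
      (fun z => Phi (zh z) (zt z) (zx z) - natg_psi_x sigma us (zh z) (zt z) (zx z))
      eps.
Proof.
have csig : continuous sigma by exact: C1d_cont (CrR_C1d Hsig).
have [S DS] := antiderivative csig.
have CS : C1d r.+1 S.
  by split; [move=> x; have [] := DS x|rewrite (derive1_eq DS); exact: CrR_C1d].
have np := rfinite_nonpolynomial Hsig Hfin DS.
have [sK [pK cK]] := gradient_nets CS np (open_usubmx oUp) HK.
have [sV [pV cV]] := gradient_nets CS np (open_usubmx oUq) HV.
pose f N (w : 'cV[R]_(d + 1)) := - \col_(j < d) pd (lshift 1 j) (net S (sV N)) w.
pose g N (w : 'cV[R]_(d + 1)) := \col_(j < d) pd (lshift 1 j) (net S (sK N)) w.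
pose f0 (w : 'cV[R]_(d + 1)) := - \col_(j < d) pd (lshift 1 j) (uncurry_t V) w.
pose g0 (w : 'cV[R]_(d + 1)) := \col_(j < d) pd (lshift 1 j) (uncurry_t K) w.
have pf : PcV r [set w | Uq (usubmx w)] f.
  by move=> j; apply: Pc_eq (Pc_opp (pV j)) => N w; rewrite [RHS]mxE.
have cf : ccvgon [set w | Uq (usubmx w)] f f0.
  by move=> w Uw; apply: ccvgN; exact: cV.
pose Om := [set z : 'cV[R]_(1 + 1 + (d + d)) | prodU Up Uq (zx z)].
have oOm : open Om.
  apply: (@open_comp _ _ (fun z => zx z)); first by move=> z _; exact: dsubmx_continuous.
  apply: openI; apply: open_comp => // z _; [exact: usubmx_continuous|exact: dsubmx_continuous].
pose F := scheme (fun N y t => f N (col_mx y t%:M)) (fun N y t => g N (col_mx y t%:M)).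
have hamE z : hamF K V (zx z) (zt z) = col_mx (f0 (col_mx (dsubmx (zx z)) (zt z)%:M))
    (g0 (col_mx (usubmx (zx z)) (zt z)%:M)) by rewrite hamF_gradient.
have cF : ccvgon Om F (ham_field (hamF K V)).
  by move=> z Oz; have := scheme_ccvg cf cK Oz; rewrite /scheme_limit -hamE.
have pF : PcV r Om F := PcV_scheme pf pK cf.
(* The Hamiltonian field is the continuous limit of the network fields, hence continuous. *)
have chamz z : Om z -> {for z, continuous (fun z => hamF K V (zx z) (zt z))}.
  have c y : Om y -> ccvg (fun N z => col_mx (f N (col_mx (dsubmx (zx z)) (zt z)%:M))
      (g N (col_mx (usubmx (zx z) + (N%:R^-1 * zh z) *: f N (col_mx (dsubmx (zx z)) (zt z)%:M))
        (zt z + 2^-1 * (N%:R^-1 * zh z))%:M))) y (hamF K V (zx y) (zt y)).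
    by move=> Oy; rewrite hamE; exact: (vector_field_ccvg cf cK Oy).
  move=> Oz; apply: (ccvg_limit_continuous _ (c z Oz)).
  exact: (filterS c (open_nbhs_nbhs (conj oOm Oz))).
pose A := time_interval_dom D.
have oA : open A := open_time_interval_dom oD.
have solA z (Az : A z) := flow_curve_sol HDU Hode Az.
have uniqA z b y (Az : A z) (b01 : 0 <= b <= 1) sy y0 :=
  sol_unique HDU Hinit Huniq chamz Az b01 sy y0 : forall s, 0 <= s <= b -> y s = flow_curve Phi z s.
have HA z : A z -> uniq_sol (ham_field (hamF K V)) Om z /\
    exists L, [/\ L `<=` Om, compact L & confined F L z].
  move=> Az; split.
    move=> y1 y2 s1 s2 h1 h2 s s01.
    by rewrite (uniqA z 1 y1 Az _ s1 h1) ?(uniqA z 1 y2 Az _ s2 h2) ?lexx ?ler01.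
  apply: (confined_of_solution oOm cF (solA z Az) (flow_curve0 HDU Hinit Az)) => b y b01 sy y0.
  exact: uniqA.
have pE := euler_smooth oOm oA pF cF HA.
have cE z : A z -> ccvg (fun N => iter N (euler F N)) z (flow_curve Phi z 1).
  move=> Az; have [uz [L [LO cL HL]]] := HA z Az.
  have [Y [sY Y0 _ HY]] := euler_cvg cF LO cL HL uz.
  have i01 : 0 <= (1 : R) <= 1 by rewrite lexx ler01.
  rewrite -(uniqA z 1 Y Az i01 sY Y0 1 i01).
  apply/cvgrPdist_le => e e0.
  have N1 : evnear z (fun N _ => (0 < N)%N) by apply: evnear_fst; exists 1%N.
  apply: filterS (evnearI N1 (HY e e0)) => -[N z'] /= [N0 /(_ N (leqnn N))].
  by rewrite divff ?pnatr_eq0 -?lt0n // distrC.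
pose G N z := Phi (zh z) (zt z) (zx z) - zx (iter N (euler F N) z).
have cEj z j : A z -> ccvg (fun N z => iter N (euler F N) z (rshift (1 + 1) j) ord0) z
    (Phi (zh z) (zt z) (zx z) j ord0).
  move=> Az; have := ccvg_coord (j := rshift (1 + 1) j) (cE z Az).
  by rewrite /flow_curve mul1r -zxE zx_pack.
(* [Phi] is itself of class [C^r] on [A], as the limit of the iterates, so the error [G] converges
   with its derivatives. *)
have pG : PcV r A G.
  move=> j; have pj := pE (rshift (1 + 1) j).
  have pPhi := Pc_limit oA pj (fun z Az => cEj z j Az).
  by apply: Pc_eq (Pc_add pPhi (Pc_opp pj)) => N z; rewrite /G !mxE.
have G0 z : A z -> ccvg G z 0.
  move=> Az; apply: ccvg_mx => j; rewrite mxE.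
  have pPhi := Pc_limit oA (pE (rshift (1 + 1) j)) (fun z Az => cEj z j Az).
  have [l Hl] := Pc_lim pPhi Az.
  have := ccvgB (Pc_cst_ccvg Hl) (cEj z j Az); rewrite subrr.
  by apply: ccvg_ext; apply: nearW => p; rewrite /G !mxE.
set Dom := [set z | _].
have cDom : compact Dom.
  have cT := compact_scalar (@segment_compact R 0 T).
  have := compact_col_mx (compact_col_mx cT (compact_scalar cWt)) cW.
  congr compact; apply/seteqP; split => z /=.
    by rewrite /Dom /= in_itv /= => -[[]].
  by rewrite /Dom /= in_itv /= => -[? []].
have DA : Dom `<=` A.
  move=> z [/andP[h0 _] [tz xz]] s /andP[s0 _]; apply: HDex.
  - by rewrite mulr_ge0.
  - exact: Wt0.
  - exact: WU.
have [N0 HN0] := Cr_norm_lt_eventually oA cDom DA pG G0 Heps.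
(* The successor guarantees a positive number of steps, as [natg_psi_scheme] requires. *)
exists (layers sK sV N0.+1); split; first by rewrite size_layers.
have := HN0 N0.+1 (leqnSn N0); congr (Cr_norm_lt r Dom _ eps); apply/funext => z.
by rewrite (natg_psi_scheme DS csig).
Qed.
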